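(* There exists an algorithm that, given a prenex pp-formula $\phi$ (with liberal variables), outputs a $\sharp\mathsf{PP}$-representation $\psi$ of $\phi$ of minimum width, i.e., such that no $\sharp\mathsf{PP}$-representation of $\phi$ has smaller $\mathsf{width}$ than $\psi$.
   Context: Structures are finite relational structures over a signature $\tau$ (no equality). A pp-formula is built from atoms $R(v_1,\dots,v_k)$ using $\wedge$ and $\exists$; a prenex pp-formula $\phi$ with liberal variables $S\supseteq\mathrm{free}(\phi)$ defines, for a structure $\mathbf{B}$, the set $\phi(\mathbf{B})$ of assignments $f:S\to B$ with $\mathbf{B},f\models\phi$. $\sharp$-formulas: inductively, with free and closed variable sets: $C(\phi,L)$ ($\phi$ first-order, $L\supseteq\mathrm{free}(\phi)$; free $L$, closed $\emptyset$); $PV\psi$ ($V\cap\mathrm{closed}(\psi)=\emptyset$; free $\mathrm{free}(\psi)\setminus V$, closed $V\cup\mathrm{closed}(\psi)$); $EV\psi$ ($V$ disjoint from free and closed variables of $\psi$; free $V\cup\mathrm{free}(\psi)$, closed $\mathrm{closed}(\psi)$); $\psi\times\psi'$ (equal free sets, disjoint closed sets; free $\mathrm{free}(\psi)$, closed the union); $\psi+\psi'$ (equal free sets; closed the union); $n\in\mathbb{Z}$ (no free or closed variables). Semantics, for $h:\mathrm{free}\to B$: $[\mathbf{B},C(\phi,L)](h)$ is $1$ if $\mathbf{B},h\models\phi$ else $0$; $[\mathbf{B},PV\psi](h)=\sum[\mathbf{B},\psi](h')$ over extensions $h'$ of $h$ to $\mathrm{free}(\psi)\cup V$; $[\mathbf{B},EV\psi](h)=[\mathbf{B},\psi](h|_{\mathrm{free}(\psi)})$;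 $\times,+$ pointwise; $[\mathbf{B},n](h)=n$. $\mathsf{width}(\psi)$ is the maximum of $|\mathrm{free}(\theta)|$ over all $\sharp$-subformulas $\theta$ (subtrees of the formula tree) and all fo-subformulas $\theta$ (subformulas of first-order formulas $\phi$ occurring as $C(\phi,L)$). A $\sharp\mathsf{PP}$-formula is one where each $C(\phi,L)$ has $\phi$ a pp-formula. A $\sharp$-sentence $\psi$ (no free variables) represents $\phi(S)$ if $|\phi(\mathbf{B})|=[\mathbf{B},\psi](\epsilon)$ for every finite $\mathbf{B}$, $\epsilon$ the empty assignment. *)

(* Defs.v *)
From HB Require Import structures.
From mathcomp Require Import all_boot all_order all_algebra finmap.

Set Implicit Arguments.
Unset Strict Implicit.
Unset Printing Implicit Defensive.

Import GRing.Theory.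

Local Open Scope nat_scope.
Local Open Scope fset_scope.
Local Open Scope fmap_scope.

(* A signature with k relation symbols, the i-th one of arity nth 0 tau i. *)
Definition signature := seq nat.

Definition symbol (tau : signature) := 'I_(size tau).

Definition arity (tau : signature) (R : symbol tau) : nat := nth 0 tau R.

(* The empty universe is allowed. *)
Record structure (tau : signature) := Structure {
  dom :> finType;
  interp : forall R : symbol tau, {set (arity R).-tuple dom}
}.

Definition var := nat.

Inductive fo (tau : signature) : Type :=
| Atom (R : symbol tau) (vs : (arity R).-tuple var)
| Neg (phi : fo tau)
| And (phi phi' : fo tau)
| Or (phi phi' : fo tau)
| Ex (x : var) (phi : fo tau)
| All (x : var) (phi : fo tau).

Fixpoint fo_free tau (phi : fo tau) : {fset var} :=
  match phi with
  | Atom _ vs => [fset x in tval vs]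
  | Neg phi => fo_free phi
  | And phi phi' | Or phi phi' => fo_free phi `|` fo_free phi'
  | Ex x phi | All x phi => fo_free phi `\ x
  end.

Fixpoint fo_subformulas tau (phi : fo tau) : seq (fo tau) :=
  phi :: match phi with
         | Atom _ _ => [::]
         | Neg phi | Ex _ phi | All _ phi => fo_subformulas phi
         | And phi phi' | Or phi phi' =>
             fo_subformulas phi ++ fo_subformulas phi'
         end.

Fixpoint is_pp tau (phi : fo tau) : bool :=
  match phi with
  | Atom _ _ => true
  | And phi phi' => is_pp phi && is_pp phi'
  | Ex _ phi => is_pp phi
  | _ => false
  end.

Fixpoint is_conjunction_of_atoms tau (phi : fo tau) : bool :=
  match phi with
  | Atom _ _ => true
  | And phi phi' => is_conjunction_of_atoms phi && is_conjunction_of_atoms phi'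
  | _ => false
  end.

Fixpoint is_prenex_pp tau (phi : fo tau) : bool :=
  match phi with
  | Ex _ phi => is_prenex_pp phi
  | _ => is_conjunction_of_atoms phi
  end.

(* Assignments are finite maps; fo_sat is meant for maps h whose domain
   contains the free variables of phi, and an atom mentioning a variable
   outside of the domain counts as false. *)
Fixpoint fo_sat tau (B : structure tau) (phi : fo tau) (h : {fmap var -> B})
    : bool :=
  match phi with
  | Atom R vs =>
      [exists b in interp B R, [seq h.[? x] | x <- vs] == [seq Some a | a <- b]]
  | Neg phi => ~~ fo_sat phi h
  | And phi phi' => fo_sat phi h && fo_sat phi' h
  | Or phi phi' => fo_sat phi h || fo_sat phi' h
  | Ex x phi => [exists b : B, fo_sat phi h.[x <- b]]
  | All x phi => [forall b : B, fo_sat phi h.[x <- b]]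
  end.

Definition answers tau (B : structure tau) (phi : fo tau) (S : {fset var})
    : {set {ffun S -> B}} :=
  [set f : {ffun S -> B} | fo_sat phi (FinMap f)].

Inductive sharp (tau : signature) : Type :=
| Cast (phi : fo tau) (L : {fset var})
| Proj (V : {fset var}) (psi : sharp tau)
| Expand (V : {fset var}) (psi : sharp tau)
| Times (psi psi' : sharp tau)
| Plus (psi psi' : sharp tau)
| Const (n : int).

Arguments Const tau n : clear implicits.

Fixpoint sh_free tau (psi : sharp tau) : {fset var} :=
  match psi with
  | Cast _ L => L
  | Proj V psi => sh_free psi `\` V
  | Expand V psi => V `|` sh_free psi
  | Times psi _ | Plus psi _ => sh_free psi
  | Const _ => fset0
  end.

Fixpoint sh_closed tau (psi : sharp tau) : {fset var} :=
  match psi with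
  | Cast _ _ => fset0
  | Proj V psi => V `|` sh_closed psi
  | Expand _ psi => sh_closed psi
  | Times psi psi' | Plus psi psi' => sh_closed psi `|` sh_closed psi'
  | Const _ => fset0
  end.

Fixpoint is_sharp tau (psi : sharp tau) : bool :=
  match psi with
  | Cast phi L => fo_free phi `<=` L
  | Proj V psi => is_sharp psi && fdisjoint V (sh_closed psi)
  | Expand V psi =>
      [&& is_sharp psi, fdisjoint V (sh_free psi)
        & fdisjoint V (sh_closed psi)]
  | Times psi psi' =>
      [&& is_sharp psi, is_sharp psi', sh_free psi == sh_free psi'
        & fdisjoint (sh_closed psi) (sh_closed psi')]
  | Plus psi psi' =>
      [&& is_sharp psi, is_sharp psi' & sh_free psi == sh_free psi']
  | Const _ => true
  end.

Fixpoint all_casts_pp tau (psi : sharp tau) : bool :=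
  match psi with
  | Cast phi _ => is_pp phi
  | Proj _ psi | Expand _ psi => all_casts_pp psi
  | Times psi psi' | Plus psi psi' => all_casts_pp psi && all_casts_pp psi'
  | Const _ => true
  end.

Definition is_sharpPP tau (psi : sharp tau) : bool :=
  is_sharp psi && all_casts_pp psi.

(* For h with domain sh_free (Proj V psi), the maps h + FinMap g are exactly the
   extensions of h to sh_free psi `|` V.  Variables of V that are not free in
   psi therefore contribute a factor #|B| each. *)
Fixpoint sh_eval tau (B : structure tau) (psi : sharp tau)
    (h : {fmap var -> B}) : int :=
  match psi with
  | Cast phi _ => ((fo_sat phi h : nat)%:Z)%R
  | Proj V psi =>
      (\sum_(g : {ffun V -> B}) sh_eval psi (h + FinMap g)%fset.[& sh_free psi])%R
  | Expand _ psi => sh_eval psi h.[& sh_free psi]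
  | Times psi psi' => (sh_eval psi h * sh_eval psi' h)%R
  | Plus psi psi' => (sh_eval psi h + sh_eval psi' h)%R
  | Const n => n
  end.

Fixpoint sharp_subformulas tau (psi : sharp tau) : seq (sharp tau) :=
  psi :: match psi with
         | Cast _ _ | Const _ => [::]
         | Proj _ psi | Expand _ psi => sharp_subformulas psi
         | Times psi psi' | Plus psi psi' =>
             sharp_subformulas psi ++ sharp_subformulas psi'
         end.

Fixpoint sharp_fo_subformulas tau (psi : sharp tau) : seq (fo tau) :=
  match psi with
  | Cast phi _ => fo_subformulas phi
  | Proj _ psi | Expand _ psi => sharp_fo_subformulas psi
  | Times psi psi' | Plus psi psi' =>
      sharp_fo_subformulas psi ++ sharp_fo_subformulas psi'
  | Const _ => [::]
  end.

Definition width tau (psi : sharp tau) : nat :=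
  maxn (\max_(theta <- sharp_subformulas psi) #|` sh_free theta|)
       (\max_(theta <- sharp_fo_subformulas psi) #|` fo_free theta|).

Definition represents tau (psi : sharp tau) (phi : fo tau) (S : {fset var})
    : Prop :=
  [/\ is_sharp psi, sh_free psi = fset0
    & forall B : structure tau,
        (#|answers B phi S|%:Z)%R = sh_eval psi ([fmap] : {fmap var -> B})].

Definition sharpPP_representation tau (psi : sharp tau) (phi : fo tau)
    (S : {fset var}) : Prop :=
  is_sharpPP psi /\ represents psi phi S.

(* Algorithms are partial recursive functions of one variable, built with a
   pairing function as in Mathlib's Nat.Partrec.  The pairing is bijective:
   every positive integer is uniquely 2 ^ a * (2 * b + 1). *)
Definition npair (a b : nat) : nat := (2 ^ a * b.*2.+1).-1.

Inductive recfun : Type :=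
| RZero
| RSucc
| RLeft
| RRight
| RPair (f g : recfun)
| RComp (f g : recfun)
| RPrec (f g : recfun)
| RMin (f : recfun).

(* computes p x y : p halts on input x with output y. *)
Fixpoint computes (p : recfun) (x y : nat) : Prop :=
  match p with
  | RZero => y = 0
  | RSucc => y = x.+1
  | RLeft => exists b, x = npair y b
  | RRight => exists a, x = npair a y
  | RPair f g =>
      exists u v, [/\ computes f x u, computes g x v & y = npair u v]
  | RComp f g => exists2 z, computes g x z & computes f z y
  | RPrec f g =>
      exists a n, x = npair a n /\
      (fix iterate (k z : nat) : Prop :=
         match k with
         | 0 => computes f a z
         | k'.+1 => exists2 w,
             iterate k' w & computes g (npair a (npair k' w)) z
         end) n y
  | RMin f =>
      computes f (npair x y) 0 /\
      forall i, i < y -> exists k, computes f (npair x i) k.+1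
  end.

Definition code_vars (V : {fset var}) : nat :=
  CodeSeq.code (sort leq (enum_fset V)).

Definition code_int (n : int) : nat :=
  match n with
  | Posz m => npair 0 m
  | Negz m => npair 1 m
  end.

(* The signature is not part of a code: an atom is coded by the index of its
   symbol and its list of arguments, whose length gives the arity. *)
Fixpoint code_fo tau (phi : fo tau) : nat :=
  match phi with
  | Atom R vs => npair 0 (npair R (CodeSeq.code vs))
  | Neg phi => npair 1 (code_fo phi)
  | And phi phi' => npair 2 (npair (code_fo phi) (code_fo phi'))
  | Or phi phi' => npair 3 (npair (code_fo phi) (code_fo phi'))
  | Ex x phi => npair 4 (npair x (code_fo phi))
  | All x phi => npair 5 (npair x (code_fo phi))
  end.

Fixpoint code_sharp tau (psi : sharp tau) : nat :=
  match psi with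
  | Cast phi L => npair 0 (npair (code_fo phi) (code_vars L))
  | Proj V psi => npair 1 (npair (code_vars V) (code_sharp psi))
  | Expand V psi => npair 2 (npair (code_vars V) (code_sharp psi))
  | Times psi psi' => npair 3 (npair (code_sharp psi) (code_sharp psi'))
  | Plus psi psi' => npair 4 (npair (code_sharp psi) (code_sharp psi'))
  | Const n => npair 5 (code_int n)
  end.

Definition code_input tau (phi : fo tau) (S : {fset var}) : nat :=
  npair (code_fo phi) (code_vars S).

(* Main.v *)
(** A pp-formula with liberal variables is a finite structure with a marked set
    of elements.  Multiplying out the sums and constants of a sharp-PP formula of
    width k writes its value as an integer combination of counts |theta_i(B)|,
    where each pp-formula theta_i inherits from the formula an order in which its
    variables can be eliminated, quantified ones first, at cost at most k.  If
    this combination equals |phi(B)| for all B, then some theta_i is renaming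
    equivalent to phi: blowing up structures and inclusion-exclusion isolate the
    answers that hit all marked elements, and the resulting matrix of weights is
    triangular for the homomorphism order.  A composite phi -> theta_i -> phi with
    the smallest possible image is an endomorphism h of phi whose image embeds
    into theta_i, so the elimination order of theta_i can be pulled back to the
    image of phi under h.

    Conversely, an endomorphism h of phi permuting the liberal variables together
    with an order of the variables yields, by elimination, a representation whose
    width is the cost of the elimination.  Hence the algorithm runs through the
    finitely many pairs of an endomorphism and an order and keeps the cheapest
    one. *)

Require Import Defs.
From mathcomp Require Import all_boot all_order all_algebra finmap.

Set Implicit Arguments.
Unset Strict Implicit.
Unset Printing Implicit Defensive.

Local Open Scope nat_scope.

(** * Elimination of the vertices of a hypergraph *)

(** Both bounds meet in the hypergraph whose edges are the argument lists of the atoms: [elimok]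
    measures there, without any formula, how many free variables an elimination order produces.
    Quantified variables precede liberal ones because [Ex] occurs only inside a cast, whereas [Proj]
    acts outside it. A count forgets which liberal variable is which, so the endomorphism need only
    permute them, and the comparison [ple] asks only that they be covered. In the matrix of weights,
    doubling a marked element that an answer hits m times contributes 2^m, and inclusion-exclusion
    turns this into 2^m - 1. All terms are thus nonnegative, nothing cancels, and a weight is
    nonzero exactly when the two formulas are comparable. The empty structure shapes many details.
    Canonical structures and the identities tested on them are restricted to inhabited ones, an
    input without any variable is treated apart, and the construction keeps quantifying over
    variables that occur in no atom. Formulas have no normal form here: the elimination is written
    once over abstract operations, and the program on codes is obtained from the one on formulas by
    a morphism. *)

Section Elimination.
Variable T : eqType.
Implicit Types (E : seq (seq T)) (v : T) (F : pred T).

Definition nbhd v E : seq T := flatten [seq e <- E | v \in e].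

Definition elim_step v E : seq (seq T) :=
  [seq u <- nbhd v E | u != v] :: [seq e <- E | v \notin e].

Arguments elim_step : simpl never.

(** [F] holds the vertices allowed to survive, namely the free variables. The bound [k] applies to
    the edges at every stage as well as to the neighbourhoods, since each edge stands for a
    subformula whose free variables count. A neighbourhood contains [v] itself: it is the set of
    free variables just before [v] is bound. *)
Fixpoint elimok k F E (vs : seq T) : bool :=
  all (fun e => size (undup e) <= k) E &&
  match vs with
  | [::] => all (all F) E
  | v :: vs' => (size (undup (nbhd v E)) <= k) && elimok k F (elim_step v E) vs'
  end.

Lemma mem_nbhd v E u :
  reflect (exists2 e, e \in E & (v \in e) && (u \in e)) (u \in nbhd v E).
Proof.
apply: (iffP flattenP) => [[e]|[e eE /andP[ve ue]]].
  by rewrite mem_filter => /andP[ve eE] ue; exists e => //; rewrite ve ue.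
by exists e; rewrite // mem_filter ve.
Qed.

Lemma elimok_sub k F F' E vs :
  subpred F F' -> elimok k F E vs -> elimok k F' E vs.
Proof.
move=> FF'; elim: vs E => [|v vs IH] E /= /andP[-> ] /=.
  by apply: sub_all => e; apply: sub_all.
by case/andP=> -> /IH.
Qed.

End Elimination.

Lemma size_undup_le (T : eqType) (s s' : seq T) :
  {subset s <= s'} -> size (undup s) <= size (undup s').
Proof.
by move=> ss'; apply: uniq_leq_size (undup_uniq s) _ => x; rewrite !mem_undup => /ss'.
Qed.

(* Empty edges are exempted, so that eliminating an isolated vertex is harmless. *)
Definition dominated (T T' : eqType) (a : T -> T') (E : seq (seq T))
    (E' : seq (seq T')) :=
  forall e, e \in E -> e = [::] \/ exists2 e', e' \in E' & {subset map a e <= e'}.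

(** An order for [E'] is replayed on [E]. Eliminating [a v] is matched by eliminating [v]. A vertex
    without preimage is skipped on the side of [E], because its elimination only merges edges of
    [E'], which cannot destroy domination. [C] is the region where [a] is invertible; in the lower
    bound it is the image of an endomorphism. *)
Lemma elimok_dominated (T T' : eqType) (a : T -> T') (inv : T' -> option T)
    (C : pred T) k (F : pred T') E E' vs :
  ocancel inv a -> (forall v, C v -> inv (a v) = Some v) ->
  all (all C) E -> dominated a E E' ->
  elimok k F E' vs -> elimok k (preim a F) E (pmap inv vs).
Proof.
move=> inv_a a_inv.
have injC : {in C &, injective a}.
  by move=> u v Cu Cv eq_uv; have := a_inv u Cu; rewrite eq_uv a_inv // => -[].
have sizeC (N : seq T) (N' : seq T') : all C N -> {subset map a N <= N'} ->
    size (undup N) <= size (undup N').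
  move=> /allP CN NN'; rewrite -(size_map a); apply: uniq_leq_size.
    rewrite map_inj_in_uniq ?undup_uniq // => u v.
    by rewrite !mem_undup => /CN Cu /CN Cv; apply: injC.
  move=> t /mapP[u]; rewrite mem_undup => uN ->.
  by rewrite mem_undup; apply/NN'/map_f.
have edges E1 E1' : all (all C) E1 -> dominated a E1 E1' ->
    all (fun e => size (undup e) <= k) E1' ->
    all (fun e => size (undup e) <= k) E1.
  move=> /allP CE1 dE1 /allP kE1'; apply/allP => e eE1.
  case: (dE1 e eE1) => [-> //|[e' /kE1' ke' ee']].
  by apply: leq_trans ke'; apply: sizeC => //; apply: CE1.
have nbhd_sub (v : T) E1 E1' : dominated a E1 E1' ->
    {subset map a (nbhd v E1) <= nbhd (a v) E1'}.
  move=> dE1 t /mapP[u /mem_nbhd[e eE1 /andP[ve ue]] ->].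
  case: (dE1 e eE1) => [e0|[e' e'E1' ee']]; first by rewrite e0 in ve.
  by apply/mem_nbhd; exists e'; rewrite // !ee' ?map_f.
have nbhdC (v : T) E1 : all (all C) E1 -> all C (nbhd v E1).
  move=> /allP CE1; apply/allP => u /mem_nbhd[e eE1 /andP[_ ue]].
  by move/allP: (CE1 e eE1); apply.
have step_dom (t : T') (E1' : seq (seq T')) (e : seq T) :
    (exists2 e', e' \in E1' & {subset map a e <= e'}) -> t \notin map a e ->
    exists2 e', e' \in elim_step t E1' & {subset map a e <= e'}.
  move=> [e' e'E1' ee'] tNe; case: (boolP (t \in e')) => te'; last first.
    by exists e'; rewrite // inE mem_filter te' e'E1' orbT.
  exists [seq u <- nbhd t E1' | u != t]; first exact: mem_head.
  move=> u ue; rewrite mem_filter; apply/andP; split.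
    by apply: contraNneq tNe => <-.
  by apply/mem_nbhd; exists e'; rewrite // te' ee'.
elim: vs E E' => [|t vs IH] E E' CE dE /= /andP[kE'].
  move=> /allP FE'; rewrite (edges _ _ CE dE kE') /=.
  apply/allP => e eE; case: (dE e eE) => [-> //|[e' /FE' /allP Fe' ee']].
  by apply/allP => u ue; apply/Fe'/ee'/map_f.
case/andP=> kN ok.
(* If [t] has no preimage, no edge of [E] maps onto it, so [E] stays as it is while [E']
   advances. *)
case invt: (inv t) => [v|] /=; last first.
  apply: IH ok => // e eE; case: (altP (e =P [::])) => [->|e0]; first by left.
  right; case: (dE e eE) => [/eqP|eE']; first by rewrite (negPf e0).
  apply: step_dom => //; apply/mapP => -[u ue eq_t].
  by move: invt; rewrite eq_t a_inv //; move/allP: CE => /(_ e eE)/allP; apply.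
have {}eq_t : a v = t by have := inv_a t; rewrite invt.
rewrite (edges _ _ CE dE kE') /=; apply/andP; split.
  apply: leq_trans (kN); rewrite -eq_t; apply: sizeC; first exact: nbhdC.
  exact: nbhd_sub.
apply: IH ok; rewrite -?eq_t.
  rewrite /elim_step /=; apply/andP; split.
    apply/allP => u; rewrite mem_filter => /andP[_].
    by move/allP: (nbhdC v E CE); apply.
  by apply/allP => e; rewrite mem_filter => /andP[_]; move/allP: CE; apply.
move=> e; rewrite inE => /orP[/eqP->|].
  right; exists [seq u <- nbhd (a v) E' | u != a v]; first exact: mem_head.
  move=> w /mapP[u]; rewrite mem_filter => /andP[uv uN] ->.
  rewrite mem_filter (nbhd_sub v E E' dE) ?map_f // andbT.
  apply: contraNneq uv => eq_uv.
  apply/eqP; have := a_inv u (allP (nbhdC v E CE) u uN).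
  by rewrite eq_uv eq_t invt => -[].
rewrite mem_filter => /andP[ve eE].
case: (altP (e =P [::])) => [->|e0]; first by left.
right; case: (dE e eE) => [/eqP|eE']; first by rewrite (negPf e0).
apply: step_dom => //; apply: contra ve => /mapP[u ue eq_uv].
suff <- : u = v by [].
have Cu : C u by move/allP: CE => /(_ e eE)/allP; apply.
by have := a_inv u Cu; rewrite -eq_uv eq_t invt => -[].
Qed.

Section EliminationTheory.
Variable T : eqType.
Implicit Types (E : seq (seq T)) (v : T) (F : pred T).

Lemma elimok_weaken k F E E' vs :
  dominated id E E' -> elimok k F E' vs -> elimok k F E vs.
Proof.
move=> dE ok.
have -> : vs = pmap Some vs by elim: (vs) => //= v vs' <-.
apply: (@elimok_dominated T T id Some predT k F E E') => //.
by apply/allP => e _; apply/allP.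
Qed.

(** Eliminating an isolated vertex adds only an empty edge, which domination ignores. This serves
    the variables outside the image of the endomorphism. *)
Lemma elimok_isolated k F E us vs :
  {in us, forall u, all (fun e => u \notin e) E} ->
  elimok k F E vs -> elimok k F E (us ++ vs).
Proof.
move=> iso ok; elim: us iso => [//|u us IH] iso /=.
have /allP uE : all (fun e => u \notin e) E by apply: iso; apply: mem_head.
have nb : nbhd u E = [::].
  rewrite /nbhd (_ : [seq e <- E | u \in e] = [::]) //.
  by rewrite (eq_in_filter (a2 := pred0)) ?filter_pred0 // => e /uE /negPf.
have ok' : elimok k F E (us ++ vs) by apply: IH => v vus; apply: iso;
  rewrite inE vus orbT.
have -> : all (fun e => size (undup e) <= k) E.
  by case: (us ++ vs) ok' => [|? ?] /= /andP[].
rewrite nb /=; apply: elimok_weaken ok' => e; rewrite /elim_step nb inE /=.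
case/orP=> [/eqP->|]; first by left.
by rewrite mem_filter => /andP[_ eE]; right; exists e => // w; rewrite map_id.
Qed.

(** After [vs] every edge lies within [F], which has at most [k] vertices, so eliminating any
    further vertices is free of charge. This is the effect of putting a quantifier or a projection
    around a subformula of small width. *)
Lemma elimok_cat k F F' E vs us :
  elimok k F E vs ->
  (exists Fs, size (undup Fs) <= k /\ {subset F <= Fs}) ->
  (forall v, F v -> v \notin us -> F' v) ->
  elimok k F' E (vs ++ us).
Proof.
move=> ok [Fs [kF FFs]] FF'; elim: vs E ok => [|v vs IH] E /=; last first.
  by case/andP=> -> /andP[-> /IH].
move=> /andP[_]; have kFs e : all F e -> size (undup e) <= k.
  move=> /allP Fe; apply: leq_trans kF; apply: size_undup_le => u /Fe; apply: FFs.
have allk E' : all (all F) E' -> all (fun e => size (undup e) <= k) E'.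
  by apply: sub_all.
elim: us F F' FF' E {FFs} kFs allk => [|u us IH] F F' FF' E kFs allk FE /=.
  rewrite allk //=; apply: sub_all FE => e; apply: sub_all => v Fv.
  exact: FF'.
have FN : all F (nbhd u E).
  by apply/allP => w /mem_nbhd[e /(allP FE)/allP Fe /andP[_ /Fe]].
rewrite allk // kFs //=; apply: (IH (fun v => F v && (v != u))).
- move=> v /andP[Fv vu] vus; apply: FF' => //.
  by rewrite inE negb_or vu.
- by move=> e Fe; apply: kFs; apply: sub_all Fe => v /andP[].
- move=> E' FE'; apply: allk; apply: sub_all FE' => e.
  by apply: sub_all => v /andP[].
rewrite /elim_step /=; apply/andP; split; apply/allP => e.
  by rewrite mem_filter => /andP[eu eN]; rewrite eu andbT; move/allP: FN; apply.
rewrite mem_filter => /andP[ue eE]; apply/allP => w we.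
apply/andP; split; first by move/allP: FE => /(_ _ eE)/allP; apply.
by apply: contraNneq ue => <-.
Qed.

Lemma elimok_interleave k F (p : pred T) E1 E2 vs :
  all (all (predU p F)) E1 -> all (all (predU (predC p) F)) E2 ->
  all (predC F) vs ->
  elimok k F E1 (filter p vs) -> elimok k F E2 (filter (predC p) vs) ->
  elimok k F (E1 ++ E2) vs.
Proof.
elim: vs E1 E2 => [|v vs IH] E1 E2 /=.
  by move=> _ _ _ /andP[k1 F1] /andP[k2 F2]; rewrite !all_cat k1 F1 k2.
move=> pE1 pE2 /andP[/= Fv Fvs].
have stepP (q : pred T) (E : seq (seq T)) : all (all q) E -> all (all q) (elim_step v E).
  move=> /allP qE; rewrite /elim_step /=; apply/andP; split; apply/allP => e.
    by rewrite mem_filter => /andP[_ /mem_nbhd[e' /qE/allP qe' /andP[_ /qe']]].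
  by rewrite mem_filter => /andP[_ /qE].
have okk E us : elimok k F E us -> all (fun e => size (undup e) <= k) E.
  by case: us => [|? ?] /= /andP[].
case: (boolP (p v)) => pv /=.
  have iso : {in E2, forall e, v \notin e}.
    move=> e /(allP pE2)/allP pe; apply/negP => /pe /=.
    by rewrite pv (negPf Fv).
  have nb : nbhd v (E1 ++ E2) = nbhd v E1.
    rewrite /nbhd filter_cat flatten_cat (_ : [seq e <- E2 | v \in e] = [::]).
      by rewrite cats0.
    by rewrite (eq_in_filter (a2 := pred0)) ?filter_pred0 // => e /iso/negPf.
  have st : elim_step v (E1 ++ E2) = elim_step v E1 ++ E2.
    rewrite /elim_step nb filter_cat cat_cons; congr (_ :: (_ ++ _)).
    by apply/all_filterP/allP.
  move=> /andP[k1 /andP[kN ok1]] ok2.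
  rewrite all_cat k1 (okk _ _ ok2) nb kN /= st.
  by apply: IH => //; apply: stepP.
have iso : {in E1, forall e, v \notin e}.
  move=> e /(allP pE1)/allP pe; apply/negP => /pe /=.
  by rewrite (negPf pv) (negPf Fv).
have nb : nbhd v (E1 ++ E2) = nbhd v E2.
  rewrite /nbhd filter_cat flatten_cat (_ : [seq e <- E1 | v \in e] = [::]) //.
  by rewrite (eq_in_filter (a2 := pred0)) ?filter_pred0 // => e /iso/negPf.
move=> ok1 /andP[k2 /andP[kN ok2]].
rewrite all_cat k2 (okk _ _ ok1) nb kN /=.
(* The merged edge is put in front of the whole list instead of in front of [E2]. Domination absorbs
   the change of position. *)
apply: (@elimok_weaken _ _ _ (E1 ++ elim_step v E2)); last first.
  by apply: IH => //; apply: stepP.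
move=> e eE; right; exists e => [|u]; last by rewrite map_id.
move: eE; rewrite !(inE, mem_cat) nb filter_cat mem_cat !mem_filter.
by case/orP=> [->|/orP[/andP[_ ->]|/andP[-> ->]]]; rewrite ?orbT.
Qed.

End EliminationTheory.

Lemma elimok_map (T T' : eqType) (r : T -> T') k (F : pred T') E vs :
  injective r -> elimok k (preim r F) E vs ->
  elimok k F (map (map r) E) (map r vs).
Proof.
move=> rI; elim: vs E => [|v vs IH] E /=.
  move=> /andP[kE FE]; rewrite !all_map; apply/andP; split.
    by apply: sub_all kE => e /=; rewrite undup_map_inj // size_map.
  by apply: sub_all FE => e /=; rewrite all_map.
have nb : nbhd (r v) (map (map r) E) = map r (nbhd v E).
  rewrite /nbhd filter_map map_flatten; congr flatten; congr map.
  by apply: eq_filter => e /=; rewrite mem_map.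
move=> /andP[kE /andP[kN ok]]; rewrite nb undup_map_inj // size_map kN.
rewrite all_map (@eq_all _ _ (fun e => size (undup e) <= k)) => [|e /=]; last first.
  by rewrite undup_map_inj // size_map.
rewrite kE /= (_ : elim_step _ _ = map (map r) (elim_step v E)) ?IH //.
rewrite /elim_step nb /= !filter_map; congr (_ :: _); congr map.
  by apply: eq_filter => u /=; rewrite (inj_eq rI).
by apply: eq_filter => e /=; rewrite mem_map.
Qed.

(** * Computable functions *)

(** [CodeSeq.code (a :: l)] is 2^a times an odd number built from the code of [l], hence the
    successor of [npair a (code l)]. Decoding [n.+1] never gives the empty list, so the default is
    unreachable. *)
Definition unpair (n : nat) : nat * nat :=
  if CodeSeq.decode n.+1 is a :: l then (a, CodeSeq.code l) else (0, 0).

Lemma code_cons a l : CodeSeq.code (a :: l) = (npair a (CodeSeq.code l)).+1.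
Proof. by rewrite /npair prednK // muln_gt0 expn_gt0. Qed.

Lemma unpairK n : npair (unpair n).1 (unpair n).2 = n.
Proof.
rewrite /unpair; case E : (CodeSeq.decode n.+1) => [|a l].
  by have := CodeSeq.decodeK n.+1; rewrite E.
by apply: succn_inj; rewrite -code_cons -E CodeSeq.decodeK.
Qed.

Lemma npairK a b : unpair (npair a b) = (a, b).
Proof.
by rewrite /unpair -[b in npair a b]CodeSeq.decodeK -code_cons CodeSeq.codeK
  CodeSeq.decodeK.
Qed.

Arguments npair : simpl never.

Record encType := EncType { enc_sort :> Type; enc : enc_sort -> nat }.

Canonical nat_enc := EncType (fun n : nat => n).
Canonical bool_enc := EncType nat_of_bool.
Canonical prod_enc (A B : encType) :=
  EncType (fun x : A * B => npair (enc x.1) (enc x.2)).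
Canonical seq_enc (A : encType) := EncType (fun l : seq A =>
  CodeSeq.code (map (@enc A) l)).
Canonical option_enc (A : encType) :=
  EncType (fun o : option A => if o is Some x then (enc x).+1 else 0).

Definition computable (A B : encType) (f : A -> B) : Prop :=
  exists p, forall x, computes p (enc x) (enc (f x)).

Lemma eq_computable (A B : encType) (f g : A -> B) :
  f =1 g -> computable f -> computable g.
Proof. by move=> fg [p hp]; exists p => x; rewrite -fg. Qed.

(** A mere change of type costs nothing: as the pairing is onto, [RPair RLeft RRight] computes the
    identity on numbers. *)
Lemma computable_recode (A B : encType) (f : A -> B) :
  (forall x, enc (f x) = enc x) -> computable f.
Proof.
move=> ef; exists (RPair RLeft RRight) => x; rewrite ef.
exists (unpair (enc x)).1, (unpair (enc x)).2.
by split; rewrite ?unpairK //=; [exists (unpair (enc x)).2|exists (unpair (enc x)).1];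
  rewrite unpairK.
Qed.

Lemma computable_id (A : encType) : computable (fun x : A => x).
Proof. exact: computable_recode. Qed.

Lemma computable_comp (A B C : encType) (g : B -> C) (f : A -> B) :
  computable g -> computable f -> computable (fun x => g (f x)).
Proof. by move=> [q hq] [p hp]; exists (RComp q p) => x; exists (enc (f x)). Qed.

Section Combinators.
Variable Z : encType.

Lemma computable_pair (A B : encType) (f : Z -> A) (g : Z -> B) :
  computable f -> computable g -> computable (fun z => (f z, g z)).
Proof.
by move=> [p hp] [q hq]; exists (RPair p q) => z; exists (enc (f z)), (enc (g z)).
Qed.

Lemma computable_fst (A B : encType) (f : Z -> A * B) :
  computable f -> computable (fun z => (f z).1).
Proof.
move=> hf; apply: (computable_comp (g := fst)) hf.
by exists RLeft => x; exists (enc x.2).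
Qed.

Lemma computable_snd (A B : encType) (f : Z -> A * B) :
  computable f -> computable (fun z => (f z).2).
Proof.
move=> hf; apply: (computable_comp (g := snd)) hf.
by exists RRight => x; exists (enc x.1).
Qed.

Lemma computable_const (A : encType) (c : A) : computable (fun _ : Z => c).
Proof.
suff [p hp] : exists p, forall x, computes p x (enc c) by exists p.
elim: (enc c) => [|n [p hp]]; first by exists RZero.
by exists (RComp RSucc p) => x; exists n => //; apply: hp.
Qed.

Lemma computable_succ (f : Z -> nat) : computable f -> computable (fun z => (f z).+1).
Proof. by move=> hf; apply: (computable_comp (g := S)) hf; exists RSucc. Qed.

(** In [RPrec] the parameter [z] is carried unchanged beside the counter and the previous value; the
    program for [s] discards the counter. *)
Lemma computable_iter (A : encType) (n : Z -> nat) (s : Z -> A -> A) (a : Z -> A) :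
  computable n -> computable (fun za : Z * A => s za.1 za.2) -> computable a ->
  computable (fun z => iter (n z) (s z) (a z)).
Proof.
move=> [pn hn] [ps hs] [pa ha]; have [pid hid] := computable_id Z.
exists (RComp (RPrec pa (RComp ps (RPair RLeft (RComp RRight RRight)))) (RPair pid pn))
  => z.
exists (npair (enc z) (n z)); first by exists (enc z), (n z).
exists (enc z), (n z); split=> //.
elim: (n z) => [|k IH]; first exact: ha.
exists (enc (iter k (s z) (a z))); first exact: IH.
exists (npair (enc z) (enc (iter k (s z) (a z)))); last exact: (hs (z, _)).
exists (enc z), (enc (iter k (s z) (a z))); split=> //; first by eexists.
by exists (npair k (enc (iter k (s z) (a z)))); eexists.
Qed.

Lemma computable_if (A : encType) (b : Z -> bool) (f g : Z -> A) :
  computable b -> computable f -> computable g ->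
  computable (fun z => if b z then f z else g z).
Proof.
move=> [p hp] hf hg; apply: (@eq_computable _ _ (fun z => iter (b z) (fun=> f z) (g z))).
  by move=> z; case: (b z).
apply: computable_iter hg; first by exists p.
apply: (computable_comp hf); apply: (@eq_computable _ _ fst) => //.
by exists RLeft => x; exists (enc x.2).
Qed.

End Combinators.

Lemma computable_var1 (Z A : encType) : computable (fun za : Z * A => za.1).
Proof. exact/computable_fst/computable_id. Qed.

Lemma computable_var2 (Z A : encType) : computable (fun za : Z * A => za.2).
Proof. exact/computable_snd/computable_id. Qed.

(* Matching is syntactic: unification would eta-expand pairs for ever. *)
Ltac comp_base :=
  lazymatch goal with
  | |- computable (fun z => z) => apply: computable_id
  | |- computable (fun _ => ?c) => apply: computable_const
  | |- computable (fun z => fst _) => apply: computable_fst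
  | |- computable (fun z => snd _) => apply: computable_snd
  | |- computable fst => apply: computable_var1
  | |- computable snd => apply: computable_var2
  | |- computable (fun z => pair _ _) => apply: computable_pair
  | |- computable (fun z => S _) => apply: computable_succ
  | |- computable (fun z => if _ then _ else _) => apply: computable_if
  | |- computable (fun z => iter _ _ _) => apply: computable_iter
  | |- _ => assumption
  end.

(** * Arithmetic, Boolean and coding functions *)

Lemma computable_pred (Z : encType) (f : Z -> nat) :
  computable f -> computable (fun z => (f z).-1).
Proof.
move=> hf; apply: (@eq_computable _ _
  (fun z => (iter (f z) (fun p : nat * nat => (p.2, p.2.+1)) (0, 0)).1)).
  move=> z; suff -> : iter (f z) (fun p : nat * nat =>
    (p.2, p.2.+1)) (0, 0) = ((f z).-1, f z) by [].
  by elim: (f z) => // n IH; rewrite iterS IH.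
by repeat comp_base.
Qed.

Lemma computable_add (Z : encType) (f g : Z -> nat) :
  computable f -> computable g -> computable (fun z => f z + g z).
Proof.
move=> hf hg; apply: (@eq_computable _ _ (fun z => iter (f z) S (g z))).
  by move=> z; elim: (f z) => // n IH; rewrite iterS IH.
by repeat comp_base.
Qed.

Lemma computable_sub (Z : encType) (f g : Z -> nat) :
  computable f -> computable g -> computable (fun z => f z - g z).
Proof.
move=> hf hg; apply: (@eq_computable _ _ (fun z => iter (g z) predn (f z))).
  by move=> z; elim: (g z) => [|n IH]; rewrite ?subn0 // iterS IH subnS.
apply: computable_iter => //; exact/computable_pred/computable_var2.
Qed.

Lemma computable_eq0 (Z : encType) (f : Z -> nat) :
  computable f -> computable (fun z => f z == 0).
Proof.
move=> hf; apply: (@eq_computable _ _ (fun z => iter (f z) (fun=> false) true)).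
  by move=> z; case: (f z).
by repeat comp_base.
Qed.

Lemma computable_not (Z : encType) (b : Z -> bool) :
  computable b -> computable (fun z => ~~ b z).
Proof.
move=> hb; apply: (@eq_computable _ _ (fun z => if b z then false else true)) => //.
by repeat comp_base.
Qed.

Lemma computable_and (Z : encType) (b c : Z -> bool) :
  computable b -> computable c -> computable (fun z => b z && c z).
Proof. by move=> hb hc; apply: computable_if => //; apply: computable_const. Qed.

Lemma computable_or (Z : encType) (b c : Z -> bool) :
  computable b -> computable c -> computable (fun z => b z || c z).
Proof. by move=> hb hc; apply: computable_if => //; apply: computable_const. Qed.

Lemma computable_leq (Z : encType) (f g : Z -> nat) :
  computable f -> computable g -> computable (fun z => f z <= g z).
Proof. by move=> hf hg; apply/computable_eq0/computable_sub. Qed.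

Lemma computable_eqn (Z : encType) (f g : Z -> nat) :
  computable f -> computable g -> computable (fun z => f z == g z).
Proof.
move=> hf hg; apply: (@eq_computable _ _ (fun z => (f z <= g z) && (g z <= f z))).
  by move=> z; rewrite eqn_leq.
by apply: computable_and; apply: computable_leq.
Qed.

Lemma computable_max (Z : encType) (f g : Z -> nat) :
  computable f -> computable g -> computable (fun z => maxn (f z) (g z)).
Proof.
by move=> hf hg; apply: computable_if => //; apply: computable_leq => //;
  apply: computable_succ.
Qed.

Lemma computable_odd (Z : encType) (f : Z -> nat) :
  computable f -> computable (fun z => odd (f z)).
Proof.
move=> hf; apply: (@eq_computable _ _ (fun z => iter (f z) negb false)).
  by move=> z; elim: (f z) => // n IH; rewrite iterS IH.
by apply: computable_iter => //;
  [apply/computable_not/computable_var2|apply: computable_const].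
Qed.

Lemma computable_double (Z : encType) (f : Z -> nat) :
  computable f -> computable (fun z => (f z).*2).
Proof.
move=> hf; apply: (@eq_computable _ _ (fun z => f z + f z)) => [z|]; first exact: addnn.
exact: computable_add.
Qed.

Lemma computable_npair (Z : encType) (f g : Z -> nat) :
  computable f -> computable g -> computable (fun z => npair (f z) (g z)).
Proof.
move=> hf hg; apply: (computable_comp (g := fun p : nat * nat =>
  npair p.1 p.2) (f := fun z => (f z, g z))).
  exact: computable_recode.
exact: computable_pair.
Qed.

Lemma computable_unpair (Z : encType) (f : Z -> nat) :
  computable f -> computable (fun z => unpair (f z)).
Proof.
by apply: computable_comp; apply: computable_recode => n; rewrite /= unpairK.
Qed.

Lemma computable_decode (Z : encType) (f : Z -> nat) :
  computable f -> computable (fun z => CodeSeq.decode (f z)).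
Proof.
apply: computable_comp; apply: computable_recode => n /=.
by rewrite map_id CodeSeq.decodeK.
Qed.

Lemma computable_code (Z : encType) (l : Z -> seq nat) :
  computable l -> computable (fun z => CodeSeq.code (l z)).
Proof. by apply: computable_comp; apply: computable_recode => n /=; rewrite map_id. Qed.

(** The code of an option is zero or the successor of the code of its content. The match becomes a
    recursion of length zero or one whose parameter holds the predecessor. Working on codes avoids
    having to supply a default of type [T]. *)
Lemma computable_omatch (Z : encType) (T A : encType) (o : Z -> option T) (f : Z ->
  T -> A) (g : Z -> A) :
  computable o -> computable (fun zt : Z * T => f zt.1 zt.2) -> computable g ->
  computable (fun z => match o z with Some t => f z t | None => g z end).
Proof.
move=> ho [pf hf] [pg hg].
have ho' : computable (fun z => enc (o z)).
  by apply: (computable_comp (g := @enc _)) ho; apply: computable_recode.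
have [p1 hp1] := computable_pair (computable_pair (computable_id Z) (computable_pred ho'))
  (computable_not (computable_eq0 ho')).
exists (RComp (RPrec (RComp pg RLeft) (RComp pf RLeft)) p1) => z.
eexists; first exact: hp1.
do 2!eexists; split; first by [].
case: (o z) => [t|] /=; last first.
  by exists (enc z); [eexists|apply: hg].
exists (enc (g z)); first by exists (enc z); [eexists|apply: hg].
by exists (npair (enc z) (enc t)); [eexists|apply: (hf (z, t))].
Qed.

(** * Functions on lists *)

Lemma computable_nil (Z T : encType) : computable (fun _ : Z => ([::] : seq T)).
Proof. exact: computable_const. Qed.

Lemma computable_cons (Z T : encType) (x : Z -> T) (l : Z -> seq T) :
  computable x -> computable l -> computable (fun z => x z :: l z).
Proof.
move=> hx hl; have := computable_succ (computable_npair
  (computable_comp (g := @enc T) (f := x) _ hx)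
  (computable_comp (g := @enc (seq_enc T)) (f := l) _ hl)).
case; try exact: computable_recode.
by move=> p hp; exists p => z; have := hp z; rewrite /= -code_cons.
Qed.

Lemma computable_lmatch (Z T : encType) (A : encType) (l : Z -> seq T) (g : Z ->
  A) (f : Z -> T -> seq T -> A) :
  computable l -> computable g ->
    computable (fun zt : Z * (T * seq T) => f zt.1 zt.2.1 zt.2.2) ->
  computable (fun z => match l z with [::] => g z | x :: s => f z x s end).
Proof.
move=> hl hg hf; pose uncons (s : seq T) := if s is x :: s' then Some (x, s') else None.
apply: (@eq_computable _ _ (fun z => match uncons (l z) with
  Some t => f z t.1 t.2 | None => g z end)); first by move=> z; case: (l z).
apply: computable_omatch hf hg; apply: (computable_comp (g := uncons)) hl.
by apply: computable_recode => -[|x s] //=; rewrite -code_cons.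
Qed.

Lemma size_leq_code (T : encType) (l : seq T) : size l <= enc l.
Proof.
elim: l => // x l IH.
rewrite -[enc (x :: l)]/(CodeSeq.code (enc x :: map (@enc T) l)) code_cons ltnS /=.
apply: leq_trans IH _; rewrite /npair /= -ltnS prednK ?muln_gt0 ?expn_gt0 //.
rewrite -muln2; apply: leq_trans (leq_pmull _ _); rewrite ?expn_gt0 //.
by rewrite muln2 ltnS -addnn leq_addr.
Qed.

(** Recursion along a list is replaced by iteration. The code of the list is at least its length and
    serves as the number of rounds; the step idles once the list is used up. *)
Lemma computable_foldl (Z T : encType) (A : encType) (s : Z -> A -> T -> A) (a : Z ->
  A) (l : Z -> seq T) :
  computable (fun zat : Z * A * T => s zat.1.1 zat.1.2 zat.2) -> computable a ->
    computable l ->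
  computable (fun z => foldl (s z) (a z) (l z)).
Proof.
move=> hs ha hl.
pose step z (st : seq T * A) := match st.1 with [::] => st | t :: r =>
  (r, s z st.2 t) end.
apply: (@eq_computable _ _ (fun z => (iter (enc (l z)) (step z) (l z, a z)).2)).
  move=> z; have nil_fix n b : iter n (step z) ([::], b) = ([::], b).
    by elim: n => // n IH; rewrite iterS IH.
  elim: (l z) (enc (l z)) (size_leq_code (l z)) (a z) => [|t r IH] n /=.
    by move=> _ b; rewrite nil_fix.
  by case: n => // n le_n b; rewrite iterSr (IH n).
apply: computable_snd; apply: computable_iter.
- by apply: (computable_comp (g := @enc _)) hl; apply: computable_recode.
- apply: (@computable_lmatch _ _ _ (fun za : Z * (seq T * A) => za.2.1) (fun za => za.2)
    (fun za t r => (r, s za.1 za.2.2 t))); try by repeat comp_base.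
  apply: computable_pair; first by repeat comp_base.
  by apply: (computable_comp hs (f := fun w : Z * (seq T * A) * (T * seq T) =>
    (w.1.1, w.1.2.2, w.2.1))); repeat comp_base.
by repeat comp_base.
Qed.

Lemma computable_app2 (W Z T A : encType) (f : Z -> T -> A) (z : W -> Z) (t : W -> T) :
  computable (fun zt : Z * T => f zt.1 zt.2) -> computable z -> computable t ->
  computable (fun w => f (z w) (t w)).
Proof.
by move=> hf hz ht; apply: (computable_comp hf (f := fun w => (z w, t w)));
  apply: computable_pair.
Qed.

Lemma computable_catrev (Z T : encType) (l l' : Z -> seq T) :
  computable l -> computable l' ->
  computable (fun z => catrev (l z) (l' z)).
Proof.
move=> hl hl'; apply: (@eq_computable _ _ (fun z => foldl (fun s x =>
  x :: s) (l' z) (l z))).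
  by move=> z; elim: (l z) (l' z) => //= x s IH s'; rewrite IH.
by apply: computable_foldl => //; apply: computable_cons; repeat comp_base.
Qed.

Lemma computable_rev (Z T : encType) (l : Z -> seq T) :
  computable l -> computable (fun z => rev (l z)).
Proof. by move=> hl; apply: computable_catrev => //; apply: computable_nil. Qed.

Lemma computable_cat (Z T : encType) (l l' : Z -> seq T) :
  computable l -> computable l' ->
  computable (fun z => l z ++ l' z).
Proof.
move=> hl hl'; apply: (@eq_computable _ _ (fun z => catrev (rev (l z)) (l' z))).
  by move=> z; rewrite catrevE revK.
by apply: computable_catrev => //; apply: computable_rev.
Qed.

Lemma computable_map (Z T U : encType) (f : Z -> T -> U) (l : Z -> seq T) :
  computable (fun zt : Z * T => f zt.1 zt.2) -> computable l ->
  computable (fun z => map (f z) (l z)).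
Proof.
move=> hf hl; apply: (@eq_computable _ _
  (fun z => catrev (foldl (fun s x => f z x :: s) [::] (l z)) [::])).
  move=> z; suff H s s' : catrev (foldl (fun s x => f z x :: s) s (l z)) s'
    = catrev s (map (f z) (l z) ++ s') by rewrite H /= cats0.
  by elim: (l z) s => //= x r IH s; rewrite IH.
suff h : computable (fun z => foldl (fun s x => f z x :: s) [::] (l z)).
  case: h => p hp; have [q hq] : computable (fun s : seq U => catrev s [::]).
    apply: (@eq_computable _ _ (fun s => foldl (fun s x => x :: s) [::] s)).
      by move=> s; elim: s [::] => //= x s IH s'; rewrite IH.
    by apply: computable_foldl; [apply: computable_cons| |]; repeat comp_base.
  by exists (RComp q p) => z; exists (enc (foldl (fun s x => f z x :: s) [::] (l z))).
apply: computable_foldl => //; last exact: computable_const.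
apply: computable_cons; last by repeat comp_base.
by apply: (computable_app2 hf); repeat comp_base.
Qed.

Lemma computable_filter (Z T : encType) (a : Z -> pred T) (l : Z -> seq T) :
  computable (fun zt : Z * T => a zt.1 zt.2) -> computable l ->
  computable (fun z => filter (a z) (l z)).
Proof.
move=> ha hl; apply: (@eq_computable _ _
  (fun z => catrev (foldl (fun s x => if a z x then x :: s else s) [::] (l z)) [::])).
  move=> z; suff H s s' : catrev (foldl (fun s x =>
    if a z x then x :: s else s) s (l z)) s'
    = catrev s (filter (a z) (l z) ++ s') by rewrite H /= cats0.
  by elim: (l z) s => //= x r IH s; rewrite IH; case: ifP.
apply: computable_catrev; last exact: computable_const.
apply: computable_foldl => //; last exact: computable_const.
apply: computable_if; last by repeat comp_base.
  by apply: (computable_app2 ha); repeat comp_base.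
by apply: computable_cons; repeat comp_base.
Qed.

Lemma computable_has (Z T : encType) (a : Z -> pred T) (l : Z -> seq T) :
  computable (fun zt : Z * T => a zt.1 zt.2) -> computable l ->
  computable (fun z => has (a z) (l z)).
Proof.
move=> ha hl; apply: (@eq_computable _ _ (fun z => foldl (fun b x =>
  b || a z x) false (l z))).
  move=> z; suff H b : foldl (fun b x =>
    b || a z x) b (l z) = b || has (a z) (l z) by rewrite H.
  by elim: (l z) b => [|x r IH] b /=; rewrite ?orbF // IH orbA.
apply: computable_foldl => //; last exact: computable_const.
apply: computable_or; first by repeat comp_base.
by apply: (computable_app2 ha); repeat comp_base.
Qed.

Lemma computable_all (Z T : encType) (a : Z -> pred T) (l : Z -> seq T) :
  computable (fun zt : Z * T => a zt.1 zt.2) -> computable l ->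
  computable (fun z => all (a z) (l z)).
Proof.
move=> ha hl; apply: (@eq_computable _ _ (fun z => ~~ has (predC (a z)) (l z))).
  by move=> z; rewrite has_predC negbK.
by apply: computable_not; apply: computable_has => //; apply: computable_not.
Qed.

Lemma computable_flatten (Z T : encType) (ll : Z -> seq (seq T)) : computable ll ->
  computable (fun z => flatten (ll z)).
Proof.
move=> hl; apply: (@eq_computable _ _ (fun z => foldl cat [::] (ll z))).
  move=> z; suff H s : foldl cat s (ll z) = s ++ flatten (ll z) by rewrite H.
  by elim: (ll z) s => [|x r IH] s /=; rewrite ?cats0 // IH catA.
apply: computable_foldl => //; last exact: computable_const.
by apply: computable_cat; repeat comp_base.
Qed.

Lemma computable_size (Z T : encType) (l : Z -> seq T) :
  computable l -> computable (fun z => size (l z)).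
Proof.
move=> hl; apply: (@eq_computable _ _ (fun z => foldl (fun n _ => n.+1) 0 (l z))).
  move=> z; suff H n : foldl (fun n _ => n.+1) n (l z) = n + size (l z) by rewrite H.
  by elim: (l z) n => [|x r IH] n /=; rewrite ?addn0 // IH addSnnS.
by apply: computable_foldl => //; repeat comp_base.
Qed.

Lemma computable_head (Z T : encType) (x : Z -> T) (l : Z -> seq T) :
  computable x -> computable l ->
  computable (fun z => head (x z) (l z)).
Proof. by move=> hx hl; apply: computable_lmatch hl hx _; repeat comp_base. Qed.

Lemma computable_behead (Z T : encType) (l : Z -> seq T) :
  computable l -> computable (fun z => behead (l z)).
Proof. by move=> hl; apply: computable_lmatch hl _ _; repeat comp_base. Qed.

Lemma computable_mem (Z : encType) (x : Z -> nat) (l : Z -> seq nat) :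
  computable x -> computable l ->
  computable (fun z => x z \in l z).
Proof.
move=> hx hl; apply: (@eq_computable _ _ (fun z => has (fun y => y == x z) (l z))).
  by move=> z; rewrite has_pred1.
apply: computable_has => //; apply: computable_eqn; first by repeat comp_base.
by apply: (computable_comp hx); repeat comp_base.
Qed.

Lemma computable_iota0 (Z : encType) (n : Z -> nat) :
  computable n -> computable (fun z => iota 0 (n z)).
Proof.
move=> hn; apply: (@eq_computable _ _
  (fun z => rev (iter (n z) (fun p : nat * seq nat =>
    (p.1.+1, p.1 :: p.2)) (0, [::])).2)).
  move=> z; suff -> : iter (n z) (fun p : nat * seq nat => (p.1.+1, p.1 :: p.2)) (0, [::])
    = (n z, rev (iota 0 (n z))) by rewrite revK.
  by elim: (n z) => // k IH; rewrite iterS IH -[in iota _ k.+1]addn1 iotaD rev_cat /=.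
apply: computable_rev; apply: computable_snd; apply: computable_iter => //.
  by apply: computable_pair; [|apply: computable_cons]; repeat comp_base.
exact: computable_const.
Qed.

Lemma computable_sumn (Z : encType) (l : Z -> seq nat) :
  computable l -> computable (fun z => sumn (l z)).
Proof.
move=> hl; apply: (@eq_computable _ _ (fun z => foldl addn 0 (l z))).
  move=> z; suff H n : foldl addn n (l z) = n + sumn (l z) by rewrite H.
  by elim: (l z) n => [|x r IH] n /=; rewrite ?addn0 // IH addnA.
by apply: computable_foldl; [apply: computable_add| |]; repeat comp_base.
Qed.

Local Open Scope fset_scope.

(** * The elimination algorithm *)

(** This is the sorted list without repetitions, obtained by filtering an initial segment so that no
    sorting program has to be written. The sum of the entries bounds each of them. Being canonical,
    it has the same code as the finite set. *)
Definition norm (l : seq nat) : seq nat := [seq v <- iota 0 (sumn l).+1 | v \in l].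

Lemma mem_norm l : norm l =i l.
Proof.
move=> v; rewrite mem_filter mem_iota /= add0n ltnS.
by apply: andb_idr => vl; rewrite (perm_sumn (perm_to_rem vl)) leq_addr.
Qed.

Lemma norm_uniq l : uniq (norm l).
Proof. by rewrite filter_uniq ?iota_uniq. Qed.

Lemma code_vars_fset l : code_vars [fset x in l] = CodeSeq.code (norm l).
Proof.
rewrite /code_vars; congr CodeSeq.code.
apply: (sorted_eq leq_trans anti_leq); first exact/sort_sorted/leq_total.
  apply: sorted_filter; first exact: leq_trans.
  exact: iota_sorted.
rewrite perm_sort; apply: uniq_perm; [exact: fset_uniq|exact: norm_uniq|].
by move=> x; rewrite mem_norm inE.
Qed.

(** [fo] has no constant for truth, so a conjunction has no neutral element to start from; [d] is
    the value on the empty list. *)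
Definition fold1 (F : Type) (op : F -> F -> F) (d : F) (l : seq F) : F :=
  foldl op (head d l) (behead l).

(* The elimination algorithm is run on formulas for the correctness proof, and
   on codes of formulas for the computability proof. *)
Record ops (A F G : Type) := Ops {
  o_vars : A -> seq nat;
  o_atom : A -> F;
  o_ex : nat -> F -> F;
  o_and : F -> F -> F;
  o_dflt : F;
  o_cast : F -> seq nat -> G;
  o_proj : nat -> G -> G;
  o_expand : seq nat -> G -> G;
  o_times : G -> G -> G;
  o_dflt' : G
}.

Section Pieces.
Variable F : Type.
Implicit Types (ps : seq (seq nat * F)).

Definition occurs (v : nat) ps : bool := has (fun p => v \in p.1) ps.

(* A variable that occurs nowhere is quantified in front of the first piece rather
   than dropped: over the empty structure this makes the value false or zero. *)
Definition sel v ps :=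
  if occurs v ps then [seq p <- ps | v \in p.1] else take 1 ps.

Definition unsel v ps :=
  if occurs v ps then [seq p <- ps | v \notin p.1] else behead ps.

Definition elim_vars v ps := norm (flatten (map fst (sel v ps))).

(** A state couples the largest number of variables seen so far with the current pieces, each
    labelled by the list of its free variables. *)
Definition elim_piece (comb : nat -> seq nat -> seq (seq nat * F) -> F) v
    (st : nat * seq (seq nat * F)) : nat * seq (seq nat * F) :=
  (maxn st.1 (size (elim_vars v st.2)),
   ([seq u <- elim_vars v st.2 | u != v],
      comb v (elim_vars v st.2) (sel v st.2)) :: unsel v st.2).

Definition elim_pieces comb st vs := foldl (fun st v => elim_piece comb v st) st vs.

End Pieces.

Section Build.
Variables (A F G : Type) (o : ops A F G).

Definition comb_ex v (U : seq nat) (ps : seq (seq nat * F)) : F :=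
  o_ex o v (fold1 (o_and o) (o_dflt o) (map snd ps)).

(** [Times] requires equal sets of free variables, so every factor is expanded to [U] before the
    product is formed. *)
Definition comb_proj v (U : seq nat) (ps : seq (seq nat * G)) : G :=
  o_proj o v (fold1 (o_times o) (o_dflt' o)
    [seq o_expand o [seq u <- U | u \notin p.1] p.2 | p <- ps]).

Definition pieces0 (ats : seq A) := [seq (norm (o_vars o a), o_atom o a) | a <- ats].

Definition width0 (ps : seq (seq nat * F)) := foldl (fun w p => maxn w (size p.1)) 0 ps.

Definition phase1 ats ox := elim_pieces comb_ex (width0 (pieces0 ats), pieces0 ats) ox.

Definition cast_pieces (st : nat * seq (seq nat * F)) :=
  (st.1, [seq (p.1, o_cast o p.2 p.1) | p <- st.2]).

Definition phase2 ats ox os := elim_pieces comb_proj (cast_pieces (phase1 ats ox)) os.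

Definition build ats ox os : nat * G :=
  let st := phase2 ats ox os in
  (st.1, fold1 (o_times o) (o_dflt' o) (map snd st.2)).

End Build.

Section BuildMorphism.
Variables (A F G A' F' G' : Type) (o : ops A F G) (o' : ops A' F' G').
Variables (fA : A -> A') (fF : F -> F') (fG : G -> G').
Hypothesis vars_morph : forall a, o_vars o' (fA a) = o_vars o a.
Hypothesis atom_morph : forall a, o_atom o' (fA a) = fF (o_atom o a).
Hypothesis ex_morph : forall v p, o_ex o' v (fF p) = fF (o_ex o v p).
Hypothesis and_morph : forall p q, o_and o' (fF p) (fF q) = fF (o_and o p q).
Hypothesis dflt_morph : o_dflt o' = fF (o_dflt o).
Hypothesis cast_morph : forall p l, o_cast o' (fF p) l = fG (o_cast o p l).
Hypothesis proj_morph : forall v p, o_proj o' v (fG p) = fG (o_proj o v p).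
Hypothesis expand_morph : forall l p, o_expand o' l (fG p) = fG (o_expand o l p).
Hypothesis times_morph : forall p q, o_times o' (fG p) (fG q) = fG (o_times o p q).
Hypothesis dflt'_morph : o_dflt' o' = fG (o_dflt' o).

Definition map_pieces (T T' : Type) (f : T -> T') (ps : seq (seq nat * T)) :=
  [seq (p.1, f p.2) | p <- ps].

Definition map_state (T T' : Type) (f : T -> T') (st : nat * seq (seq nat * T)) :=
  (st.1, map_pieces f st.2).

Lemma fold1_morph (T T' : Type) (f : T -> T') op op' d l :
  (forall x y, op' (f x) (f y) = f (op x y)) ->
  fold1 op' (f d) (map f l) = f (fold1 op d l).
Proof.
move=> fop; rewrite /fold1; case: l => //= x l.
by elim: l x => //= y l IH x; rewrite fop IH.
Qed.

Section Step.
Variables (T T' : Type) (f : T -> T').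

Lemma occurs_morph v ps : occurs v (map_pieces f ps) = occurs v ps.
Proof. by rewrite /occurs has_map. Qed.

Lemma sel_morph v ps : sel v (map_pieces f ps) = map_pieces f (sel v ps).
Proof.
by rewrite /sel occurs_morph; case: ifP => _; rewrite ?filter_map // /map_pieces map_take.
Qed.

Lemma unsel_morph v ps : unsel v (map_pieces f ps) = map_pieces f (unsel v ps).
Proof.
by rewrite /unsel occurs_morph; case: ifP => _;
  rewrite ?filter_map // /map_pieces behead_map.
Qed.

Lemma elim_pieces_morph comb comb' st vs :
  (forall v U ps, comb' v U (map_pieces f ps) = f (comb v U ps)) ->
  elim_pieces comb' (map_state f st) vs = map_state f (elim_pieces comb st vs).
Proof.
move=> fcomb; elim: vs st => //= v vs IH st; rewrite -IH; congr foldl.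
rewrite /elim_piece /map_state /elim_vars /= sel_morph unsel_morph fcomb.
by rewrite /map_pieces -!map_comp.
Qed.

End Step.

(** The algorithm inspects only the lists of variables, never the formulas attached to them, so it
    commutes with every map that respects the operations. Applied to the coding of formulas, this
    shows that the run on codes returns the code of the formula built. *)
Lemma build_morph ats ox os :
  build o' (map fA ats) ox os
  = ((build o ats ox os).1, fG (build o ats ox os).2).
Proof.
have eq0 : pieces0 o' (map fA ats) = map_pieces fF (pieces0 o ats).
  rewrite /pieces0 /map_pieces -!map_comp; apply: eq_map => a /=.
  by rewrite vars_morph atom_morph.
have eqw (ps : seq (seq nat * F)) : width0 (map_pieces fF ps) = width0 ps.
  by rewrite /width0; elim: ps 0 => //= p ps IH w; rewrite IH.
have eq1 : phase1 o' (map fA ats) ox = map_state fF (phase1 o ats ox).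
  rewrite /phase1 eq0 eqw.
  apply: (elim_pieces_morph (f := fF) (comb := comb_ex o) (_, pieces0 o ats)) => v U ps.
  rewrite /comb_ex dflt_morph -ex_morph -(fold1_morph (op := o_and o)(op' := o_and o'))
    //.
  by rewrite /map_pieces -!map_comp.
have eq2 : phase2 o' (map fA ats) ox os = map_state fG (phase2 o ats ox os).
  rewrite /phase2 eq1.
  rewrite -(@elim_pieces_morph _ _ fG (comb_proj o) (comb_proj o')).
    congr elim_pieces; rewrite /cast_pieces /map_state /map_pieces /= -!map_comp.
    by congr (_, _); apply: eq_map => p /=; rewrite cast_morph.
  move=> v U ps; rewrite /comb_proj -proj_morph dflt'_morph.
  rewrite -(fold1_morph (op := o_times o)(op' := o_times o')) //;
    congr (o_proj _ _ (fold1 _ _ _)).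
  by rewrite /map_pieces -!map_comp; apply: eq_map => p /=; rewrite expand_morph.
rewrite /build eq2 /= dflt'_morph; congr (_, _).
rewrite -(fold1_morph (op := o_times o)(op' := o_times o')) //.
by rewrite /map_pieces -!map_comp.
Qed.

End BuildMorphism.

(** * The number reported by the algorithm is bounded by the cost of the order *)

Section Width.

Lemma map_fst_filter (F : Type) (a : pred (seq nat)) (ps : seq (seq nat * F)) :
  map fst [seq p <- ps | a p.1] = [seq e <- map fst ps | a e].
Proof. by rewrite filter_map. Qed.

(** The pieces follow the hypergraph step by step, but only up to domination: when [v] occurs
    nowhere the algorithm uses the first piece, where the hypergraph just gains an empty edge. *)
Lemma elim_piece_dominated k (Fr : pred nat) (F : Type) comb v vs
    (st : nat * seq (seq nat * F)) E :
  dominated id (map fst st.2) E -> elimok k Fr E (v :: vs) -> st.1 <= k ->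
  dominated id (map fst (elim_piece comb v st).2) (elim_step v E) /\
  (elim_piece comb v st).1 <= k.
Proof.
move=> dom /= /andP[/allP kE /andP[kN _]] wk.
have avoid e : v \notin e ->
    (exists2 e', e' \in E & {subset map id e <= e'}) ->
    exists2 e', e' \in elim_step v E & {subset map id e <= e'}.
  move=> ve [e' e'E ee']; have [ve'|ve'] := boolP (v \in e'); last first.
    by exists e'; rewrite // inE mem_filter ve' e'E orbT.
  exists [seq u <- nbhd v E | u != v]; first exact: mem_head.
  move=> u ue; rewrite mem_filter; apply/andP; split.
    by apply: contraNneq ve => <-; rewrite map_id in ue.
  by apply/mem_nbhd; exists e'; rewrite // ve' ee'.
have inst e : e \in map fst st.2 -> e != [::] ->
    exists2 e', e' \in E & {subset map id e <= e'}.
  by move=> est e0; have [/eqP|] := dom e est; first rewrite (negPf e0).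
pose U := elim_vars v st.2.
have mem_unsel e : e \in map fst (unsel v st.2) -> e \in map fst st.2 /\ v \notin e.
  rewrite /unsel; case: ifP => [_|/negbT nocc].
    by rewrite (map_fst_filter (fun e => v \notin e)) mem_filter => /andP[].
  move=> eps; have est : e \in map fst st.2.
    by case: (st.2) eps => //= p ps; rewrite inE => ->; rewrite orbT.
  split=> //; apply: contra nocc => ve; rewrite /occurs.
  by rewrite -[has _ _](has_map fst (fun e => v \in e)); apply/hasP; exists e.
have subU : U != [::] -> exists2 e', size (undup e') <= k /\ {subset U <= e'} &
    exists2 e'', e'' \in elim_step v E & {subset [seq u <- U | u != v] <= e''}.
  move=> U0; rewrite {}/U /elim_vars /sel in U0 *; case: ifP U0 => [_|nocc] U0.
    have subN : {subset norm (flatten [seq i.1 | i <- st.2 & v \in i.1]) <= nbhd v E}.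
      move=> u; rewrite mem_norm => /flattenP[e];
        rewrite (map_fst_filter (fun e => v \in e)).
      rewrite mem_filter => /andP[/= ve est] ue.
      have [|e' e'E ee'] := inst e est; first by apply: contraTneq ve => ->.
      by apply/mem_nbhd; exists e'; rewrite // !ee' // map_id.
    exists (nbhd v E); first by split.
    exists [seq u <- nbhd v E | u != v]; first exact: mem_head.
    by move=> u; rewrite mem_filter [in X in _ -> X]mem_filter => /andP[-> /subN].
  (* Here [v] occurs nowhere and the first piece was selected. Its variables lie in a single edge of
     [E], and every edge has at most [k] vertices. *)
  case E0 : (st.2) U0 nocc => [|p ps] //=; rewrite take0 /= cats0 => U0 nocc.
  have p0 : p.1 != [::] by apply: contraNneq U0 => ->.
  have [|e' e'E ee'] := inst p.1 _ p0; first by rewrite E0 mem_head.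
  exists e'; first by split; [apply: kE|move=> u; rewrite mem_norm => up; apply: ee';
    rewrite map_id].
  have vp : v \notin p.1 by apply: contraFN nocc => vp; rewrite /occurs /= vp.
  have [|e'' e''E ee''] := avoid p.1 vp; first by exists e'.
  by exists e'' => // u; rewrite mem_filter mem_norm => /andP[_ up]; apply: ee'';
    rewrite map_id.
split.
  move=> e /=; rewrite inE => /orP[/eqP->|/mem_unsel[est ve]]; last first.
    have [->|e0] := eqVneq e [::]; first by left.
    by right; apply: avoid => //; apply: inst.
  rewrite -/U; have [->|U0] := eqVneq U [::]; first by left.
  by right; have [e' _ [e'' ? ?]] := subU U0; exists e''; rewrite ?map_id.
rewrite /= geq_max wk -/U; have [->|U0] := eqVneq U [::] => //.
have [e' [ke' Ue'] _] := subU U0; apply: leq_trans ke'.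
by rewrite -(undup_id (norm_uniq _ : uniq U)); apply: size_undup_le.
Qed.

Lemma elim_pieces_dominated k (Fr : pred nat) (F : Type) comb vs us
    (st : nat * seq (seq nat * F)) E :
  dominated id (map fst st.2) E -> elimok k Fr E (vs ++ us) -> st.1 <= k ->
  exists E', [/\ dominated id (map fst (elim_pieces comb st vs).2) E',
                 elimok k Fr E' us & (elim_pieces comb st vs).1 <= k].
Proof.
elim: vs st E => [|v vs IH] st E dom ok wk; first by exists E.
have [dom' wk'] := @elim_piece_dominated k Fr F comb v (vs ++ us) st E dom ok wk.
by move: ok => /= /and3P[_ _ ok]; apply: IH dom' ok wk'.
Qed.

(** One hypergraph elimination covers both phases: casting the pieces leaves their lists of
    variables unchanged, so the second phase resumes where the first one stopped. *)
Lemma build_width (A F G : Type) (o : ops A F G) k (Fr : pred nat) ats ox os :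
  elimok k Fr (map (o_vars o) ats) (ox ++ os) -> (build o ats ox os).1 <= k.
Proof.
move=> ok; have [||E' [dom ok' wk]] := @elim_pieces_dominated k Fr F (comb_ex o) ox os
  (width0 (pieces0 o ats), pieces0 o ats) (map (o_vars o) ats) _ ok.
- move=> e; rewrite /pieces0 -map_comp (map_comp norm (o_vars o)) => /mapP[e' e'E ->].
  by right; exists e' => // u; rewrite map_id mem_norm.
- have {ok} : all (fun e => size (undup e) <= k) (map (o_vars o) ats).
    by case: (ox ++ os) ok => [|? ?] /= /andP[].
  rewrite /width0 /pieces0; elim: ats 0 (leq0n k) => //= a ats IH w wk /andP[ka /IH];
    apply.
  rewrite geq_max wk; apply: leq_trans ka; rewrite -(undup_id (norm_uniq _)).
  by apply: size_undup_le => u; rewrite mem_norm.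
have [||E'' [_ _ //]] := @elim_pieces_dominated k Fr G (comb_proj o) os [::]
  (cast_pieces o (phase1 o ats ox)) E' _ _ wk; last by rewrite cats0.
by rewrite /cast_pieces /= -map_comp.
Qed.

End Width.

Import Order.TTheory GRing.Theory Num.Theory.

Local Open Scope fmap_scope.

(** * Unfolding a sharp formula into counted pp-formulas *)

Definition atom (tau : signature) (N : Type) :=
  {R : symbol tau & (arity R).-tuple N}.

Definition amap tau (N M : Type) (f : N -> M) (a : atom tau N) : atom tau M :=
  existT _ (tag a) (map_tuple f (tagged a)).

Definition avars tau (N : Type) (a : atom tau N) : seq N := tval (tagged a).

Definition holds tau (N : Type) (B : structure tau) (e : N -> B) (a : atom tau N) :=
  map_tuple e (tagged a) \in interp B (tag a).

Lemma avars_amap tau N M (f : N -> M) (a : atom tau N) :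
  avars (amap f a) = map f (avars a).
Proof. by []. Qed.

Lemma holds_amap tau (N M : Type) (B : structure tau) (e : M -> B) (f : N -> M)
    (a : atom tau N) :
  holds e (amap f a) = holds (e \o f) a.
Proof.
case: a => R vs; rewrite /holds /=.
suff -> : map_tuple e (map_tuple f vs) = map_tuple (e \o f) vs by [].
by apply: eq_from_tnth => i; rewrite !tnth_map.
Qed.

Lemma eq_in_holds tau (N : eqType) (B : structure tau) (e e' : N -> B)
    (a : atom tau N) :
  {in avars a, e =1 e'} -> holds e a = holds e' a.
Proof.
case: a => R vs ee'; rewrite /holds /=.
suff -> : map_tuple e vs = map_tuple e' vs by [].
by apply: eq_from_tnth => i; rewrite !tnth_map ee' // mem_tnth.
Qed.

(** Only free variables keep numbers as names. Bound variables live in finite types, so disjoint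
    sums of types rename them apart when two formulas are combined. *)
Definition name (X S : Type) := (nat + (X + S))%type.

Definition inX X S (x : X) : name X S := inr (inl x).
Definition inS X S (s : S) : name X S := inr (inr s).

Definition name_env X S B (e : nat -> B) (g : X -> B) (f : S -> B) (t : name X S) : B :=
  match t with inl n => e n | inr (inl x) => g x | inr (inr s) => f s end.

Definition is_free X S (L : {fset var}) (t : name X S) : bool :=
  if t is inl n then n \in L else false.

(* The pp-formula with free variables in nat, liberal variables [pS] and
   quantified variables [pX]; [pox] and [pos] are elimination orders, the
   quantified variables being eliminated before the liberal ones. *)
Record ppf (tau : signature) := Ppf {
  pX : finType;
  pS : finType;
  pats : seq (atom tau (name pX pS));
  pox : seq pX;
  pos : seq pS
}.

Section Ppf.
Variable tau : signature.
Implicit Types (P : ppf tau) (B : structure tau) (L : {fset var}).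

Definition panswer P B (e : nat -> B) (f : pS P -> B) : bool :=
  [exists g : {ffun pX P -> B}, all (holds (name_env e g f)) (pats P)].

Definition pval P B (e : nat -> B) : int :=
  (\sum_(f : {ffun pS P -> B}) ((panswer e f : nat)%:Z))%R.

Definition edges P := map (@avars tau _) (pats P).

Definition elim_order P : seq (name (pX P) (pS P)) :=
  map (@inX _ _) (pox P) ++ map (@inS _ _) (pos P).

(** This is the invariant of the unfolding: both orders enumerate their type exactly once, the
    elimination costs at most [k], and all free names lie in [L]. *)
Definition pgood k L P :=
  [/\ uniq (pox P) /\ (forall x, x \in pox P),
      uniq (pos P) /\ (forall s, s \in pos P),
      elimok k (is_free L) (edges P) (elim_order P)
    & all (all (fun t => if t is inl n then n \in L else true)) (edges P)].

Lemma pgood_sub k L L' P : L `<=` L' -> pgood k L P -> pgood k L' P.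
Proof.
move=> /fsubsetP LL' [Xok Sok ok cl]; split=> //.
  by apply: elimok_sub ok => -[n|//]; apply: LL'.
by apply: sub_all cl => e; apply: sub_all => -[n|//]; apply: LL'.
Qed.

Lemma panswerP P B (e : nat -> B) (f : pS P -> B) :
  reflect (exists g : pX P -> B, all (holds (name_env e g f)) (pats P))
          (panswer e f).
Proof.
apply: (iffP existsP) => [[g ok]|[g ok]]; first by exists g.
exists (finfun g); apply: sub_all ok => a.
rewrite (@eq_in_holds _ _ _ _ (name_env e (finfun g) f)) // => -[n|[x|s]] _ //=.
by rewrite ffunE.
Qed.

Lemma eq_panswer P B (e e' : nat -> B) (f f' : pS P -> B) :
  e =1 e' -> f =1 f' -> panswer e f = panswer e' f'.
Proof.
move=> ee' ff'; apply: eq_existsb => g; apply: eq_all => a.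
by apply: eq_in_holds => -[n|[x|s]] _ /=.
Qed.

Definition patom (a : atom tau nat) : ppf tau :=
  @Ppf tau void void [:: amap inl a] [::] [::].

Lemma pval_noS P B (e : nat -> B) (f : pS P -> B) :
  (pS P -> False) -> pval P e = ((panswer e f : nat)%:Z)%R.
Proof.
move=> noS; rewrite /pval (bigD1 [ffun s => f s]) //= big1 ?addr0.
  by congr ((nat_of_bool _)%:Z)%R; apply: eq_panswer => // s; case: (noS s).
by move=> g /eqP[]; apply/ffunP => s; case: (noS s).
Qed.

Definition ptrue : ppf tau := @Ppf tau void void [::] [::] [::].

Lemma ptrue_good k L : pgood k L ptrue.
Proof. by split => //=; split=> // -[]. Qed.

Lemma pval_ptrue B (e : nat -> B) : pval ptrue e = 1%R.
Proof.
rewrite (@pval_noS ptrue _ _ (fun s => match s with end)) //.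
by rewrite (_ : panswer _ _) //; apply/panswerP;
  exists (fun x : void => match x with end).
Qed.

Lemma patom_good k L a :
  {subset avars a <= L} -> #|` L| <= k -> pgood k L (patom a).
Proof.
move=> aL Lk; split; [by split=> [|[]]|by split=> [|[]]| |].
  rewrite /= /elim_order /= !andbT; apply/andP; split; last first.
    by rewrite avars_amap all_map; apply/allP => v /aL.
  rewrite avars_amap undup_map_inj; last by move=> ? ? [].
  rewrite size_map; apply: leq_trans Lk.
  apply: (@uniq_leq_size _ _ (enum_fset L)); first exact: undup_uniq.
    by move=> v; rewrite mem_undup => /aL.
by rewrite /edges /= andbT all_map; apply/allP => v /aL.
Qed.

Lemma pval_patom a B (e : nat -> B) : pval (patom a) e = ((holds e a : nat)%:Z)%R.
Proof.
rewrite (@pval_noS (patom a) _ _ (fun s => match s with end)) //.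
congr ((nat_of_bool _)%:Z)%R; apply/panswerP/idP => /=.
  by move=> [g]; rewrite andbT holds_amap.
by exists (fun x : void => match x with end); rewrite andbT holds_amap.
Qed.

Section Times.
Variables P1 P2 : ppf tau.

Let N := name (pX P1 + pX P2) (pS P1 + pS P2).

Definition name_l (t : name (pX P1) (pS P1)) : N :=
  match t with
  | inl n => inl n | inr (inl x) => inX _ (inl x) | inr (inr s) => inS _ (inl s)
  end.

Definition name_r (t : name (pX P2) (pS P2)) : N :=
  match t with
  | inl n => inl n | inr (inl x) => inX _ (inr x) | inr (inr s) => inS _ (inr s)
  end.

Definition ptimes : ppf tau := @Ppf tau (pX P1 + pX P2)%type (pS P1 + pS P2)%type
  (map (amap name_l) (pats P1) ++ map (amap name_r) (pats P2))
  (map inl (pox P1) ++ map inr (pox P2)) (map inl (pos P1) ++ map inr (pos P2)).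

Lemma name_l_inj : injective name_l.
Proof. by move=> [n|[x|s]] [n'|[x'|s']] //= [->]. Qed.

Lemma name_r_inj : injective name_r.
Proof. by move=> [n|[x|s]] [n'|[x'|s']] //= [->]. Qed.

Lemma panswer_ptimes B (e : nat -> B) (f : pS P1 + pS P2 -> B) :
  panswer (P := ptimes) e f
  = panswer (P := P1) e (f \o inl) && panswer (P := P2) e (f \o inr).
Proof.
apply/panswerP/andP => [[g]|[/panswerP[g1 ok1] /panswerP[g2 ok2]]].
  rewrite all_cat !all_map => /andP[ok1 ok2]; split; apply/panswerP.
    exists (g \o inl); apply: sub_all ok1 => a /=; rewrite holds_amap => ok_a.
    by apply: etrans ok_a; apply: eq_in_holds => -[n|[x|s]].
  exists (g \o inr); apply: sub_all ok2 => a /=; rewrite holds_amap => ok_a.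
  by apply: etrans ok_a; apply: eq_in_holds => -[n|[x|s]].
exists (fun x => match x with inl y => g1 y | inr y => g2 y end).
rewrite all_cat !all_map; apply/andP; split.
  apply: sub_all ok1 => a /=; rewrite holds_amap => ok_a.
  by apply: etrans ok_a; apply: eq_in_holds => -[n|[x|s]].
apply: sub_all ok2 => a /=; rewrite holds_amap => ok_a.
by apply: etrans ok_a; apply: eq_in_holds => -[n|[x|s]].
Qed.

Lemma big_ffun_sum (B : finType) (S1 S2 : finType) (G : {ffun S1 + S2 -> B} -> int) :
  (\sum_f G f = \sum_(f1 : {ffun S1 -> B}) \sum_(f2 : {ffun S2 -> B})
    G [ffun s => match s with inl s => f1 s | inr s => f2 s end])%R.
Proof.
rewrite pair_big /=.
rewrite (reindex (fun p : {ffun S1 -> B} * {ffun S2 -> B} =>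
  [ffun s => match s with inl s => p.1 s | inr s => p.2 s end])) //=.
exists (fun f : {ffun S1 + S2 -> B} => ([ffun s => f (inl s)], [ffun s => f (inr s)])).
  by case=> f1 f2 _ /=; congr (_, _); apply/ffunP => s; rewrite !ffunE.
by move=> f _; apply/ffunP => -[s|s]; rewrite !ffunE.
Qed.

Lemma pval_ptimes B (e : nat -> B) :
  (pval ptimes e = pval P1 e * pval P2 e)%R.
Proof.
rewrite /pval big_ffun_sum big_distrl; apply: eq_bigr => f1 _.
rewrite big_distrr; apply: eq_bigr => f2 _ /=.
rewrite panswer_ptimes -PoszM mulnb.
rewrite (@eq_panswer P1 B e e _ f1) //; last by move=> s; rewrite /= ffunE.
by rewrite (@eq_panswer P2 B e e _ f2) // => s; rewrite /= ffunE.
Qed.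

(** The combined order takes the quantified variables of both parts first and then the liberal ones
    of both. Restricted to either part it is that part's own order, and the parts share free names
    only. *)
Lemma ptimes_good k L : pgood k L P1 -> pgood k L P2 -> pgood k L ptimes.
Proof.
move=> [[uX1 aX1] [uS1 aS1] ok1 cl1] [[uX2 aX2] [uS2 aS2] ok2 cl2].
have inlI A A' : injective (@inl A A') by move=> ? ? [].
have inrI A A' : injective (@inr A A') by move=> ? ? [].
have ucat (A A' : eqType) (s : seq A) (s' : seq A') : uniq s -> uniq s' ->
    uniq (map inl s ++ map inr s' : seq (A + A')).
  move=> us us'; rewrite cat_uniq (map_inj_uniq (@inlI _ _)) (map_inj_uniq (@inrI _ _))
    us us' andbT /=.
  by apply/hasPn => _ /mapP[x _ ->]; apply/mapP => -[].
have acat (A A' : eqType) (s : seq A) (s' : seq A') : (forall x, x \in s) ->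
    (forall x, x \in s') -> forall t, t \in (map inl s ++ map inr s' : seq (A + A')).
  move=> as_ as' [x|x]; rewrite mem_cat; first by rewrite map_f.
  by apply/orP; right; apply: map_f.
have E : edges ptimes = map (map name_l) (edges P1) ++ map (map name_r) (edges P2).
  by rewrite /edges /= map_cat -!map_comp.
split; [by split; [apply: ucat|apply: acat]|by split; [apply: ucat|apply: acat]| |];
  last first.
  rewrite E all_cat (all_map (map name_l)) (all_map (map name_r)); apply/andP; split.
    by apply: sub_all cl1 => e /=; rewrite all_map; apply: sub_all => -[n|[]].
  by apply: sub_all cl2 => e /=; rewrite all_map; apply: sub_all => -[n|[]].
pose p (t : N) := match t with
  | inr (inl (inl _)) | inr (inr (inl _)) => true | _ => false end.
rewrite E; apply: (elimok_interleave (p := p)).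
- rewrite all_map; apply: sub_all cl1 => e /=; rewrite all_map.
  by apply: sub_all => -[n|[]].
- rewrite all_map; apply: sub_all cl2 => e /=; rewrite all_map.
  by apply: sub_all => -[n|[]].
- by rewrite /elim_order all_cat !all_map; apply/andP; split; apply/allP.
- rewrite (_ : filter _ _ = map name_l (elim_order P1)).
    apply: elimok_map; first exact: name_l_inj.
    by apply: elimok_sub ok1 => -[n|[]].
  rewrite /elim_order !map_cat !filter_cat -!map_comp !filter_map.
  rewrite (@eq_filter _ _ predT _ (pox P1)) // filter_predT.
  rewrite (@eq_filter _ _ pred0 _ (pox P2)) // filter_pred0.
  rewrite (@eq_filter _ _ predT _ (pos P1)) // filter_predT.
  by rewrite (@eq_filter _ _ pred0 _ (pos P2)) // filter_pred0 /= !cats0.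
rewrite (_ : filter _ _ = map name_r (elim_order P2)).
  apply: elimok_map; first exact: name_r_inj.
  by apply: elimok_sub ok2 => -[n|[]].
rewrite /elim_order !map_cat !filter_cat -!map_comp !filter_map.
rewrite (@eq_filter _ _ pred0 _ (pox P1)) // filter_pred0.
rewrite (@eq_filter _ _ predT _ (pox P2)) // filter_predT.
rewrite (@eq_filter _ _ pred0 _ (pos P1)) // filter_pred0.
by rewrite (@eq_filter _ _ predT _ (pos P2)) // filter_predT.
Qed.

End Times.
End Ppf.

Lemma is_free_small (X S : eqType) k (L : {fset var}) : #|` L| <= k ->
  exists Fs : seq (name X S),
    size (undup Fs) <= k /\ {subset (is_free L : pred (name X S)) <= Fs}.
Proof.
move=> Lk; exists (map inl (enum_fset L)); split; last first.
  by move=> [n|t] //= nL; apply: map_f.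
by rewrite (leq_trans (size_undup _)) // size_map.
Qed.

Section PpfEx.
Variables (tau : signature) (x : nat) (P : ppf tau).

Definition name_ex (t : name (pX P) (pS P)) : name (option (pX P)) (pS P) :=
  match t with
  | inl n => if n == x then inX _ None else inl n
  | inr (inl y) => inX _ (Some y) | inr (inr s) => inS _ s
  end.

Definition pexists : ppf tau := @Ppf tau (option (pX P)) (pS P)
  (map (amap name_ex) (pats P)) (rcons (map Some (pox P)) None) (pos P).

Definition upd (B : Type) (e : nat -> B) v b n := if n == v then b else e n.

Lemma panswer_pexists (B : structure tau) (e : nat -> B) (f : pS P -> B) :
  panswer (P := pexists) e f = [exists b : B, panswer (P := P) (upd e x b) f].
Proof.
apply/panswerP/existsP => [[g]|[b /panswerP[g ok]]].
  rewrite all_map => ok; exists (g None); apply/panswerP; exists (g \o Some).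
  apply: sub_all ok => a /=; rewrite holds_amap => ok_a.
  apply: etrans ok_a; apply: eq_in_holds => -[n|[y|s]] _ //=.
  by rewrite /upd; case: eqP.
exists (fun y => if y is Some y then g y else b); rewrite all_map.
apply: sub_all ok => a /=; rewrite holds_amap => ok_a.
apply: etrans ok_a; apply: eq_in_holds => -[n|[y|s]] _ //=.
by rewrite /upd; case: eqP.
Qed.

Lemma name_ex_inj : injective name_ex.
Proof.
move=> [n|[y|s]] [n'|[y'|s']] //=; do ?case: eqP => //; try by move=> ? ? [->].
- by move=> -> ->.
- by move=> [->].
- by move=> [->].
Qed.

(** The new quantified variable must come last among the quantified ones and before all liberal
    ones. With no liberal variable present this is the end of the whole order, where eliminating a
    free variable costs nothing new. Inside a cast this situation always holds. *)
Lemma pexists_good k L :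
  (pS P -> False) -> #|` L| <= k -> pgood k L P -> pgood k (L `\ x) pexists.
Proof.
move=> noS Lk [[uX aX] [uS aS] ok cl].
have pos0 : pos P = [::] by case: (pos P) => // s; case: (noS s).
have someI (A : Type) : injective (@Some A) by move=> ? ? [].
have E : edges pexists = map (map name_ex) (edges P).
  by rewrite /edges /= -!map_comp.
split=> //.
- split; first rewrite /= rcons_uniq (map_inj_uniq (@someI _)) uX andbT.
    by apply/mapP => -[].
  by case=> [y|]; rewrite /= mem_rcons inE ?(map_f Some (aX y)) ?orbT.
- rewrite E (_ : elim_order pexists = map name_ex (elim_order P ++ [:: inl x])).
    apply: elimok_map; first exact: name_ex_inj.
    apply: (@elimok_sub _ _ (is_free (L `\ x))).
      by move=> [n|//] /=; case: eqP => [->|//]; rewrite !inE eqxx.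
    apply: (elimok_cat ok (is_free_small _ _ Lk)) => -[n|//] /= nL.
    by rewrite mem_seq1 !inE nL andbT => /eqP neq; apply/eqP => n_x; apply: neq;
      rewrite n_x.
  rewrite /elim_order /= pos0 /= !cats0 map_cat /= eqxx map_rcons -cats1 -!map_comp.
  by congr cat; apply: eq_map.
rewrite E all_map; apply: sub_all cl => e /=; rewrite all_map.
apply: sub_all => -[n|[y|s]] //=; case: eqP => //= /eqP nx nL.
by rewrite !inE nL nx.
Qed.

End PpfEx.

Section PpfProj.
Variables (tau : signature) (V : {fset var}) (P : ppf tau).

Definition name_proj (t : name (pX P) (pS P)) : name (pX P) (pS P + V) :=
  match t with
  | inl n => if insub n is Some v then inS _ (inr v) else inl n
  | inr (inl y) => inX _ y | inr (inr s) => inS _ (inl s)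
  end.

(** Every element of [V] becomes a liberal variable, including those that are not free in the
    formula: such a variable occurs in no atom and contributes the factor [#|B|] demanded by the
    semantics. *)
Definition pproj : ppf tau := @Ppf tau (pX P) (pS P + V)%type
  (map (amap name_proj) (pats P)) (pox P) (map inl (pos P) ++ map inr (enum {: V})).

Definition override (B : Type) (e : nat -> B) (g : V -> B) n :=
  if insub n is Some v then g v else e n.

Lemma panswer_pproj (B : structure tau) (e : nat -> B) (f : pS P + V -> B) :
  panswer (P := pproj) e f
  = panswer (P := P) (override e (f \o inr)) (f \o inl).
Proof.
apply/panswerP/panswerP => -[g]; rewrite ?all_map => ok; exists g; rewrite ?all_map.
  apply: sub_all ok => a /=; rewrite holds_amap => ok_a.
  apply: etrans ok_a; apply: eq_in_holds => -[n|[y|s]] _ //=.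
  by rewrite /override; case: insubP.
apply: sub_all ok => a /=; rewrite holds_amap => ok_a.
apply: etrans ok_a; apply: eq_in_holds => -[n|[y|s]] _ //=.
by rewrite /override; case: insubP.
Qed.

Lemma pval_pproj (B : structure tau) (e : nat -> B) :
  pval pproj e = (\sum_(g : {ffun V -> B}) pval P (override e g))%R.
Proof.
rewrite /pval big_ffun_sum exchange_big; apply: eq_bigr => g _.
apply: eq_bigr => f _; rewrite panswer_pproj.
rewrite (@eq_panswer tau P B _ (override e g) _ f) // => [n|s] /=.
  by rewrite /override; case: insubP => // v _ _; rewrite /= ffunE.
by rewrite ffunE.
Qed.

Lemma name_proj_inj : injective name_proj.
Proof.
move=> [n|[y|s]] [n'|[y'|s']] //=; do ?case: insubP => //=.
- by move=> u _ <- u' _ <- [->].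
- by move=> _ _ [->].
- by move=> [->].
- by move=> [->].
Qed.

Lemma pproj_good k L : #|` L| <= k -> pgood k L P -> pgood k (L `\` V) pproj.
Proof.
move=> Lk [[uX aX] [uS aS] ok cl].
have inlI A A' : injective (@inl A A') by move=> ? ? [].
have inrI A A' : injective (@inr A A') by move=> ? ? [].
have E : edges pproj = map (map name_proj) (edges P).
  by rewrite /edges /= -!map_comp.
split=> //.
- split=> [|[s|v]] /=.
  + rewrite cat_uniq (map_inj_uniq (@inlI _ _)) (map_inj_uniq (@inrI _ _)) uS enum_uniq.
    by rewrite andbT; apply/hasPn => _ /mapP[v _ ->]; apply/mapP => -[].
  + by rewrite mem_cat map_f.
  + by rewrite mem_cat; apply/orP; right; apply: map_f; rewrite mem_enum.
- rewrite E (_ : elim_order pproj = map name_proj (elim_order P ++ map (inl \o val)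
  (enum {: V}))).
    apply: elimok_map; first exact: name_proj_inj.
    apply: (@elimok_sub _ _ (is_free (L `\` V))).
      move=> [n|//] /=; rewrite !inE => /andP[nV nL].
      by rewrite insubN //= !inE nV.
    apply: (elimok_cat ok (is_free_small _ _ Lk)) => -[n|//] /= nL nV.
    rewrite !inE nL andbT; apply: contra nV => nV.
    by apply/mapP; exists [` nV]; rewrite ?mem_enum.
  rewrite /elim_order /= !map_cat -!map_comp catA; congr ((_ ++ _) ++ _).
  by apply: eq_map => v /=; rewrite valK.
rewrite E all_map; apply: sub_all cl => e /=; rewrite all_map.
apply: sub_all => -[n|[y|s]] //=; case: insubP => //= nV nL.
by rewrite !inE nL andbT.
Qed.

End PpfProj.

Definition agrees (B : Type) (h : {fmap var -> B}) (e : nat -> B) (L : {fset var}) :=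
  {in L, forall x, h.[? x] = Some (e x)}.

Lemma agrees_sub B (h : {fmap var -> B}) e (L L' : {fset var}) :
  L' `<=` L -> agrees h e L -> agrees h e L'.
Proof. by move=> /fsubsetP LL' he x /LL'; apply: he. Qed.

Lemma bool_int_neq0 (b : bool) : ((b : nat)%:Z != 0)%R = b.
Proof. by case: b. Qed.

Section Unfolding.
Variables (tau : signature) (k : nat).

Lemma fo_sat_Atom (B : structure tau) R vs (h : {fmap var -> B}) e :
  {in tval vs, forall x, h.[? x] = Some (e x)} ->
  fo_sat (@Atom tau R vs) h = holds e (existT _ R vs).
Proof.
move=> he /=; have -> : [seq h.[? x] | x <- vs] = [seq Some a | a <- map e vs].
  by rewrite -map_comp; apply/eq_in_map.
apply/existsP/idP => [[b /andP[bR /eqP eq_b]]|ok]; last first.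
  by exists (map_tuple e vs); rewrite [_ \in _]ok /=.
rewrite /holds /=; suff <- : b = map_tuple e vs by [].
by apply: val_inj; apply: (@inj_map _ _ Some) => [? ? []|].
Qed.

(** Without liberal variables [pval] runs over a single empty assignment and is thus a truth value.
    This lets conjunction be treated as a product. *)
Lemma pp_unfold (phi : fo tau) : is_pp phi ->
  all (fun theta => #|` fo_free theta| <= k) (fo_subformulas phi) ->
  exists P : ppf tau, [/\ pS P -> False, pgood k (fo_free phi) P &
    forall (B : structure tau) (e : nat -> B) h, agrees h e (fo_free phi) ->
      fo_sat phi h = (pval P e != 0%R)].
Proof.
elim: phi => // [R vs|phi IH phi' IH'|x phi IH] /=.
- move=> _ /andP[kR _]; exists (patom (existT _ R vs)); split; first by case.
    by apply: patom_good => // v vvs; rewrite inE.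
  move=> B e h he; rewrite pval_patom.
  have /= -> := @fo_sat_Atom B R vs h e; first by case: (holds _ _).
  by move=> v vvs; apply: he; rewrite inE.
- move=> /andP[pp pp']; rewrite all_cat => /and3P[_ kphi kphi'].
  have [P [noS ok val]] := IH pp kphi; have [P' [noS' ok' val']] := IH' pp' kphi'.
  exists (ptimes P P'); split; first by case.
    by apply: ptimes_good; apply: pgood_sub; [|exact: ok| |exact: ok'];
      rewrite ?fsubsetUl ?fsubsetUr.
  move=> B e h he; rewrite pval_ptimes mulf_eq0 negb_or.
  rewrite (val B e h) ?(val' B e h) //.
    exact: agrees_sub (fsubsetUr _ _) he.
  exact: agrees_sub (fsubsetUl _ _) he.
move=> pp /andP[_ kphi]; have [P [noS ok val]] := IH pp kphi.
exists (pexists x P); split=> //.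
  apply: pexists_good => //.
  by move: kphi; clear; case: phi => [? ?|?|? ?|? ?|? ?|? ?]; case/andP.
move=> B e h he.
rewrite (@pval_noS _ (pexists x P) _ _ (fun s => False_rect _ (noS s))) //.
rewrite panswer_pexists bool_int_neq0 /=.
apply: eq_existsb => b; rewrite (val B (upd e x b)).
  by rewrite (@pval_noS _ P _ _ (fun s => False_rect _ (noS s))) // bool_int_neq0.
move=> y yphi; rewrite fnd_set /upd; case: eqP => // /eqP yx.
by apply: he; rewrite !inE yx.
Qed.

(** Products of sums are indexed by pairs and sums by disjoint unions. A projection passes through
    the sum, an expansion only enlarges the set of allowed free names, and a constant is the
    coefficient of [ptrue]. None of these raises the cost of a term above [k]. *)
Lemma sharp_unfold (psi : sharp tau) : is_sharp psi -> all_casts_pp psi ->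
  all (fun theta => #|` sh_free theta| <= k) (sharp_subformulas psi) ->
  all (fun theta => #|` fo_free theta| <= k) (sharp_fo_subformulas psi) ->
  exists (I : finType) (c : I -> int) (P : I -> ppf tau),
    (forall i, pgood k (sh_free psi) (P i)) /\
    forall (B : structure tau) (e : nat -> B) h, agrees h e (sh_free psi) ->
      sh_eval psi h = (\sum_i c i * pval (P i) e)%R.
Proof.
have kfree psi0 : all (fun theta : sharp tau => #|` sh_free theta| <= k)
    (sharp_subformulas psi0) -> #|` sh_free psi0| <= k.
  by case: psi0 => [? ?|? ?|? ?|? ?|? ?|?]; case/andP.
elim: psi => /= [phi L|V psi IH|V psi IH|psi IH psi' IH'|psi IH psi' IH'|n].
- move=> phiL pp _ kphi; have [P [noS ok val]] := pp_unfold pp kphi.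
  exists unit, (fun=> 1%R), (fun=> P); split=> [_|B e h he].
    exact: pgood_sub phiL ok.
  rewrite (bigD1 tt) //= big1 ?addr0 ?mul1r => [|[] //].
  rewrite (val _ e) ?(@pval_noS _ P _ _ (fun s => False_rect _ (noS s))) //.
    by case: panswer.
  exact: agrees_sub he.
- move=> /andP[sh _] pp /andP[_ kpsi] kfo.
  have [I [c [P [ok val]]]] := IH sh pp kpsi kfo.
  exists I, c, (fun i => pproj V (P i)); split=> [i|B e h he].
    by apply: pproj_good => //; apply: kfree.
  under [RHS]eq_bigr => i _ do rewrite pval_pproj big_distrr /=.
  rewrite exchange_big; apply: eq_bigr => g _; apply: val => x xpsi.
  rewrite fnd_restrict xpsi fnd_cat /override /=.
  case: insubP => [v vV /= vx|xV].
    by rewrite vV /fnd /= -vx valK.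
  by rewrite (negPf xV) he // !inE xV.
- move=> /and3P[sh _ _] pp /andP[_ kpsi] kfo.
  have [I [c [P [ok val]]]] := IH sh pp kpsi kfo.
  exists I, c, P; split=> [i|B e h he].
    by apply: pgood_sub (ok i); apply: fsubsetUr.
  by apply: val => x xpsi; rewrite fnd_restrict xpsi he // inE xpsi orbT.
- move=> /and4P[sh sh' /eqP eqf _] /andP[pp pp']; rewrite !all_cat.
  move=> /and3P[_ kpsi kpsi'] /andP[kfo kfo'].
  have [I [c [P [ok val]]]] := IH sh pp kpsi kfo.
  have [I' [c' [P' [ok' val']]]] := IH' sh' pp' kpsi' kfo'.
  exists (I * I')%type, (fun i => c i.1 * c' i.2)%R, (fun i => ptimes (P i.1) (P' i.2)).
  split=> [i|B e h he]; first by apply: ptimes_good => //; rewrite eqf.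
  rewrite (val B e) // (val' B e) -?eqf // big_distrlr pair_big.
  by apply: eq_bigr => i _; rewrite pval_ptimes mulrACA.
- move=> /and3P[sh sh' /eqP eqf] /andP[pp pp']; rewrite !all_cat.
  move=> /and3P[_ kpsi kpsi'] /andP[kfo kfo'].
  have [I [c [P [ok val]]]] := IH sh pp kpsi kfo.
  have [I' [c' [P' [ok' val']]]] := IH' sh' pp' kpsi' kfo'.
  exists (I + I')%type, (fun i => match i with inl i => c i | inr i => c' i end),
    (fun i => match i with inl i => P i | inr i => P' i end).
  split=> [[i|i]|B e h he] //; first by rewrite eqf.
  by rewrite (val B e) // (val' B e) -?eqf // big_sumType.
move=> _ _ _ _; exists unit, (fun=> n), (fun=> ptrue tau).
split=> [_|B e h _]; first exact: ptrue_good.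
by rewrite (bigD1 tt) //= big1 ?addr0 ?pval_ptrue ?mulr1 // => -[].
Qed.

End Unfolding.

(** * Linear independence of counting functions *)

Section Hom.
Variable tau : signature.

Definition is_hom (A B : structure tau) (g : A -> B) : bool :=
  [forall R, [forall t in interp A R, map_tuple g t \in interp B R]].

Lemma is_homP (A B : structure tau) (g : A -> B) :
  reflect (forall R t, t \in interp A R -> map_tuple g t \in interp B R) (is_hom g).
Proof.
apply: (iffP forallP) => [h R t|h R]; first by move/forall_inP: (h R); apply.
by apply/forall_inP => t; apply: h.
Qed.

Lemma eq_is_hom (A B : structure tau) (g g' : A -> B) : g =1 g' -> is_hom g = is_hom g'.
Proof.
move=> gg'; apply: eq_forallb => R; apply: eq_forallb => t.
suff -> : map_tuple g t = map_tuple g' t by [].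
by apply: eq_from_tnth => i; rewrite !tnth_map.
Qed.

Lemma is_hom_id (A : structure tau) : is_hom (@id A).
Proof.
apply/is_homP => R t tR; suff -> : map_tuple id t = t by [].
by apply: eq_from_tnth => i; rewrite tnth_map.
Qed.

Lemma is_hom_comp (A B C : structure tau) (g : A -> B) (g' : B -> C) :
  is_hom g -> is_hom g' -> is_hom (g' \o g).
Proof.
move=> /is_homP hg /is_homP hg'; apply/is_homP => R t /hg /hg'.
suff -> : map_tuple g' (map_tuple g t) = map_tuple (g' \o g) t by [].
by apply: eq_from_tnth => i; rewrite !tnth_map.
Qed.

(* A pp-formula given by its canonical structure [prA], in which [pri] marks
   the liberal variables. *)
Record ppair := Ppair {
  prA : structure tau;
  prS : finType;
  pri : prS -> prA;
  pri_inj : injective pri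
}.

Implicit Types (p q : ppair) (B D : structure tau).

Definition is_answer p B (f : prS p -> B) : bool :=
  [exists g : {ffun prA p -> B}, is_hom g && [forall s, g (pri s) == f s]].

Lemma is_answerP p B (f : prS p -> B) :
  reflect (exists2 g : prA p -> B, is_hom g & forall s, g (pri s) = f s) (is_answer f).
Proof.
apply: (iffP existsP) => [[g /andP[hg /forallP gf]]|[g hg gf]].
  by exists g => // s; apply/eqP.
exists (finfun g); rewrite (@eq_is_hom _ _ _ g) => [|x]; last by rewrite ffunE.
by rewrite hg; apply/forallP => s; rewrite ffunE gf.
Qed.

Lemma eq_is_answer p B (f f' : prS p -> B) :
  f =1 f' -> is_answer f = is_answer f'.
Proof.
by move=> ff'; apply: eq_existsb => g; congr andb; apply: eq_forallb => s; rewrite ff'.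
Qed.

Definition nanswers p B : nat := #|[set f : {ffun prS p -> B} | is_answer f]|.

(* Having such a homomorphism in both directions amounts to renaming
   equivalence; bijectivity on the liberal variables follows by counting. *)
Definition ple p q : bool :=
  [exists g : {ffun prA p -> prA q},
    is_hom g && [forall s, exists s', g (pri s') == pri s]].

Lemma pleP p q :
  reflect (exists2 g : prA p -> prA q, is_hom g & forall s, exists s', g (pri s') = pri s)
          (ple p q).
Proof.
apply: (iffP existsP) => [[g /andP[hg /forallP gs]]|[g hg gs]].
  by exists g => // s; have /existsP[s' /eqP] := gs s; exists s'.
exists (finfun g); rewrite (@eq_is_hom _ _ _ g) => [|x]; last by rewrite ffunE.
rewrite hg; apply/forallP => s; have [s' eq_s] := gs s.
by apply/existsP; exists s'; rewrite ffunE eq_s.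
Qed.

Lemma ple_refl p : ple p p.
Proof. by apply/pleP; exists id => [|s]; [apply: is_hom_id|exists s]. Qed.

Lemma ple_trans q p r : ple p q -> ple q r -> ple p r.
Proof.
move=> /pleP[g hg gs] /pleP[g' hg' gs']; apply/pleP.
exists (g' \o g) => [|s]; first exact: is_hom_comp.
have [s' eq_s] := gs' s; have [s'' eq_s'] := gs s'.
by exists s''; rewrite /= eq_s' eq_s.
Qed.

Lemma ple_card p q : ple p q -> #|prS q| <= #|prS p|.
Proof.
move=> /pleP[g hg gs].
have /fin_all_exists[t tP] : forall s, exists s', g (pri s') = pri s by [].
by apply: (@leq_card _ _ t) => s s' eq_t; apply: (@pri_inj q); rewrite -!tP eq_t.
Qed.

(** Comparability in both directions forces equally many liberal variables, so choosing preimages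
    under [g] gives a bijection. Reindexing answers along its inverse is injective. *)
Lemma ple_nanswers p q B : ple p q -> ple q p -> nanswers q B <= nanswers p B.
Proof.
move=> pq qp; have eq_card : #|prS p| = #|prS q|.
  by apply/eqP; rewrite eqn_leq !ple_card.
case/pleP: pq => g hg gs.
have /fin_all_exists[t tP] : forall s, exists s', g (pri s') = pri s by [].
have tI : injective t.
  by move=> s s' eq_t; apply: (@pri_inj q); rewrite -!tP eq_t.
have [u tu ut] := inj_card_bij tI (eq_leq eq_card).
have F_inj : injective (fun f : {ffun prS q -> B} => [ffun s => f (u s)]).
  move=> f f' /ffunP eq_f; apply/ffunP => s.
  by have := eq_f (t s); rewrite !ffunE tu.
rewrite /nanswers -(card_imset _ F_inj); apply: subset_leq_card.
apply/subsetP => f' /imsetP[f]; rewrite inE => /is_answerP[h hh hf] ->.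
rewrite inE; apply/is_answerP; exists (h \o g) => [|s]; first exact: is_hom_comp.
by rewrite ffunE -hf /=; congr h; rewrite -tP ut.
Qed.

Lemma eq_nanswers p q B : ple p q -> ple q p -> nanswers p B = nanswers q B.
Proof. by move=> pq qp; apply/eqP; rewrite eqn_leq !ple_nanswers. Qed.

End Hom.

(** * Blow-ups and the weights of inclusion-exclusion *)

Section BlowUp.
Variable tau : signature.
Variables (D : structure tau) (S : finType) (i : S -> D) (U : {set S}).
Hypothesis i_inj : injective i.
Local Open Scope ring_scope.

Definition blow_proj (x : D + {s in U}) : D :=
  match x with inl d => d | inr s => i (val s) end.

(* [D] with the elements marked by [U] doubled. *)
Definition blow_up : structure tau :=
  @Structure tau (D + {s in U})%type
    (fun R => [set t | map_tuple blow_proj t \in interp D R]).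

(** Relations of the blow-up are pulled back along [blow_proj], so copies may be chosen freely
    element by element when a homomorphism is lifted. *)
Lemma is_answer_blow_up (p : ppair tau) (f : prS p -> blow_up) :
  is_answer f = is_answer (fun s => blow_proj (f s)).
Proof.
have hom_proj : is_hom (blow_proj : blow_up -> D).
  by apply/is_homP => R t; rewrite inE.
apply/is_answerP/is_answerP => [[g hg gf]|[g hg gf]].
  exists (fun x => blow_proj (g x)) => [|s]; last by rewrite gf.
  exact: is_hom_comp hg hom_proj.
(* Marked elements take the copy that [f] prescribes, which is consistent because [pri] is
   injective; all others take the original. *)
pose g' x : blow_up := if [pick s | pri s == x] is Some s then f s else inl (g x).
have g'g x : blow_proj (g' x) = g x.
  by rewrite /g'; case: pickP => // s /eqP <-; rewrite gf.
exists g' => [|s]; last first.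
  rewrite /g'; case: pickP => [s' /eqP/(@pri_inj _ p)-> //|/(_ s)].
  by rewrite eqxx.
apply/is_homP => R t tR; rewrite inE.
suff -> : map_tuple blow_proj (map_tuple g' t) = map_tuple g t.
  by apply: (is_homP _ hg).
by apply: eq_from_tnth => j; rewrite !tnth_map g'g.
Qed.

(** An answer [f] over [D] lifts independently at each [s], in two ways if [f s] is doubled and in
    one way otherwise. *)
Lemma nanswers_blow_up (p : ppair tau) :
  ((nanswers p blow_up)%:R : int) =
  \sum_(f : {ffun prS p -> D} | is_answer f)
    \prod_s (1 + \sum_(u in U) (i u == f s)%:R).
Proof.
rewrite /nanswers -sum1_card natr_sum.
transitivity (\sum_(f : {ffun prS p ->
  blow_up} | is_answer (fun s => blow_proj (f s))) 1 : int).
  by apply: eq_bigl => f; rewrite inE is_answer_blow_up.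
rewrite (partition_big (fun f : {ffun prS p -> blow_up} => [ffun s => blow_proj (f s)])
  (fun f => is_answer f)) => [|f /=]; last first.
  by rewrite (@eq_is_answer _ _ _ [ffun s => blow_proj (f s)] (fun s =>
    blow_proj (f s))) // => s; rewrite ffunE.
apply: eq_bigr => f ans_f.
transitivity (\prod_s \sum_(x : blow_up) ((blow_proj x == f s)%:R : int)); last first.
  apply: eq_bigr => s _; rewrite big_sumType /= (bigD1 (f s)) //= eqxx.
  rewrite big1 ?addr0 => [|d /negPf -> //]; congr (_ + _).
  by rewrite (big_sub _ (fun u => ((i u == f s)%:R : int))).
rewrite bigA_distr_bigA big_mkcond /=; apply: eq_bigr => f' _.
case: ifPn => [/andP[_ /eqP <-]|].
  by rewrite big1 // => s _; rewrite ffunE eqxx.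
rewrite negb_and => /orP[nans|nf].
  have [/forallP eq_f|/forallPn[s ns]] := boolP [forall s, blow_proj (f' s) == f s].
    by case/negP: nans; rewrite (@eq_is_answer _ _ _ _ f) // => s; apply/eqP.
  by rewrite (bigD1 s) //= (negPf ns) mul0r.
have [/forallP eq_f|/forallPn[s ns]] := boolP [forall s, blow_proj (f' s) == f s].
  by case/eqP: nf; apply/ffunP => s; rewrite ffunE; apply/eqP.
by rewrite (bigD1 s) //= (negPf ns) mul0r.
Qed.

End BlowUp.

Section Weight.
Variable tau : signature.
Local Open Scope ring_scope.
Implicit Types p q : ppair tau.

(* Inclusion-exclusion over blow-ups of the canonical structure of [q] isolates
   the answers to [p] that hit every liberal variable of [q]. *)
Definition weight p q : int :=
  \sum_(U : {set prS q})
    (\prod_s (if s \in U then 1 else -1)) * (nanswers p (blow_up (@pri _ q) U))%:R.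

(** Per element [u] the factor is 2^m, where m is the number of [s] with [f s] equal to [pri u]. The
    signed sum over [U] then expands the product of these factors minus one. *)
Lemma weightE p q :
  weight p q = \sum_(f : {ffun prS p -> prA q} | is_answer f)
    \prod_(u : prS q) (\prod_s (1 + (pri u == f s)%:R) - 1).
Proof.
rewrite /weight.
under eq_bigr => U _ do rewrite nanswers_blow_up big_distrr /=.
rewrite exchange_big; apply: eq_bigr => f _.
rewrite bigA_distr; apply: eq_big => [U|U _]; first by rewrite inE.
(* By injectivity of [pri] at most one [u] matches [f s], so one plus the sum over [U] equals the
   product over [U]. *)
have -> : \prod_s (1 + \sum_(u in U) ((pri u == f s)%:R : int))
    = \prod_(u in U) \prod_s (1 + (pri u == f s)%:R).
  rewrite exchange_big; apply: eq_bigr => s _.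
  have [/existsP[u /andP[uU /eqP eq_u]]|no_u] := boolP [exists u,
    (u \in U) && (pri u == f s)].
    rewrite (bigD1 u) //= [RHS](bigD1 u) //= eq_u eqxx big1 ?addr0 => [|v /andP[_ vu]].
      rewrite big1 ?mulr1 // => v /andP[_ vu].
      by rewrite -eq_u (inj_eq (@pri_inj _ q)) (negPf vu) addr0.
    by rewrite -eq_u (inj_eq (@pri_inj _ q)) (negPf vu).
  have {}no_u u : u \in U -> (pri u == f s) = false.
    by move=> uU; apply: contraNF no_u => eq_u; apply/existsP; exists u; rewrite uU.
  rewrite !big1 ?addr0 // => u uU; first by rewrite no_u ?addr0.
  by rewrite no_u.
rewrite [X in _ * X]big_mkcond -big_split /=; apply: eq_bigr => u _.
by case: ifP; rewrite ?mul1r ?mulr1.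
Qed.

Lemma term_ge0 p q (f : {ffun prS p -> prA q}) (u : prS q) :
  0 <= \prod_s (1 + (pri u == f s)%:R) - 1 :> int.
Proof.
rewrite subr_ge0; elim/big_ind: _ => // [x y x1 y1|s _]; last by rewrite lerDl.
by rewrite -[leLHS]mulr1 ler_pM.
Qed.

(** Each answer contributes a product of numbers 2^m - 1, which is nonnegative, and positive exactly
    when every liberal variable of [q] is hit. Such an answer comes from a homomorphism witnessing
    [ple p q]. *)
Lemma weight_neq0 p q : (weight p q != 0) = ple p q.
Proof.
rewrite weightE; apply/idP/idP => [|/pleP[g hg gs]]; last first.
  pose f := [ffun s => g (pri s)].
  rewrite gt_eqF // (bigD1 f) /=; last first.
    by apply/is_answerP; exists g => // s; rewrite ffunE.
  rewrite ltr_wpDr //.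
    by apply: sumr_ge0 => f' _; apply: prodr_ge0 => u _; apply: term_ge0.
  apply: prodr_gt0 => u _; have [s eq_s] := gs u.
  rewrite subr_gt0 (bigD1 s) //= ffunE eq_s eqxx.
  have : 1 <= \prod_(s' | s' != s) (1 + (pri u == f s')%:R) :> int.
    elim/big_ind: _ => // [x y x1 y1|s' _]; last by rewrite lerDl.
    by rewrite -[leLHS]mulr1 ler_pM.
  by move=> le1; apply: lt_le_trans (_ : 1 < 2%:R) _; rewrite // ler_peMr.
apply: contraR => npq; apply/eqP; apply: big1 => f /is_answerP[g hg gf].
have [/forallP cov|/forallPn[u /existsPn nu]] :=
  boolP [forall u : prS q, [exists s, f s == pri u]].
  case/negP: npq; apply/pleP; exists g => // u.
  by have /existsP[s /eqP eq_s] := cov u; exists s; rewrite gf.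
rewrite (bigD1 u) //= big1 ?subrr ?mul0r // => s _.
by rewrite eq_sym (negPf (nu s)) addr0.
Qed.

Lemma eq_weight p p' q : ple p p' -> ple p' p -> weight p q = weight p' q.
Proof.
by move=> pp' p'p; apply: eq_bigr => U _; congr (_ * _%:R); apply: eq_nanswers.
Qed.

End Weight.

(** * Integer relations between counting functions are trivial *)

Section Independence.
Variables (tau : signature) (I : finType) (c : I -> int) (p : I -> ppair tau).
Local Open Scope ring_scope.

Hypothesis relation : forall B : structure tau, (exists x : B, True) ->
  \sum_i c i * (nanswers (p i) B)%:R = 0.
Hypothesis inhab : forall i, exists x : prA (p i), True.

Let equ i j := ple (p i) (p j) && ple (p j) (p i).
(** [pick] depends only on the predicate, so equivalent indices get the same representative. *)
Let repr i := odflt i [pick j | equ i j].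

Let equ_repr i : equ i (repr i).
Proof. by rewrite /repr; case: pickP => //= _; rewrite /equ ple_refl. Qed.

Let eq_repr i j : equ i j -> repr i = repr j.
Proof.
move=> ij; rewrite /repr; have e : equ i =1 equ j.
  move=> k; case/andP: ij => ij ji; apply/andP/andP => -[ik ki]; split.
  - exact: ple_trans ji ik.
  - exact: ple_trans ki ij.
  - exact: ple_trans ij ik.
  - exact: ple_trans ki ji.
by rewrite (eq_pick e); case: pickP => // /(_ j); rewrite /equ ple_refl.
Qed.

Let coef j := \sum_(i | repr i == j) c i.

(** A weight is an integer combination of counts on blow-ups of [q], so any relation between counts
    passes to weights. The blow-ups are inhabited because [q] is. *)
Let sum_weight q : (exists x : prA q, True) -> \sum_j coef j * weight (p j) q = 0.
Proof.
move=> [x _].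
transitivity (\sum_i c i * weight (p i) q); last first.
  rewrite /weight; under eq_bigr => i _ do rewrite big_distrr /=.
  rewrite exchange_big big1 // => U _.
  under eq_bigr => i _ do rewrite mulrCA.
  by rewrite -big_distrr /= relation ?mulr0 //; exists (inl x).
rewrite [RHS](partition_big repr xpredT) //=; apply: eq_bigr => j _.
rewrite /coef big_distrl; apply: eq_bigr => i /eqP <-.
by congr (_ * _); case/andP: (equ_repr i) => ? ?; apply: eq_weight.
Qed.

Let coef_neq0 j : coef j != 0 -> repr j = j.
Proof.
move=> nz; have [i /eqP ri|none] := pickP (fun i => repr i == j).
  by rewrite -[in LHS]ri -(eq_repr (equ_repr i)).
by move: nz; rewrite /coef big_pred0 ?eqxx.
Qed.

(* In the relation evaluated at [p j], only the classes below that of [j] have a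
   nonzero weight, so induction along the order leaves the term of [j] alone. *)
Let coef_eq0 j : coef j = 0.
Proof.
have [n] := ubnP #|[set i | ple (p i) (p j)]|; elim: n j => // n IH j le_n.
apply/eqP/contraT => nz; have := sum_weight (inhab j).
rewrite (bigD1 j) //= big1 ?addr0 => [/eqP|k kj].
  by rewrite mulf_eq0 (negPf nz) -[_ == 0]negbK weight_neq0 ple_refl.
have [kj_le|nkj] := boolP (ple (p k) (p j)); last first.
  by apply/eqP; rewrite mulf_eq0 orbC -[_ == 0]negbK weight_neq0 nkj.
have [jk_le|njk] := boolP (ple (p j) (p k)).
  have [->|nzk] := eqVneq (coef k) 0; first by rewrite mul0r.
  case/eqP: kj; rewrite -(coef_neq0 nzk) -(coef_neq0 nz).
  by apply: eq_repr; rewrite /equ kj_le.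
rewrite IH ?mul0r //; apply: leq_trans (_ : _ <= _)%N (ltnSE le_n); apply: proper_card.
apply/properP; split.
  by apply/subsetP => i; rewrite !inE => ik; apply: ple_trans ik kj_le.
by exists j; rewrite !inE ?ple_refl.
Qed.

Lemma lone_coef_eq0 j :
  (forall i, ple (p i) (p j) -> ple (p j) (p i) -> i = j) -> c j = 0.
Proof.
move=> lone; rewrite -[RHS](coef_eq0 (repr j)) /coef (bigD1 j) //=.
rewrite big1 ?addr0 // => i /andP[/eqP ri /eqP[]]; apply: lone.
  apply: ple_trans (_ : ple (p i) (p (repr i))) _; first by case/andP: (equ_repr i).
  by rewrite ri; case/andP: (equ_repr j).
apply: ple_trans (_ : ple (p j) (p (repr j))) _; first by case/andP: (equ_repr j).
by rewrite -ri; case/andP: (equ_repr i).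
Qed.

End Independence.

(** The formula [q] is added to the family as index [None] with coefficient -1. If no [p i] were
    equivalent to it, its class would be a singleton, and this coefficient would have to vanish. *)
Lemma independence (tau : signature) (I : finType) (c : I -> int)
    (p : I -> ppair tau) (q : ppair tau) :
  (exists x : prA q, True) -> (forall i, exists x : prA (p i), True) ->
  (forall B : structure tau, (exists x : B, True) ->
    (nanswers q B)%:R = \sum_i c i * (nanswers (p i) B)%:R)%R ->
  exists2 i, ple q (p i) & ple (p i) q.
Proof.
move=> xq xp eqn.
pose c' o := (if o is Some i then c i else -1)%R.
pose p' o := if o is Some i then p i else q.
have big_opt (F : option I -> int) : (\sum_o F o = F None + \sum_i F (Some i))%R.
  rewrite (bigD1 None) //=; congr (_ + _)%R.
  rewrite (reindex_omap Some id) => [|[]] //=.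
  by apply: eq_bigl => i; rewrite eqxx.
have rel (B : structure tau) : (exists x : B, True) ->
    (\sum_o c' o * (nanswers (p' o) B)%:R = 0)%R.
  by move=> xB; rewrite big_opt /= eqn // mulN1r addNr.
have xp' o : exists x : prA (p' o), True by case: o.
have [i /andP[qi iq]|none] := pickP (fun i => ple q (p i) && ple (p i) q);
  first by exists i.
have : c' None = 0%R by apply: (lone_coef_eq0 rel xp') => -[i|] //= iq qi;
  have := none i; rewrite iq qi.
by [].
Qed.

(** * The lower bound *)

(* For [h = c \o a] with the image of [c \o a] as small as possible, [h] is
   injective on its image, and hence so is [a]. *)
Lemma retraction tau (p q : ppair tau) : ple q p -> ple p q ->
  exists (a : prA q -> prA p) (h : prA q -> prA q),
    [/\ is_hom a /\ is_hom h,
        (forall s, exists s', a (pri s') = pri s) /\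
          (forall s', exists s, a (pri s') = pri s),
        forall s, exists s', h (pri s') = pri s
      & forall x y, a (h x) = a (h y) -> h x = h y].
Proof.
move=> qp pq; have cardS : #|prS q| <= #|prS p| by apply: ple_card.
case/pleP: qp => a ha aS; case/pleP: pq => b hb bS.
pose good (c : {ffun prA p -> prA q}) :=
  is_hom c && [forall s, exists s', c (a (pri s')) == pri s].
have good_b : good (finfun b).
  rewrite /good (@eq_is_hom _ _ _ (finfun b) b) => [|x]; last by rewrite ffunE.
  rewrite hb; apply/forallP => s; have [s' eq_s] := bS s.
  have [s'' eq_s'] := aS s'; apply/existsP; exists s''.
  by rewrite ffunE eq_s' eq_s.
pose im (c : {ffun prA p -> prA q}) := [set c (a x) | x in [set: prA q]].
case: (@arg_minnP _ (finfun b) good (fun c => #|im c|) good_b) => c /andP[hc cS] min_c.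
pose h x := c (a x).
have hh : is_hom h by apply: is_hom_comp ha hc.
have hS s : exists s', h (pri s') = pri s.
  by have /existsP[s' /eqP] := forallP cS s; exists s'.
exists a, h; split=> //; first split=> // s'.
  have /fin_all_exists[t tP] : forall s, exists s', a (pri s') = pri s by [].
  have tI : injective t.
    by move=> s s1 eq_t; apply: (@pri_inj _ p); rewrite -!tP eq_t.
  by have [u tu ut] := inj_card_bij tI cardS; exists (u s'); rewrite -tP ut.
(* The map [h \o c] is admissible too and has image [h @: im c]. By minimality of [im c] the map [h]
   cannot shrink it. *)
have h_inj : {in im c &, injective h}.
  apply/imset_injP; rewrite eqn_leq leq_imset_card /=.
  have := min_c [ffun x => h (c x)]; rewrite (_ : im [ffun x => h (c x)] = h @: im c).
    apply; rewrite /good (@eq_is_hom _ _ _ [ffun x => h (c x)] (h \o c)) => [|x];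
      last first.
      by rewrite ffunE.
    rewrite (is_hom_comp hc hh); apply/forallP => s; have [s' eq_s] := hS s.
    have [s'' eq_s'] := hS s'; apply/existsP; exists s''.
    by rewrite ffunE -/(h _) eq_s' eq_s.
  by rewrite /im -imset_comp; apply: eq_imset => x; rewrite /= ffunE.
move=> x y eq_a; apply: h_inj; rewrite ?imset_f ?inE //.
by rewrite /h -/(h x) -/(h y) eq_a.
Qed.

(** * From an equivalent term back to an order on the variables of the input *)

Section PpairOfPpf.
Variables (tau : signature) (P : ppf tau).

Definition bound_name (t : name (pX P) (pS P)) : option (pX P + pS P) :=
  if t is inr z then Some z else None.

(* The extra element [None] keeps the universe inhabited. *)
Definition ppf_structure : structure tau :=
  @Structure tau (option (pX P + pS P))
    (fun R => [set t : (arity R).-tuple (option (pX P + pS P)) |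
       (existT _ R t : atom tau _) \in map (amap bound_name) (pats P)]).

Definition ppf_pri (s : pS P) : ppf_structure := Some (inr s).

Lemma ppf_pri_inj : injective ppf_pri.
Proof. by move=> s s' [->]. Qed.

Definition ppair_of_ppf : ppair tau := Ppair ppf_pri_inj.

Lemma nanswers_ppf k (B : structure tau) (e : nat -> B) : pgood k fset0 P ->
  ((nanswers ppair_of_ppf B)%:Z = pval P e)%R.
Proof.
case=> _ _ _ /allP closed.
have bound a t : a \in pats P -> t \in avars a -> exists z, t = inr z.
  move=> aP; case: t => [n|z]; last by exists z.
  by move=> /(allP (closed _ (map_f _ aP))).
rewrite /nanswers -sum1_card -natz natr_sum /pval big_mkcond; apply: eq_bigr => f _.
rewrite inE; suff -> : is_answer (p := ppair_of_ppf) f = panswer e f by case: panswer.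
apply/is_answerP/panswerP => [[g hg gf]|[g ok]].
  exists (fun x => g (Some (inl x))); apply/allP => a aP.
  have : tagged (amap bound_name a) \in interp ppf_structure (tag a).
    by rewrite inE; apply: (map_f (amap bound_name)).
  move/(is_homP _ hg) => ok; apply: etrans ok; rewrite -/(holds g (amap bound_name a)).
  rewrite holds_amap; apply: eq_in_holds => t /(bound _ _ aP)[[x|s] ->] //=.
  by rewrite -gf.
pose g' (z : option (pX P + pS P)) :=
  match z with Some (inl x) => g x | Some (inr s) => f s | None => e 0 end.
exists g' => //; apply/is_homP => R t; rewrite inE => /mapP[a aP eq_t].
have := allP ok a aP.
suff -> : holds (name_env e g f) a = holds g' (existT _ R t : atom tau _) by [].
rewrite eq_t holds_amap; apply: eq_in_holds => u /(bound _ _ aP)[[x|s] ->] //.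
Qed.

End PpairOfPpf.

(* Variables are renamed apart: the liberal variable [s] becomes [s.*2] and
   quantified variables become odd. *)
Definition solves tau (B : structure tau) (ats : seq (atom tau nat))
    (S : {fset var}) (f : S -> B) : Prop :=
  exists2 e : nat -> B, all (holds e) ats & forall s, e (val s).*2 = f s.

Lemma all_le_bigmax (A : Type) (F : A -> nat) s w :
  \max_(x <- s) F x <= w -> all (fun x => F x <= w) s.
Proof. by elim: s => //= x s IH; rewrite big_cons geq_max => /andP[-> /IH]. Qed.

Section Instance.
Variables (tau : signature) (ats : seq (atom tau nat)) (S : {fset var}).
Variables (V : seq nat) (v0 : seq_sub V).
Hypothesis uV : uniq V.
Hypothesis atsV : all (fun a => all [in V] (avars a)) ats.
Hypothesis SV : forall v, ~~ odd v -> (v \in V) = (v./2 \in S).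

Definition inst_structure : structure tau :=
  @Structure tau (seq_sub V)
    (fun R => [set t : (arity R).-tuple (seq_sub V) |
       (existT _ R (map_tuple val t) : atom tau nat) \in ats]).

Definition inst_pri (s : S) : inst_structure := insubd v0 (val s).*2.

Lemma val_inst_pri s : val (inst_pri s) = (val s).*2.
Proof.
by rewrite /inst_pri val_insubd SV ?odd_double // doubleK (valP s).
Qed.

Lemma inst_pri_inj : injective inst_pri.
Proof.
move=> s s' eq_s; apply/val_inj/double_inj.
by rewrite -!val_inst_pri eq_s.
Qed.

Definition inst_pair : ppair tau := Ppair inst_pri_inj.

Lemma inst_atom a : a \in ats ->
  exists2 t : (arity (tag a)).-tuple (seq_sub V),
    map_tuple val t = tagged a & t \in interp inst_structure (tag a).
Proof.
move=> aats; have aV := allP (allP atsV a aats).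
exists (map_tuple (insubd v0) (tagged a)).
  apply: eq_from_tnth => i; rewrite !tnth_map val_insubd.
  by rewrite (aV (tnth (tagged a) i)) // mem_tnth.
rewrite inE; suff -> : map_tuple val (map_tuple (insubd v0) (tagged a)) = tagged a.
  by case: a aats {aV}.
apply: eq_from_tnth => i; rewrite !tnth_map val_insubd.
by rewrite (aV (tnth (tagged a) i)) // mem_tnth.
Qed.

Lemma inst_answerP (B : structure tau) (f : S -> B) :
  reflect (solves ats f) (is_answer (p := inst_pair) f).
Proof.
apply: (iffP (is_answerP _)) => [[g hg gf]|[e ok ef]].
  exists (fun v => g (insubd v0 v)) => [|s]; last by rewrite -gf.
  apply/allP => a /inst_atom[t eq_t /(is_homP _ hg)].
  apply: etrans; rewrite /holds -eq_t.
  suff -> : map_tuple g t = map_tuple (fun v => g (insubd v0 v)) (map_tuple val t) by [].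
  by apply: eq_from_tnth => i; rewrite !tnth_map valKd.
exists (fun v => e (val v)) => [|s]; last by rewrite val_inst_pri ef.
apply/is_homP => R t; rewrite inE => /(allP ok); apply: etrans.
rewrite /holds /=.
suff -> : map_tuple e (map_tuple val t) = map_tuple (fun v => e (val v)) t by [].
by apply: eq_from_tnth => i; rewrite !tnth_map.
Qed.

Section LowerBound.
Variables (k : nat) (P : ppf tau).
Hypothesis P_good : pgood k fset0 P.
Hypothesis qp : ple inst_pair (ppair_of_ppf P).
Hypothesis pq : ple (ppair_of_ppf P) inst_pair.

(** The map [a], injective on the image of [h], embeds the image atoms into those of [P], so the
    order of [P] pulls back. As [a] matches liberal with liberal variables, the pulled-back order
    already has the odd variables before the even ones. *)
Lemma pull_order : exists (h : nat -> nat) (vs : seq nat),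
  [/\ all (fun a => amap h a \in ats) ats,
      {in V, forall v, h v \in V},
      {in V, forall v, ~~ odd v -> exists2 u, u \in V & ~~ odd u /\ h u = v},
      perm_eq vs V
    & elimok k predT (map (@avars tau nat) (map (amap h) ats))
        (filter odd vs ++ filter (predC odd) vs)].
Proof.
have [a [h [[ha hh] [aS aS'] hS a_inj]]] := retraction qp pq.
have {}hS : forall s, exists s', h (inst_pri s') = inst_pri s := hS.
have {}aS : forall s : pS P, exists s', a (inst_pri s') = Some (inr s) := aS.
have {}aS' : forall s', exists s : pS P, a (inst_pri s') = Some (inr s) := aS'.
(* The name [inl 0] stands for elements sent to [None]. No edge of [P] contains it, since [P] is
   closed. *)
pose a' v : name (pX P) (pS P) :=
  if insub v is Some u then if a u is Some z then inr z else inl 0 else inl 0.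
pose h' v := val (h (insubd v0 v)).
(* [C] is the image of [h]; only there is [a'] known to be injective, so [inv] searches preimages in
   [C]. *)
pose C := [seq val (h u) | u : seq_sub V].
pose inv t := ohead [seq v <- C | a' v == t].
have a'E u : a' (val u) = if a u is Some z then inr z else inl 0.
  by rewrite /a' valK.
have inv_a : ocancel inv a'.
  move=> t; rewrite /inv; case E : [seq v <- C | a' v == t] => [|v s] //=.
  have : v \in [seq v <- C | a' v == t] by rewrite E mem_head.
  by rewrite mem_filter => /andP[/eqP].
have C_inv t v : inv t = Some v -> v \in C.
  rewrite /inv; case E : [seq v <- C | a' v == t] => [|w s] //= [<-].
  have : w \in [seq v <- C | a' v == t] by rewrite E mem_head.
  by rewrite mem_filter => /andP[].
have a'_inj : {in C &, injective a'}.
  move=> _ _ /mapP[u _ ->] /mapP[w _ ->]; rewrite !a'E => eq_a.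
  congr val; apply: a_inj; move: eq_a.
  by case: (a (h u)) => [z|]; case: (a (h w)) => [z'|] // [->].
have a_inv v : v \in C -> inv (a' v) = Some v.
  move=> vC; case E : (inv (a' v)) => [w|].
    congr Some; apply: a'_inj => //; first exact: C_inv E.
    by have := inv_a (a' v); rewrite E.
  move: E; rewrite /inv; case E : [seq _ <- _ | _] => // _.
  have : v \in [seq w <- C | a' w == a' v] by rewrite mem_filter eqxx.
  by rewrite E.
have CV v : v \in C -> v \in V by move=> /mapP[u _ ->]; apply: valP.
case: (P_good) => -[uX aX] [uS aS0] ok closed.
pose pull := pmap inv (elim_order P).
pose pullX := pmap inv (map (@inX _ _) (pox P)).
pose pullS := pmap inv (map (@inS _ _) (pos P)).
have pullE : pull = pullX ++ pullS by rewrite /pull /elim_order pmap_cat.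
(* An even variable is liberal and [a] sends it to a liberal name, so it cannot lie above a
   quantified one. *)
have oddX v : v \in pullX -> odd v.
  rewrite mem_pmap => /mapP[t /mapP[x _ ->] /esym eq_v].
  apply: contraT => ev; have vV := CV _ (C_inv _ _ eq_v).
  have := inv_a (inX _ x); rewrite eq_v /=.
  have vS : v./2 \in S by rewrite -SV.
  have -> : v = val (inst_pri [` vS]) by rewrite val_inst_pri /= even_halfK.
  by rewrite a'E; have [s ->] := aS' [` vS].
(* Every liberal name is already the image of some even variable in [C], and injectivity on [C]
   leaves no other preimage there. *)
have evenS v : v \in pullS -> ~~ odd v.
  rewrite mem_pmap => /mapP[t /mapP[s _ ->] /esym eq_v].
  have [s' eq_s'] := aS s; have [s'' eq_s''] := hS s'.
  have sC : val (inst_pri s') \in C.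
    by rewrite -eq_s''; apply/mapP; exists (inst_pri s''); rewrite ?mem_enum.
  suff -> : v = val (inst_pri s') by rewrite val_inst_pri odd_double.
  apply: a'_inj => //; first exact: C_inv eq_v.
  by have := inv_a (inS _ s); rewrite eq_v /= => ->; rewrite a'E eq_s'.
have evenP v : v \in V -> ~~ odd v -> v \in pull.
  move=> vV ev; have vS : v./2 \in S by rewrite -SV.
  have eq_v : val (inst_pri [` vS]) = v by rewrite val_inst_pri /= even_halfK.
  have [s'' eq_s''] := hS [` vS]; have [s eq_s] := aS' [` vS].
  have vC : v \in C.
    by rewrite -eq_v -eq_s''; apply/mapP; exists (inst_pri s''); rewrite ?mem_enum.
  rewrite pullE mem_cat; apply/orP; right; rewrite mem_pmap.
  apply/mapP; exists (inS _ s).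
    by apply: map_f.
  by rewrite -(a_inv v vC); congr inv; rewrite -eq_v a'E eq_s.
(* The variables missed by the pulled-back order are all odd and occur in no image atom. They go
   first, as isolated vertices. *)
pose vs := [seq v <- V | v \notin pull] ++ pull.
exists h', vs; split.
- apply/allP => b bats; have [t eq_t tR] := inst_atom bats.
  have := is_homP _ hh _ _ tR; rewrite inE.
  suff -> : amap h' b = existT _ (tag b) (map_tuple val (map_tuple h t)) by [].
  rewrite /amap; congr existT.
  apply: eq_from_tnth => i; rewrite -eq_t !tnth_map /h'; congr (val (h _)).
  by rewrite valKd.
- by move=> v _; apply: valP.
- move=> v vV ev; have vS : v./2 \in S by rewrite -SV.
  have [s eq_s] := hS [` vS]; exists (val (inst_pri s)); first exact: valP.
  by rewrite val_inst_pri odd_double /h' -val_inst_pri valKd eq_s val_inst_pri /=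
    even_halfK.
- have pullV v : v \in pull -> v \in V.
    by rewrite mem_pmap => /mapP[t _ /esym/C_inv/CV].
  apply: uniq_perm => //; last first.
    move=> v; rewrite mem_cat mem_filter; case: (boolP (v \in pull)) => [/pullV -> //|_].
    by rewrite orbF.
  rewrite cat_uniq filter_uniq //=; apply/andP; split.
    by apply/hasPn => v vp; rewrite mem_filter vp.
  apply: (pmap_uniq inv_a); rewrite /elim_order cat_uniq.
  rewrite !map_inj_uniq ?uX ?uS; try by move=> ? ? [].
  by rewrite andbT; apply/hasPn => _ /mapP[s _ ->]; apply/mapP => -[].
have -> : filter odd vs ++ filter (predC odd) vs = vs.
  have oddR : {in [seq v <- V | v \notin pull], forall v, odd v}.
    move=> v; rewrite mem_filter => /andP[vp vV].
    by apply: contraR vp => ev; apply: evenP.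
  rewrite /vs; set R := [seq v <- V | _] in oddR *; rewrite pullE !filter_cat.
  have /all_filterP -> : all odd R by apply/allP.
  have /all_filterP -> : all odd pullX by apply/allP.
  have /all_filterP -> : all (predC odd) pullS by apply/allP.
  rewrite (@eq_in_filter _ odd pred0 pullS) => [|v /evenS/negPf -> //].
  rewrite (@eq_in_filter _ (predC odd) pred0 pullX) => [|v /oddX /= -> //].
  rewrite (@eq_in_filter _ (predC odd) pred0 R) => [|v /oddR /= -> //].
  by rewrite !filter_pred0 cats0 -catA.
have domE : dominated a' (map (@avars tau nat) (map (amap h') ats)) (edges P).
  move=> e; rewrite -map_comp => /mapP[b bats ->]; right.
  have [t eq_t tR] := inst_atom bats.
  have := is_homP _ ha _ _ (is_homP _ hh _ _ tR).
  rewrite inE => /mapP[c cP eq_c]; exists (avars c); first exact: map_f.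
  have cb u : u \in avars c -> exists z, u = inr z.
    case: u => [n|z]; last by exists z.
    by move=> /(allP (allP closed _ (map_f _ cP))).
  have eq_bc : map a (map h t) = map (@bound_name tau P) (avars c).
    rewrite -avars_amap -eq_c; done.
  rewrite /=; have -> : avars (amap h' b) = map val (map h t).
    rewrite avars_amap /avars -eq_t /= -!map_comp; apply: eq_map => u /=.
    by rewrite /h' valKd.
  rewrite -map_comp => w /mapP[u ut ->]; rewrite /= a'E.
  have /mapP[x xc ->] : a u \in map (@bound_name tau P) (avars c) by rewrite -eq_bc map_f.
  by have [z eq_x] := cb x xc; rewrite eq_x /= -eq_x.
have CE : all (all [in C]) (map (@avars tau nat) (map (amap h') ats)).
  apply/allP => e; rewrite -map_comp => /mapP[b _ ->]; apply/allP => v.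
  rewrite /= avars_amap => /mapP[u _ ->].
  by apply/mapP; exists (insubd v0 u); rewrite ?mem_enum.
have ok' : elimok k predT (map (@avars tau nat) (map (amap h') ats)) pull.
  apply: (@elimok_sub _ _ (preim a' (is_free fset0))) => //.
  exact: (elimok_dominated (C := [in C]) inv_a a_inv CE domE ok).
apply: elimok_isolated ok' => v; rewrite mem_filter => /andP[vp _].
apply/allP => e eE; apply: contra vp => ve.
have [e0|[e' e'P ee']] := domE e eE; first by rewrite e0 in ve.
(* A variable of an image atom lies in [C], and its name occurs in a closed edge of [P]. That name
   is bound, hence listed in the order, so the variable is pulled back after all. *)
have vC := allP (allP CE e eE) v ve.
rewrite mem_pmap; apply/mapP; exists (a' v); last by rewrite a_inv.
have ae' : a' v \in e' by apply/ee'/map_f.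
rewrite mem_cat; case: (a' v) ae' => [n|[x|s]].
- by move=> /(allP (allP closed _ e'P)).
- by move=> _; rewrite map_f.
by move=> _; apply/orP; right; apply: map_f.
Qed.

End LowerBound.

Lemma order_of_representation (psi : sharp tau) :
  is_sharpPP psi -> sh_free psi = fset0 ->
  (forall B : structure tau, (exists x : B, True) ->
    (nanswers inst_pair B)%:Z%R = sh_eval psi ([fmap] : {fmap var -> B})) ->
  exists (h : nat -> nat) (vs : seq nat),
  [/\ all (fun a => amap h a \in ats) ats,
      {in V, forall v, h v \in V},
      {in V, forall v, ~~ odd v -> exists2 u, u \in V & ~~ odd u /\ h u = v},
      perm_eq vs V
    & elimok (width psi) predT (map (@avars tau nat) (map (amap h) ats))
        (filter odd vs ++ filter (predC odd) vs)].
Proof.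
case/andP=> sh pp closed eval.
have [] := @sharp_unfold tau (width psi) psi sh pp.
- exact: all_le_bigmax (leq_maxl _ _).
- exact: all_le_bigmax (leq_maxr _ _).
move=> I [c [P [ok val]]]; rewrite closed in ok.
have [||B [x _]|i qi iq] :=
  independence (c := c) (p := fun i => ppair_of_ppf (P i)) (q := inst_pair).
- by exists v0.
- by move=> i; exists None.
- rewrite natz eval; last by exists x.
  rewrite (val B (fun=> x)) => [|y]; last by rewrite closed.
  by apply: eq_bigr => i _; rewrite natz (nanswers_ppf (fun=> x) (ok i)).
exact: pull_order (ok i) qi iq.
Qed.

End Instance.

(** * Correctness of the elimination algorithm *)

Lemma eq_fo_sat tau (B : structure tau) (phi : fo tau) (h h' : {fmap var -> B}) :
  {in fo_free phi, forall x, h.[? x] = h'.[? x]} -> fo_sat phi h = fo_sat phi h'.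
Proof.
have ext x (phi' : fo tau) (g g' : {fmap var -> B}) b :
    {in fo_free phi' `\ x, forall y, g.[? y] = g'.[? y]} ->
    {in fo_free phi', forall y, g.[x <- b].[? y] = g'.[x <- b].[? y]}.
  move=> gg' y yphi; rewrite !fnd_set; case: eqP => // /eqP yx.
  by apply: gg'; rewrite !inE yx.
elim: phi h h' => /= [R vs|phi IH|phi IH phi' IH'|phi IH phi' IH'|x phi IH|x phi IH] h
  h' hh'.
- have -> // : [seq h.[? x] | x <- vs] = [seq h'.[? x] | x <- vs].
  by apply/eq_in_map => x xvs; apply: hh'; rewrite inE.
- by rewrite (IH h h').
- by rewrite (IH h h') ?(IH' h h') // => x xphi; apply: hh'; rewrite inE xphi ?orbT.
- by rewrite (IH h h') ?(IH' h h') // => x xphi; apply: hh'; rewrite inE xphi ?orbT.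
- by apply: eq_existsb => b; apply/IH/ext.
by apply: eq_forallb => b; apply/IH/ext.
Qed.

Lemma eq_sh_eval tau (B : structure tau) (psi : sharp tau) (h h' : {fmap var -> B}) :
  is_sharp psi -> {in sh_free psi, forall x, h.[? x] = h'.[? x]} ->
  sh_eval psi h = sh_eval psi h'.
Proof.
elim: psi h h' => /= [phi L|V psi IH|V psi IH|psi IH psi' IH'|psi IH psi' IH'|n] h h'.
- move=> /fsubsetP phiL hh'; rewrite (@eq_fo_sat _ _ _ h h') // => x /phiL.
  exact: hh'.
- move=> _ hh'; apply: eq_bigr => g _; congr sh_eval; apply/fmapP => x.
  rewrite !fnd_restrict; case: ifP => // xpsi; rewrite !fnd_cat /=.
  by case: ifPn => // xV; apply: hh'; rewrite !inE xV.
- move=> _ hh'; congr sh_eval; apply/fmapP => x.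
  rewrite !fnd_restrict; case: ifP => // xpsi.
  by apply: hh'; rewrite inE xpsi orbT.
- move=> /and4P[sh sh' /eqP eqf _] hh'; rewrite (IH h h') ?(IH' h h') //.
  by rewrite -eqf.
- move=> /and3P[sh sh' /eqP eqf] hh'; rewrite (IH h h') ?(IH' h h') //.
  by rewrite -eqf.
by [].
Qed.

Lemma card_fset_le (L : {fset nat}) (s : seq nat) : {subset L <= s} -> #|` L| <= size s.
Proof. by move=> Ls; apply: (@uniq_leq_size _ (enum_fset L)) => //; apply: fset_uniq. Qed.

Lemma sel_unsel (R : Type) (idx : R) (op : Monoid.com_law idx) (F : Type)
    (f : seq nat * F -> R) v ps :
  \big[op/idx]_(p <- ps) f p
  = op (\big[op/idx]_(p <- sel v ps) f p) (\big[op/idx]_(p <- unsel v ps) f p).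
Proof.
rewrite /sel /unsel; case: ifP => _; last first.
  case: ps => [|p ps] /=; first by rewrite !big_nil Monoid.mul1m.
  by rewrite take0 big_cons big_seq1.
by rewrite !big_filter (bigID (fun p => v \in p.1) xpredT).
Qed.

Lemma sel_unsel_all (F : Type) (a : pred (seq nat * F)) v ps :
  all a ps = all a (sel v ps) && all a (unsel v ps).
Proof. by rewrite -!big_all; apply: sel_unsel. Qed.

Lemma unsel_avoid (F : Type) v (ps : seq (seq nat * F)) :
  all (fun p => v \notin p.1) (unsel v ps).
Proof.
rewrite /unsel; case: ifP => [_|/negbT]; first exact: filter_all.
by rewrite /occurs -all_predC => /= H; case: ps H => //= p ps /andP[_].
Qed.

Lemma sel_neq0 (F : Type) v (ps : seq (seq nat * F)) :
  0 < size ps -> 0 < size (sel v ps).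
Proof.
by rewrite /sel; case: ifP => [|_]; [rewrite /occurs has_count size_filter|case: ps].
Qed.

Lemma mem_elim_vars (F : Type) v (ps : seq (seq nat * F)) x :
  (x \in elim_vars v ps) = has (fun p => x \in p.1) (sel v ps).
Proof.
rewrite mem_norm; elim: (sel v ps) => //= p qs IH.
by rewrite mem_cat IH.
Qed.

Section Typed.
Variable tau : signature.
Implicit Types (phi : fo tau) (psi : sharp tau) (B : structure tau).

Definition typed_ops (d : fo tau) : ops (atom tau nat) (fo tau) (sharp tau) :=
  @Ops (atom tau nat) (fo tau) (sharp tau) (@avars tau nat)
    (fun a => Atom (tagged a)) (@Ex tau) (@And tau) d
    (fun phi l => Cast phi [fset x in l]) (fun v => Proj [fset v])
    (fun l => Expand [fset x in l]) (@Times tau) (Const tau 0%R).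

Definition fo_small k phi := all (fun theta =>
  #|` fo_free theta| <= k) (fo_subformulas phi).

Lemma fold1_And_sat B d (l : seq (fo tau)) (h : {fmap var -> B}) : 0 < size l ->
  fo_sat (fold1 (@And tau) d l) h = all (fun phi => fo_sat phi h) l.
Proof.
case: l => // phi l _; rewrite /fold1 /=.
by elim: l phi => [|phi' l IH] phi /=; rewrite ?andbT // IH /= andbA.
Qed.

Lemma fold1_And_free d (l : seq (fo tau)) x : 0 < size l ->
  (x \in fo_free (fold1 (@And tau) d l)) = has (fun phi => x \in fo_free phi) l.
Proof.
case: l => // phi l _; rewrite /fold1 /=.
by elim: l phi => [|phi' l IH] phi /=; rewrite ?orbF // IH /= inE orbA.
Qed.

Lemma fold1_And_pp d (l : seq (fo tau)) : 0 < size l ->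
  is_pp (fold1 (@And tau) d l) = all (@is_pp tau) l.
Proof.
case: l => // phi l _; rewrite /fold1 /=.
by elim: l phi => [|phi' l IH] phi /=; rewrite ?andbT // IH /= andbA.
Qed.

(** The partial conjunctions are subformulas too and count for the width; their free variables stay
    within [U]. *)
Lemma fold1_And_small k d (l : seq (fo tau)) (U : {fset nat}) :
  0 < size l -> #|` U| <= k ->
  all (fo_small k) l -> all (fun phi => fo_free phi `<=` U) l ->
  fo_small k (fold1 (@And tau) d l).
Proof.
case: l => // phi l _ Uk; rewrite /fold1 /= => /andP[kphi kl] /andP[phiU lU].
elim: l phi kphi phiU kl lU => [|phi' l IH] phi kphi phiU //=.
move=> /andP[kphi' kl] /andP[phiU' lU].
have sub : fo_free (And phi phi') `<=` U by rewrite fsubUset phiU.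
apply: IH => //; rewrite /fo_small /= all_cat; apply/and3P; split=> //.
by apply: leq_trans Uk; apply: fsubset_leq_card.
Qed.

Lemma fo_small_leq k k' phi : k <= k' -> fo_small k phi -> fo_small k' phi.
Proof. by move=> kk'; apply: sub_all => theta /leq_trans; apply. Qed.

Definition fo_piece k (p : seq nat * fo tau) : bool :=
  [&& is_pp p.2, fo_free p.2 == [fset x in p.1] & fo_small k p.2].

Lemma elim_piece_fo d v (st : nat * seq (seq nat * fo tau)) :
  let st' := elim_piece (comb_ex (typed_ops d)) v st in
  0 < size st.2 -> all (fo_piece st.1) st.2 ->
  (0 < size st'.2) && all (fo_piece st'.1) st'.2.
Proof.
move=> st' st0 ok; rewrite [0 < _]/= andTb; set k := st'.1.
have {}ok : all (fo_piece k) st.2.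
  apply: sub_all ok => p /and3P[pp fr sm]; rewrite /fo_piece pp fr.
  by apply: fo_small_leq sm; rewrite leq_maxl.
move: ok; rewrite (sel_unsel_all _ v) => /andP[ok_sel ok_unsel].
rewrite /= ok_unsel andbT.
have sel0 := sel_neq0 v st0.
have sz0 : 0 < size (map snd (sel v st.2)) by rewrite size_map.
set Q := fold1 _ _ _.
have Uk : size (elim_vars v st.2) <= k by rewrite leq_maxr.
have frQ x : (x \in fo_free Q) = (x \in elim_vars v st.2).
  rewrite fold1_And_free // mem_elim_vars has_map.
  elim: (sel v st.2) ok_sel => //= p ps IH /andP[/and3P[_ /eqP -> _] /IH ->].
  by rewrite inE.
have smQ : fo_small k Q.
  apply: (@fold1_And_small _ _ _ [fset x in elim_vars v st.2]) => //.
  - by apply: leq_trans Uk; apply: card_fset_le => x; rewrite inE.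
  - by rewrite all_map; apply: sub_all ok_sel => p /and3P[].
  apply/(all_nthP d) => i; rewrite size_map => isz; apply/fsubsetP => x xi.
  rewrite inE mem_elim_vars; apply/(has_nthP ([::], d)); exists i => //.
  have /and3P[_ /eqP fr _] := all_nthP ([::], d) ok_sel i isz.
  by move: xi; rewrite (nth_map ([::], d)) // fr inE.
have frE : fo_free (Ex v Q) =i [seq u <- elim_vars v st.2 | u != v].
  by move=> x; rewrite /= !inE frQ [in RHS]mem_filter.
apply/and3P; split=> /=.
- by rewrite fold1_And_pp // all_map; apply: sub_all ok_sel => p /and3P[].
- by apply/eqP/fsetP => x; rewrite frE inE.
rewrite /fo_small /= -/(fo_small k Q) smQ andbT; apply: leq_trans Uk.
by apply: card_fset_le => x; rewrite frE => H; move: H; rewrite mem_filter => /andP[].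
Qed.

Lemma elim_pieces_fo d vs (st : nat * seq (seq nat * fo tau)) :
  let st' := elim_pieces (comb_ex (typed_ops d)) st vs in
  0 < size st.2 -> all (fo_piece st.1) st.2 ->
  (0 < size st'.2) && all (fo_piece st'.1) st'.2.
Proof.
elim: vs st => [|v vs IH] st /= st0 ok; first by rewrite st0.
by have /andP[st0' ok'] := elim_piece_fo d v st0 ok; apply: IH.
Qed.

Definition all_sat B (ps : seq (seq nat * fo tau)) (h : {fmap var -> B}) : bool :=
  all (fun p => fo_sat p.2 h) ps.

(** The head of the list is eliminated first and therefore becomes the innermost quantifier. *)
Fixpoint ex_over B (vs : seq nat) (Q : {fmap var -> B} -> bool) h : bool :=
  if vs is v :: vs' then ex_over vs' (fun h => [exists b : B, Q h.[v <- b]]) h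
  else Q h.

Fixpoint sum_over B (vs : seq nat) (Q : {fmap var -> B} -> int) h : int :=
  if vs is v :: vs' then sum_over vs' (fun h => \sum_(b : B) Q h.[v <- b])%R h
  else Q h.

Lemma eq_ex_over B vs (Q Q' : {fmap var -> B} -> bool) :
  Q =1 Q' -> ex_over vs Q =1 ex_over vs Q'.
Proof.
elim: vs Q Q' => //= v vs IH Q Q' QQ'; apply: IH => h.
by apply: eq_existsb => b.
Qed.

Lemma eq_sum_over B vs (Q Q' : {fmap var -> B} -> int) :
  Q =1 Q' -> sum_over vs Q =1 sum_over vs Q'.
Proof.
elim: vs Q Q' => //= v vs IH Q Q' QQ'; apply: IH => h.
by apply: eq_bigr => b.
Qed.

(** The quantifier moves past the pieces that avoid [v]. At least one piece is always selected, so
    over the empty structure the left side is false as well. *)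
Lemma elim_piece_sat B d v (st : nat * seq (seq nat * fo tau)) (h : {fmap var -> B}) :
  0 < size st.2 -> all (fo_piece st.1) st.2 ->
  all_sat (elim_piece (comb_ex (typed_ops d)) v st).2 h
  = [exists b : B, all_sat st.2 h.[v <- b]].
Proof.
move=> st0 ok; have sz0 : 0 < size (map snd (sel v st.2)).
  by rewrite size_map sel_neq0.
have unselE b : all_sat (unsel v st.2) h.[v <- b] = all_sat (unsel v st.2) h.
  move: ok (unsel_avoid v st.2); rewrite (sel_unsel_all _ v) => /andP[_].
  rewrite /all_sat; elim: (unsel v st.2) => //= p ps IH /andP[okp okps] /andP[vp vps].
  congr (_ && _); last exact: IH.
  apply: eq_fo_sat => x; case/and3P: okp => _ /eqP-> _; rewrite inE => xp.
  by rewrite fnd_set; case: eqP => // eq_x; rewrite -eq_x xp in vp.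
rewrite {1}/all_sat /= -/(all_sat _ _).
apply/andP/existsP => [[/existsP[b]]|[b]].
  rewrite fold1_And_sat // all_map => ok_sel ok_unsel; exists b.
  by rewrite /all_sat (sel_unsel_all _ v) -/(all_sat (unsel _ _) _) unselE ok_unsel andbT.
rewrite /all_sat (sel_unsel_all _ v) -/(all_sat (unsel _ _) _) unselE =>
  /andP[ok_sel ok_unsel].
by split=> //; apply/existsP; exists b; rewrite fold1_And_sat // all_map.
Qed.

Lemma elim_pieces_sat B d vs (st : nat * seq (seq nat * fo tau)) (h : {fmap var -> B}) :
  0 < size st.2 -> all (fo_piece st.1) st.2 ->
  all_sat (elim_pieces (comb_ex (typed_ops d)) st vs).2 h = ex_over vs (all_sat st.2) h.
Proof.
elim: vs st => //= v vs IH st st0 ok.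
have /andP[st0' ok'] := elim_piece_fo d v st0 ok.
by rewrite IH //; apply: eq_ex_over => h'; apply: elim_piece_sat.
Qed.

Definition sh_small k psi :=
  all (fun theta => #|` sh_free theta| <= k) (sharp_subformulas psi)
  && all (fun theta => #|` fo_free theta| <= k) (sharp_fo_subformulas psi).

Lemma sh_small_leq k k' psi : k <= k' -> sh_small k psi -> sh_small k' psi.
Proof.
move=> kk' /andP[ksh kfo]; apply/andP; split.
  by apply: sub_all ksh => theta /leq_trans; apply.
by apply: sub_all kfo => theta /leq_trans; apply.
Qed.

Lemma sh_small_width k psi : sh_small k psi -> width psi <= k.
Proof.
rewrite /width geq_max => /andP[ksh kfo]; apply/andP; split.
  by elim: (sharp_subformulas _) ksh => [|? ? IH] /=;
    rewrite ?big_nil // big_cons geq_max => /andP[-> /IH].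
by elim: (sharp_fo_subformulas _) kfo => [|? ? IH] /=;
  rewrite ?big_nil // big_cons geq_max => /andP[-> /IH].
Qed.

Definition factor k (U : {fset nat}) psi :=
  [&& is_sharp psi, all_casts_pp psi, sh_free psi == U & sh_small k psi].

(** Pairwise disjointness of the closed sets is phrased by counting occurrences, a condition that
    survives merging the first two factors. *)
Lemma factor_fold1 k d (l : seq (sharp tau)) (U : {fset nat}) :
  0 < size l -> #|` U| <= k -> all (factor k U) l ->
  (forall u, count (fun psi => u \in sh_closed psi) l <= 1) ->
  [/\ factor k U (fold1 (@Times tau) d l),
      forall u, (u \in sh_closed (fold1 (@Times tau) d l))
                = has (fun psi => u \in sh_closed psi) l
    & forall B (h : {fmap var -> B}),
        sh_eval (fold1 (@Times tau) d l) h = (\prod_(psi <- l) sh_eval psi h)%R].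
Proof.
case: l => // psi l _ Uk; rewrite /fold1 /=.
elim: l psi => [|psi' l IH] psi /=.
  move=> /andP[fac _] _; split=> // [u|B h]; first by rewrite orbF.
  by rewrite big_cons big_nil mulr1.
move=> /and3P[/and4P[sh pp /eqP fr sm] /and4P[sh' pp' /eqP fr' sm'] fac] cl.
have [|u|fac' cl' val] := IH (Times psi psi').
- rewrite fac andbT /factor /= sh sh' pp pp' fr fr' !eqxx /=; apply/andP; split.
    apply/fdisjointP => u upsi; have := cl u; rewrite upsi.
    by case: (u \in sh_closed psi').
  rewrite /sh_small /= fr Uk /= !all_cat.
  by move: sm sm' => /andP[-> ->] /andP[-> ->].
- have := cl u; rewrite inE.
  by case: (u \in sh_closed psi); case: (u \in sh_closed psi').
split=> // [u|B h]; first by rewrite cl' inE orbA.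
by rewrite val !big_cons /= mulrA.
Qed.

(** [done] lists the variables already projected. Closed variables lie inside it and free ones
    outside, which makes the later [Expand] and [Proj] syntactically legal. *)
Definition sh_piece k (done : seq nat) (p : seq nat * sharp tau) : bool :=
  [&& factor k [fset x in p.1] p.2, sh_closed p.2 `<=` [fset x in done]
    & all [predC done] p.1].

Definition sh_pieces k done (ps : seq (seq nat * sharp tau)) : Prop :=
  [/\ 0 < size ps, all (sh_piece k done) ps
    & forall u, count (fun p => u \in sh_closed p.2) ps <= 1].

Lemma sel_unsel_count (F : Type) (a : pred (seq nat * F)) v ps :
  count a ps = (count a (sel v ps) + count a (unsel v ps))%N.
Proof.
rewrite -!sum1_count !(big_mkcond a).
exact: (@sel_unsel nat 0 addn F (fun p => if a p then 1 else 0)).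
Qed.

Definition prod_eval B (ps : seq (seq nat * sharp tau)) (h : {fmap var -> B}) : int :=
  (\prod_(p <- ps) sh_eval p.2 h)%R.

Lemma sh_eval_Proj1 B v psi (h : {fmap var -> B}) : is_sharp psi ->
  sh_eval (Proj [fset v] psi) h = (\sum_(b : B) sh_eval psi h.[v <- b])%R.
Proof.
move=> sh /=; pose u : [fset v] := [` fset11 v].
rewrite (reindex (fun b : B => [ffun=> b] : {ffun [fset v] -> B})) /=; last first.
  exists (fun g => g u) => [b _|g _]; first by rewrite ffunE.
  apply/ffunP => w; rewrite ffunE; congr (g _); apply/val_inj.
  by have := valP w; rewrite inE => /eqP.
apply: eq_bigr => b _; apply: eq_sh_eval => // x xpsi.
rewrite fnd_restrict xpsi fnd_cat fnd_set /= inE; case: eqP => [->|//].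
by rewrite /fnd -[X in insub X]/(val u) valK /= ffunE.
Qed.

(** By distributivity the sum over [v] needs to enclose only the selected factors, the others being
    independent of [v]. Since [v] is new, projecting it cannot clash with a closed variable. *)
Lemma elim_piece_sh d v done (st : nat * seq (seq nat * sharp tau)) :
  let st' := elim_piece (comb_proj (typed_ops d)) v st in
  v \notin done -> sh_pieces st.1 done st.2 ->
  sh_pieces st'.1 (v :: done) st'.2 /\
  forall B (h : {fmap var -> B}),
    prod_eval st'.2 h = (\sum_(b : B) prod_eval st.2 h.[v <- b])%R.
Proof.
move=> st' vd [st0 ok cl]; set k := st'.1.
have {}ok : all (sh_piece k done) st.2.
  apply: sub_all ok => p /and3P[/and4P[sh pp fr sm] clp dp].
  by rewrite /sh_piece clp dp /factor sh pp fr /= andbT (sh_small_leq _ sm) // leq_maxl.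
set U := elim_vars v st.2; pose UF := [fset x in U].
have Uk : #|` UF| <= k.
  by apply: leq_trans (leq_maxr _ _); apply: card_fset_le => x; rewrite inE.
have sel0 := sel_neq0 v st0.
move: (ok); rewrite (sel_unsel_all _ v) => /andP[ok_sel ok_unsel].
have Ud x : x \in U -> x \notin done.
  rewrite mem_elim_vars; elim: (sel v st.2) ok_sel => //= p ps IH /andP[].
  by move=> /and3P[_ _ /allP dp] /IH{}IH /orP[/dp|/IH].
pose ex (p : seq nat * sharp tau) := Expand [fset x in [seq u <- U | u \notin p.1]] p.2.
have U_sel : all (fun p => all [in U] p.1) (sel v st.2).
  have : subpred (fun x => has (fun p => x \in p.1) (sel v st.2)) [in U].
    by move=> x xU; change (is_true (x \in U)); rewrite mem_elim_vars.
  elim: (sel v st.2) => //= p ps IH sub; apply/andP; split.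
    by apply/allP => x xp; apply: sub; rewrite xp.
  by apply: IH => x xps; apply: sub; rewrite xps orbT.
have [||||fac clQ valQ] := @factor_fold1 k (Const tau 0%R) [seq ex p | p <- sel v st.2]
  UF.
- by rewrite size_map.
- exact: Uk.
- rewrite all_map; move: ok_sel U_sel; elim: (sel v st.2) => //= p ps IH.
  move=> /andP[/and3P[/and4P[sh pp /eqP fr sm] clp dp] okps] /andP[pU psU].
  rewrite IH // andbT /factor /= sh pp fr /=.
  have eqU : [fset x in [seq u <- U | u \notin p.1]] `|` [fset x in p.1] = UF.
    apply/fsetP => x; rewrite !inE mem_filter; case: (boolP (x \in p.1)) => //=.
      by move/(allP pU) => /= ->.
    by rewrite orbF.
  rewrite eqU eqxx /=; apply/andP; split; last first.
    by rewrite /sh_small /= fr eqU Uk; case/andP: sm => -> ->.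
  apply/andP; split; apply/fdisjointP => x; rewrite inE mem_filter => /andP[xp xU].
    by rewrite inE.
  by apply: contra (Ud x xU) => /(fsubsetP clp); rewrite inE.
- move=> u; rewrite count_map; apply: leq_trans (cl u).
  by rewrite (sel_unsel_count _ v st.2) leq_addr.
have sh_ex : all (fun p => is_sharp p.2) (sel v st.2).
  by apply: sub_all ok_sel => p /and3P[/and4P[]].
have sel_closed : all (fun p => sh_closed p.2 `<=` [fset x in done]) st.2.
  by apply: sub_all ok => p /and3P[].
set Q := fold1 _ _ _ in fac clQ valQ.
have eqst : st'.2 = ([seq u <- U | u != v], Proj [fset v] Q) :: unsel v st.2 by [].
have clQd u : u \in sh_closed Q -> u \in done.
  rewrite clQ has_map; move: sel_closed; rewrite (sel_unsel_all _ v) => /andP[+ _].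
  elim: (sel v st.2) => //= p ps IH /andP[/fsubsetP sub /IH{}IH] /orP[/sub|/IH //].
  by rewrite inE.
have {fac}[shQ ppQ /eqP frQ smQ] := and4P fac.
split=> [|B h]; last first.
  rewrite eqst /prod_eval big_cons sh_eval_Proj1 //= big_distrl; apply: eq_bigr => b _.
  rewrite [RHS](sel_unsel _ _ v) /= valQ big_map; congr (_ * _)%R.
    move: sh_ex; elim: (sel v st.2) => [|p ps IH] /=; first by rewrite !big_nil.
    move=> /andP[shp /IH{}IH]; rewrite !big_cons IH; congr (_ * _)%R.
    by apply: eq_sh_eval => // x xp; rewrite fnd_restrict xp.
  move: (ok_unsel) (unsel_avoid v st.2); elim: (unsel v st.2) => [|p ps IH] /=.
    by rewrite !big_nil.
  move=> /andP[/and3P[/and4P[shp _ /eqP frp _] _ _] okps] /andP[vp vps].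
  rewrite !big_cons IH //; congr (_ * _)%R; apply: eq_sh_eval => // x.
  by rewrite frp inE fnd_set => xp; case: eqP => // eq_x; rewrite -eq_x xp in vp.
rewrite eqst; split=> //= [|u].
  apply/andP; split; last first.
    move: ok_unsel (unsel_avoid v st.2); elim: (unsel v st.2) => //= p ps IH.
    move=> /andP[/and3P[fac clp dp] okps] /andP[vp vps]; rewrite IH // andbT.
    apply/and3P; split=> //.
      apply/fsubsetP => x /(fsubsetP clp); rewrite !inE => ->; exact: orbT.
    apply/allP => x xp; rewrite /= inE negb_or; apply/andP; split.
      by apply: contraNneq vp => <-.
    exact: (allP dp).
  apply/and3P; split=> /=.
  - rewrite /factor /= shQ ppQ /=; apply/and3P; split.
    + by rewrite fdisjoint1X; apply: contra vd; apply: clQd.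
    + rewrite frQ; apply/eqP/fsetP => x; rewrite !inE [in RHS]mem_filter.
      by rewrite andbC.
    rewrite /sh_small /= frQ; case/andP: smQ => -> ->; rewrite !andbT.
    by apply: leq_trans Uk; apply: fsubset_leq_card; apply: fsubsetDl.
  - apply/fsubsetP => x; rewrite !inE => /orP[->//|/clQd ->]; exact: orbT.
  apply/allP => x; rewrite mem_filter => /andP[xv xU] /=.
  by rewrite inE negb_or xv Ud.
rewrite inE clQ has_map.
have := cl u; rewrite (sel_unsel_count _ v st.2) has_count.
(* The union of the selected closed sets counts once what was counted at most once before. The new
   closed variable [v] occurs in no remaining piece, as it was not in [done]. *)
have [->|uv] := eqVneq u v; last first.
  rewrite inE (negPf uv) /= => le1; apply: leq_trans le1; rewrite leq_add2r.
  by case: (count _ (sel v st.2)).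
suff -> : count (fun p => v \in sh_closed p.2) (unsel v st.2) = 0.
  by rewrite addn0 inE eqxx.
apply/eqP; rewrite -leqn0 leqNgt -has_count -all_predC.
move: sel_closed; rewrite (sel_unsel_all _ v) => /andP[_].
apply: sub_all => p /fsubsetP sub /=; apply: contra vd => /sub.
by rewrite inE.
Qed.

End Typed.

Lemma occurs_elim_piece (F : Type) comb v (st : nat * seq (seq nat * F)) x :
  occurs x (elim_piece comb v st).2 -> x != v /\ occurs x st.2.
Proof.
rewrite /occurs /= mem_filter mem_elim_vars; have := unsel_avoid v st.2.
rewrite -!big_has [in X in _ -> _ -> _ /\ X](sel_unsel _ _ v) !big_has => avoid.
case/orP=> [/andP[-> ->] //|xu]; split; last by rewrite /= xu orbT.
apply: contraTneq xu => ->; rewrite -all_predC.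
by apply: sub_all avoid.
Qed.

Lemma occurs_elim_pieces (F : Type) comb vs (st : nat * seq (seq nat * F)) x :
  occurs x (elim_pieces comb st vs).2 -> x \notin vs /\ occurs x st.2.
Proof.
elim: vs st => //= v vs IH st /IH[xvs /occurs_elim_piece[xv ->]].
by rewrite inE negb_or xv.
Qed.

Section Build.
Variable tau : signature.
Implicit Types (B : structure tau) (ats : seq (atom tau nat)).

Definition atoms_sat B ats (h : {fmap var -> B}) : bool :=
  all (fun a : atom tau nat => fo_sat (Atom (tagged a)) h) ats.

Lemma pieces0_fo (d : fo tau) ats :
  all (fo_piece (width0 (pieces0 (typed_ops d) ats))) (pieces0 (typed_ops d) ats).
Proof.
set ps := pieces0 _ _; have : all (fun p => size p.1 <= width0 ps) ps.
  rewrite /width0; elim: ps 0 => //= p ps IH w.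
  have mono w' : w' <= foldl (fun w p => maxn w (size p.1)) w' ps.
    by elim: (ps) w' => //= q qs IHq w'; apply: leq_trans (IHq _); apply: leq_maxl.
  by rewrite IH andbT; apply: leq_trans (mono _); apply: leq_maxr.
move: (width0 ps) => w; rewrite /ps /pieces0 !all_map.
apply: sub_all => a /= sz.
have fr : [fset x in val (tagged a)] = [fset x in norm (avars a)].
  by apply/fsetP => x; rewrite !inE mem_norm.
rewrite /fo_piece /= fr eqxx /fo_small /= andbT fr; apply: leq_trans sz.
by apply: card_fset_le => x; rewrite inE.
Qed.

Lemma cast_pieces_sh (d : fo tau) st : 0 < size st.2 -> all (fo_piece st.1) st.2 ->
  sh_pieces st.1 [::] (cast_pieces (typed_ops d) st).2 /\
  forall B (h : {fmap var -> B}),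
    prod_eval (cast_pieces (typed_ops d) st).2 h = ((all_sat st.2 h : nat)%:Z)%R.
Proof.
move=> st0 ok; split; last first.
  move=> B h; rewrite /prod_eval /= big_map /all_sat.
  elim: (st.2) => [|p ps IH]; first by rewrite big_nil.
  by rewrite big_cons IH /= -PoszM mulnb.
split; rewrite /= ?size_map //.
  rewrite all_map; apply: sub_all ok => p /and3P[pp /eqP fr sm].
  rewrite /sh_piece /factor /= -fr fsubset_refl pp eqxx fsub0set /=; apply/andP; split.
    rewrite /sh_small /= -/(fo_small st.1 p.2) sm !andbT.
    by move: sm; rewrite /fo_small; case: (p.2) => [? ?|?|? ?|? ?|? ?|? ?] /= /andP[].
  by apply/allP.
move=> u; rewrite count_map (eq_count (a2 := pred0)) ?count_pred0 //.
Qed.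

Lemma elim_pieces_sh (d : fo tau) vs done (st : nat * seq (seq nat * sharp tau)) :
  let st' := elim_pieces (comb_proj (typed_ops d)) st vs in
  uniq vs -> all [predC done] vs -> sh_pieces st.1 done st.2 ->
  (exists done', sh_pieces st'.1 done' st'.2) /\
  forall B (h : {fmap var -> B}), prod_eval st'.2 h = sum_over vs (prod_eval st.2) h.
Proof.
elim: vs done st => [|v vs IH] done st /=; first by move=> _ _ ok; split=> //;
  exists done.
move=> /andP[vvs uvs] /andP[vd vsd] ok.
have [ok' val] := elim_piece_sh d vd ok.
have [|ok'' val'] := IH (v :: done) _ uvs _ ok'.
  apply/allP => u uvs'; rewrite /= inE negb_or; apply/andP; split.
    by apply: contraNneq vvs => <-.
  exact: (allP vsd).
by split=> // B h; rewrite val'; apply: eq_sum_over => h'; rewrite val.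
Qed.

Lemma build_correct (d : fo tau) ats ox os :
  let r := build (typed_ops d) ats ox os in
  0 < size ats -> uniq os -> all (fun a => all [in ox ++ os] (avars a)) ats ->
  [/\ is_sharpPP r.2, sh_free r.2 = fset0, width r.2 <= r.1
    & forall B, sh_eval r.2 ([fmap] : {fmap var -> B})
      = sum_over os (fun h => (ex_over ox (@atoms_sat B ats) h : nat)%:Z%R) [fmap]].
Proof.
move=> r ats0 uos cov.
set st0 := (width0 (pieces0 (typed_ops d) ats), pieces0 (typed_ops d) ats).
have sz0 : 0 < size st0.2 by rewrite size_map.
have /andP[sz1 ok1] := elim_pieces_fo d ox sz0 (pieces0_fo d ats).
have [ok2 val2] := cast_pieces_sh d sz1 ok1.
have [|[done [sz3 ok3 cl3]] val3] := elim_pieces_sh d (vs := os) uos _ ok2;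
  first by apply/allP.
rewrite -/(phase1 (typed_ops d) ats ox) -/(phase2 (typed_ops d) ats ox os) in sz3 ok3
  cl3 val3.
set st3 := phase2 (typed_ops d) ats ox os in sz3 ok3 cl3 val3.
(* After both phases every variable of the atoms has been eliminated, so the remaining factors are
   sentences. *)
have nofree x : ~~ occurs x st3.2.
  apply/negP => /occurs_elim_pieces[xos]; rewrite /occurs /= has_map.
  move=> /(@occurs_elim_pieces _ _ _ st0)[xox]; rewrite /occurs has_map.
  move=> /hasP[a aats] /=; rewrite mem_norm => xa.
  by have := allP (allP cov a aats) x xa; rewrite /= mem_cat (negPf xox) (negPf xos).
have fac : all (factor st3.1 fset0) (map snd st3.2).
  have {}nofree : all (fun p => p.1 == [::]) st3.2.
    elim: (st3.2) nofree => //= p ps IH nf; rewrite IH => [|x]; last first.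
      by apply: contra (nf x); rewrite /occurs /= => ->; rewrite orbT.
    rewrite andbT; case E : p.1 => [//|x e]; case/negP: (nf x).
    by rewrite /occurs /= E mem_head.
  rewrite all_map; elim: (st3.2) ok3 nofree => //= p ps IH.
  move=> /andP[/and3P[fac _ _] okps] /andP[/eqP p0 ps0]; rewrite IH // andbT.
  by move: fac; rewrite p0 (_ : [fset x in [::]] = fset0) //; apply/fsetP => x;
    rewrite !inE.
have [||u|/and4P[sh pp /eqP fr sm] _ val4] := @factor_fold1 _ _ (Const tau 0%R) _ _ _ _
  fac _.
- by rewrite size_map.
- by rewrite cardfs0.
- by rewrite count_map; apply: cl3.
have -> : r = (st3.1, fold1 (@Times tau) (Const tau 0%R) (map snd st3.2)) by [].
split=> /=; rewrite ?/is_sharpPP ?sh ?pp ?fr //; first exact: sh_small_width.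
move=> B; rewrite val4 big_map; apply: etrans (val3 B [fmap]) _.
apply: eq_sum_over => h; rewrite val2 elim_pieces_sat ?pieces0_fo //.
congr ((nat_of_bool _)%:Z)%R; apply: eq_ex_over => h'.
by rewrite /all_sat /= all_map.
Qed.

End Build.

(** * Counting answers *)

Section Over.
Variables (tau : signature) (B : structure tau) (b0 : B).
Implicit Types (h : {fmap var -> B}) (vs : seq nat).

Definition over h vs (e : nat -> B) : {fmap var -> B} :=
  h + [fmap x : [fset x in vs] => e (val x)].

Lemma fnd_over h vs e x :
  (over h vs e).[? x] = if x \in vs then Some (e x) else h.[? x].
Proof.
rewrite fnd_cat /= inE; case: ifP => // xvs.
have xV : x \in [fset x in vs] by rewrite inE.
by rewrite (in_fnd (f := [fmap x : [fset x in vs] => e (val x)]) xV) ffunE.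
Qed.

Lemma ex_overP vs (Q : {fmap var -> B} -> bool) h :
  reflect (exists e, Q (over h vs e)) (ex_over vs Q h).
Proof.
elim: vs Q => [|v vs IH] Q /=.
  apply: (iffP idP) => [qh|[e]]; last by congr Q; apply/fmapP => x; rewrite fnd_over.
  by exists (fun=> b0); rewrite (_ : over _ _ _ = h) //; apply/fmapP => x;
    rewrite fnd_over.
apply: (iffP (IH _)) => [[e /existsP[b qb]]|[e qe]].
  exists (upd e v b); rewrite (_ : over _ _ _ = (over h vs e).[v <- b]) //.
  by apply/fmapP => x; rewrite fnd_set !fnd_over inE /upd; case: (x == v).
exists e; apply/existsP; exists (e v).
rewrite (_ : _.[v <- _] = over h (v :: vs) e) //.
by apply/fmapP => x; rewrite fnd_set !fnd_over inE; case: eqP => //= ->.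
Qed.

Lemma big_tuple_cons n (G : n.+1.-tuple B -> int) :
  (\sum_t G t = \sum_(t : n.-tuple B) \sum_(b : B) G [tuple of b :: t])%R.
Proof.
rewrite pair_big /= (reindex (fun p : n.-tuple B * B => [tuple of p.2 :: p.1])) //=.
exists (fun t : n.+1.-tuple B => ([tuple of behead t], thead t)) => [[t b] _|t _] /=.
  by congr (_, _); apply: val_inj.
by rewrite -tuple_eta.
Qed.

Definition assign vs (t : seq B) (v : nat) : B := nth b0 t (index v vs).

Lemma sum_overE vs (Q : {fmap var -> B} -> int) h : uniq vs ->
  sum_over vs Q h
  = (\sum_(t : (size vs).-tuple B) Q (over h vs (assign vs t)))%R.
Proof.
elim: vs Q h => [|v vs IH] Q h /=.
  move=> _; rewrite (bigD1 [tuple]) //= big1 ?addr0 => [|t /negP[]].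
    by congr Q; apply/fmapP => x; rewrite fnd_over.
  by apply/eqP; rewrite (tuple0 t).
move=> /andP[vvs uvs]; rewrite IH // big_tuple_cons.
apply: eq_bigr => t _; apply: eq_bigr => b _; congr Q.
apply/fmapP => x; rewrite fnd_set !fnd_over inE eq_sym /assign /=.
by case: eqP.
Qed.

Lemma atoms_sat_over (ats : seq (atom tau nat)) ox os (e1 e2 : nat -> B) :
  all (fun a => all [in ox ++ os] (avars a)) ats ->
  atoms_sat ats (over (over [fmap] os e1) ox e2)
  = all (holds (fun v => if v \in ox then e2 v else e1 v)) ats.
Proof.
move=> /allP cov; apply: eq_in_all => a /cov/allP aV.
rewrite (@fo_sat_Atom _ _ _ _ _ (fun v => if v \in ox then e2 v else e1 v)).
  by case: a {aV}.
by move=> x /aV /=; rewrite mem_cat !fnd_over; case: (x \in ox) => //= ->.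
Qed.

End Over.

Section Answers.
Variables (tau : signature) (B : structure tau) (S : {fset var}).
Variables (ats : seq (atom tau nat)) (os ox : seq nat) (h : nat -> nat).
Variable answer : pred {ffun S -> B}.
Hypothesis uos : uniq os.
Hypothesis osS : forall v, (v \in os) = ~~ odd v && (v./2 \in S).
Hypothesis ox_odd : all odd ox.
Hypothesis cov : all (fun a => all [in ox ++ os] (avars a)) (map (amap h) ats).
Hypothesis h_ats : all (fun a => amap h a \in ats) ats.
Hypothesis h_os : {in os, forall v, exists2 u, u \in os & h u = v}.
Hypothesis answerP : forall f : {ffun S -> B}, reflect (solves ats f) (answer f).

(** Replacing the atoms by their images under [h] may change the set of solutions but not its size:
    there are injections in both directions, and the sets are finite. *)
Lemma sum_over_answers (b0 : B) :
  sum_over os (fun g => (ex_over ox (@atoms_sat tau B (map (amap h) ats)) g :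
    nat)%:Z%R) [fmap]
  = (#|answer|%:Z)%R.
Proof.
have hos v : v \in os -> h v \in os.
  (* A list of the same length that covers the duplicate-free list [os] has exactly its elements, so
     [h] permutes [os]. *)
  have [_ eq_os] : (size os = size (map h os)) * (os =i map h os).
    apply: uniq_min_size; rewrite ?size_map // => w /h_os[u uos' <-].
    exact: map_f.
  by move=> vos; rewrite eq_os map_f.
have Sos (s : S) : (val s).*2 \in os by rewrite osS odd_double doubleK (valP s).
pose T : pred ((size os).-tuple B) := fun t =>
  ex_over ox (@atoms_sat tau B (map (amap h) ats))
  (over [fmap] os (assign b0 os t)).
rewrite (sum_overE b0) // (eq_bigr (fun t => ((T t : nat)%:R : int)%R)) => [|t _];
  last first.
  by rewrite natz.
rewrite -natr_sum natz; congr (_%:Z)%R.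
have -> : (\sum_t T t)%N = #|T|.
  by rewrite -sum1_card [RHS]big_mkcond; apply: eq_bigr.
have TP (t : (size os).-tuple B) : reflect (exists2 e : nat ->
  B, all (holds e) (map (amap h) ats)
    & {in os, forall v, e v = assign b0 os t v}) (t \in T).
  apply: (iffP (ex_overP b0 _ _ _)) => [[e]|[e ok et]].
    rewrite atoms_sat_over // => ok; eexists; first exact: ok.
    move=> v; rewrite osS => /andP[ev _] /=; case: ifP => // /(allP ox_odd).
    by rewrite (negPf ev).
  exists e; rewrite atoms_sat_over //.
  rewrite (@eq_in_all _ _ (holds e)) // => a aats; apply: eq_in_holds => v va.
  have := allP (allP cov a aats) v va; rewrite /= mem_cat.
  by case: (v \in ox) => //= /et.
apply/eqP; rewrite eqn_leq; apply/andP; split.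
  pose F (t : (size os).-tuple B) : {ffun S ->
    B} := [ffun s => assign b0 os t (h (val s).*2)].
  have F_inj : injective F.
    move=> t t' /ffunP eq_F; apply: val_inj.
    apply: (@eq_from_nth _ b0) => [|i]; rewrite ?size_tuple // => ilt.
    have [u uos' eq_u] := h_os (mem_nth 0 ilt).
    have uS : u./2 \in S by move: uos'; rewrite osS => /andP[].
    have := eq_F [` uS]; rewrite !ffunE /= even_halfK; last first.
      by move: uos'; rewrite osS => /andP[].
    by rewrite eq_u /assign index_uniq.
  rewrite -(card_image F_inj); apply: subset_leq_card.
  apply/subsetP => f /imageP[t /TP[e ok et] ->].
  (* A solution of the image atoms, composed with [h], solves the original ones. *)
  apply/answerP; exists (e \o h).
    by move: ok; rewrite all_map; apply: sub_all => a; rewrite /= holds_amap.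
  by move=> s; rewrite ffunE /= et ?hos ?Sos.
pose ext (f : {ffun S -> B}) v := if insub v is Some s then f s else b0.
pose F (f : {ffun S -> B}) : (size os).-tuple B := map_tuple (fun v =>
  ext f v./2) (in_tuple os).
have assignF f v : v \in os -> assign b0 os (F f) v = ext f v./2.
  by move=> vos; rewrite /assign (nth_map 0) ?index_mem // nth_index.
have extS f (s : S) : ext f (val s) = f s by rewrite /ext valK.
have F_inj : injective F.
  move=> f f' eq_F; apply/ffunP => s.
  by rewrite -!extS -[val s]doubleK -!assignF // eq_F.
rewrite -(card_image F_inj); apply: subset_leq_card.
apply/subsetP => t /imageP[f /answerP[e ok ef] ->].
(* Conversely the image atoms are among the original ones, so the same [e] solves them. *)
apply/TP; exists e.
  by rewrite all_map; apply/allP => a /(allP h_ats)/(allP ok).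
move=> v vos; rewrite assignF //; move: vos; rewrite osS => /andP[ev vS].
by rewrite -[v in LHS]even_halfK // -[v./2]/(val [` vS]) ef extS.
Qed.

End Answers.

(** * Prenex formulas with quantified and liberal variables renamed apart *)

Fixpoint bound_vars tau (phi : fo tau) : seq var :=
  if phi is Ex x phi' then x :: bound_vars phi' else [::].

Fixpoint pp_atoms tau (phi : fo tau) : seq (atom tau nat) :=
  match phi with
  | Atom R vs => [:: existT _ R vs]
  | And phi phi' => pp_atoms phi ++ pp_atoms phi'
  | Ex _ phi => pp_atoms phi
  | _ => [::]
  end.

(** A variable may be both quantified in the formula and a member of [S]. The atoms then see the odd
    copy, and the even copy remains as an unconstrained liberal variable. *)
Definition rename_apart (bs : seq var) (v : nat) : nat :=
  if v \in bs then v.*2.+1 else v.*2.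

Definition apart_atoms tau (phi : fo tau) : seq (atom tau nat) :=
  map (amap (rename_apart (bound_vars phi))) (pp_atoms phi).

Section Prenex.
Variable tau : signature.
Implicit Types (phi : fo tau) (B : structure tau).

Lemma conj_free phi : is_conjunction_of_atoms phi ->
  forall x, (x \in fo_free phi) = has (fun a => x \in avars a) (pp_atoms phi).
Proof.
elim: phi => //= [R vs _ x|phi IH phi' IH' /andP[c c'] x].
  by rewrite inE orbF.
by rewrite inE IH // IH' // has_cat.
Qed.

Lemma conj_sat B phi (h : {fmap var -> B}) : is_conjunction_of_atoms phi ->
  fo_sat phi h = atoms_sat (pp_atoms phi) h.
Proof.
rewrite /atoms_sat; elim: phi => //= [R vs _|phi IH phi' IH' /andP[c c']].
  by rewrite andbT.
by rewrite IH // IH' // all_cat.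
Qed.

Lemma prenex_ind (Q : fo tau -> Prop) :
  (forall phi, is_conjunction_of_atoms phi -> bound_vars phi = [::] -> Q phi) ->
  (forall x phi, is_prenex_pp phi -> Q phi -> Q (Ex x phi)) ->
  forall phi, is_prenex_pp phi -> Q phi.
Proof.
move=> Qc Qe; elim=> //= [R vs|phi _ phi' _|x phi IH] pp; try exact: Qc.
by apply: Qe => //; apply: IH.
Qed.

Lemma prenex_free phi : is_prenex_pp phi -> forall x,
  (x \in fo_free phi) = has (fun a =>
    x \in avars a) (pp_atoms phi) && (x \notin bound_vars phi).
Proof.
move: phi; apply: prenex_ind => [phi c -> x|y phi pp IH x];
  first by rewrite conj_free // andbT.
by rewrite /= !inE IH negb_or; case: (x == y); rewrite ?andbF.
Qed.

Lemma prenex_atoms_neq0 phi : is_prenex_pp phi -> 0 < size (pp_atoms phi).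
Proof.
move: phi; apply: prenex_ind => //= phi + _; elim: phi => //= phi IH phi' _ /andP[c _].
by rewrite size_cat; apply: leq_trans (IH c) (leq_addr _ _).
Qed.

(** Since all quantifiers stand in one existential block, a single environment witnesses them
    together, even when a variable is quantified repeatedly. *)
Lemma prenex_satP B (b0 : B) phi (h : {fmap var -> B}) : is_prenex_pp phi ->
  (forall x, x \in fo_free phi -> h.[? x] <> None) ->
  fo_sat phi h <-> (exists2 e : nat -> B, all (holds e) (pp_atoms phi) &
                     {in fo_free phi, forall x, h.[? x] = Some (e x)}).
Proof.
move=> pp; move: phi pp h.
have atomE (a : atom tau nat) (g : {fmap var -> B}) (e : nat -> B) :
    {in avars a, forall x, g.[? x] = Some (e x)} ->
      fo_sat (Atom (tagged a)) g = holds e a.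
  by move=> ga; rewrite (@fo_sat_Atom _ _ _ _ _ e) //; case: a ga.
apply: prenex_ind => [phi c _ h def|x phi pp IH h def].
  pose e x := odflt b0 h.[? x].
  have he x : x \in fo_free phi -> h.[? x] = Some (e x).
    by move=> /def; rewrite /e; case: (h.[? x]).
  have satE e' : {in fo_free phi, forall x, h.[? x] = Some (e' x)} ->
      fo_sat phi h = all (holds e') (pp_atoms phi).
    move=> he'; rewrite conj_sat //; apply: eq_in_all => a aP; apply: atomE => x xa.
    by apply: he'; rewrite conj_free //; apply/hasP; exists a.
  split=> [sat|[e' ok he']]; last by rewrite (satE e').
  by exists e => //; rewrite -(satE e).
split=> [/existsP[b /IH[y yphi|e ok he]]|[e ok he]].
- by rewrite fnd_set; case: eqP => // /eqP yx; apply: def; rewrite !inE yx.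
- exists e => // y; rewrite !inE => /andP[yx yphi].
  by have := he y yphi; rewrite fnd_set (negPf yx).
apply/existsP; exists (e x); apply/IH => [y yphi|].
  by rewrite fnd_set; case: eqP => // /eqP yx; apply: def; rewrite !inE yx.
exists e => // y yphi; rewrite fnd_set; case: eqP => [->//|/eqP yx].
by apply: he; rewrite !inE yx.
Qed.

Lemma prenex_sat_empty B phi (h : {fmap var -> B}) : (B -> False) -> is_prenex_pp phi ->
  fo_sat phi h = (bound_vars phi == [::]) && atoms_sat (pp_atoms phi) h.
Proof.
move=> noB; case: phi => //= [R vs _|phi phi' c|x phi _].
- by rewrite /atoms_sat /= andbT.
- by rewrite -(@conj_sat _ (And phi phi')).
by apply/existsP => -[b]; case: (noB b).
Qed.

Lemma apart_solves B (b0 : B) phi (S : {fset var}) (f : {ffun S -> B}) :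
  is_prenex_pp phi -> fo_free phi `<=` S ->
  reflect (solves (apart_atoms phi) f) (f \in answers B phi S).
Proof.
move=> pp /fsubsetP phiS; rewrite inE.
have fE x (xS : x \in S) : (FinMap f).[? x] = Some (f [` xS]).
  by rewrite /fnd -[X in insub X]/(val [` xS]) valK.
have def x : x \in fo_free phi -> (FinMap f).[? x] <> None by move=> /phiS xS; rewrite fE.
apply: (iffP idP) => [/(prenex_satP b0 pp def)[e ok he]|[e ok he]].
  pose e' u := if odd u then e u./2 else if insub u./2 is Some s then f s else e u./2.
  exists e' => [|s]; last by rewrite /e' odd_double doubleK valK.
  rewrite all_map; apply/allP => a aP; have := allP ok a aP; apply: etrans.
  rewrite /= holds_amap; apply: eq_in_holds => x xa; rewrite /e' /= /rename_apart.
  case: (boolP (x \in bound_vars phi)) => xb;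
    first by rewrite /= odd_double /= uphalf_double.
  rewrite odd_double doubleK.
  have xphi : x \in fo_free phi by rewrite prenex_free // xb andbT; apply/hasP; exists a.
  have xS := phiS x xphi; have := he x xphi.
  by rewrite fE -[X in insub X]/(val [` xS]) valK => -[].
apply/(prenex_satP b0 pp def); exists (e \o rename_apart (bound_vars phi)).
  by move: ok; rewrite all_map; apply: sub_all => a; rewrite /= holds_amap.
move=> x xphi; have xS := phiS x xphi; rewrite fE -he /= /rename_apart.
by move: xphi; rewrite prenex_free // => /andP[_ /negPf ->].
Qed.

Section Representation.
Variables (phi : fo tau) (S : {fset var}) (os ox : seq nat) (h : nat -> nat).
Hypothesis pp : is_prenex_pp phi.
Hypothesis phiS : fo_free phi `<=` S.
Hypothesis uos : uniq os.
Hypothesis osS : forall v, (v \in os) = ~~ odd v && (v./2 \in S).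
Hypothesis oxE : forall v, (v \in ox) = odd v && (v./2 \in bound_vars phi).
Hypothesis h_ats : all (fun a => amap h a \in apart_atoms phi) (apart_atoms phi).
Hypothesis h_os : {in os, forall v, exists2 u, u \in os & h u = v}.

Lemma apart_atoms_vars a : a \in apart_atoms phi -> all [in ox ++ os] (avars a).
Proof.
move=> /mapP[b bP ->]; apply/allP => v; rewrite avars_amap => /mapP[x xb ->].
rewrite /= mem_cat oxE osS /rename_apart; case: ifPn => xbd.
  by rewrite /= odd_double /= uphalf_double xbd.
rewrite odd_double doubleK /=; apply: (fsubsetP phiS).
by rewrite prenex_free // xbd andbT; apply/hasP; exists b.
Qed.

Let cov : all (fun a => all [in ox ++ os] (avars a)) (map (amap h) (apart_atoms phi)).
Proof. by rewrite all_map; apply/allP => a /(allP h_ats)/apart_atoms_vars. Qed.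

Lemma sum_over_empty B (Q : {fmap var -> B} -> int) g vs : (B -> False) ->
  sum_over vs Q g = if vs is [::] then Q g else 0%R.
Proof.
move=> noB; case: vs => //= v vs.
have -> : sum_over vs (fun h =>
  \sum_(b : B) Q h.[v <- b])%R g = sum_over vs (fun=> 0%R) g.
  by apply: eq_sum_over => g'; apply: big1 => b; case: (noB b).
by elim: vs => //= w vs IH; rewrite -[RHS]IH; apply: eq_sum_over => g'; apply: big1.
Qed.

Lemma ex_over_empty B (Q : {fmap var -> B} -> bool) g vs : (B -> False) ->
  ex_over vs Q g = (vs == [::]) && Q g.
Proof.
move=> noB; case: vs => //= v vs.
have -> : ex_over vs (fun h => [exists b : B, Q h.[v <- b]]) g = ex_over vs xpred0 g.
  by apply: eq_ex_over => g'; apply/existsP => -[b]; case: (noB b).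
elim: vs => //= w vs IH; rewrite -[RHS]IH; apply: eq_ex_over => g'.
by apply/existsP => -[].
Qed.

Lemma representation d :
  sharpPP_representation (build (typed_ops d) (map (amap h) (apart_atoms phi)) ox os).2
    phi S.
Proof.
have [||shpp fr _ val] := @build_correct tau d (map (amap h) (apart_atoms phi)) ox os _
  uos.
- by rewrite !size_map prenex_atoms_neq0.
- exact: cov.
split=> //; case/andP: (shpp) => sh _; split=> // B; rewrite val.
have ox_odd : all odd ox by apply/allP => v; rewrite oxE => /andP[].
case: (pickP (@predT B)) => [b0 _|noB].
  rewrite (@sum_over_answers _ _ S _ os ox h (fun f => f \in answers B phi S)) //.
  by move=> f; apply: apart_solves.
have {}noB (b : B) : False by have := noB b.
(* Over the empty structure a liberal variable makes both counts zero. Without one there is a single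
   assignment, and only its truth value has to be compared. *)
rewrite sum_over_empty //; case Eos : os => [|v os']; last first.
  have /andP[_ vS] : ~~ odd v && (v./2 \in S) by rewrite -osS Eos mem_head.
  by rewrite eq_card0 // => f; case: (noB (f [` vS])).
have S0 s : s \in S -> False.
  by move=> sS; have := osS s.*2; rewrite Eos odd_double doubleK sS.
rewrite ex_over_empty //.
pose f0 : {ffun S -> B} := [ffun s => False_rect B (S0 _ (valP s))].
have -> : #|answers B phi S| = fo_sat phi (FinMap f0).
  have f0E (f : {ffun S -> B}) : f = f0 by apply/ffunP => s; case: (S0 _ (valP s)).
  case: (boolP (fo_sat phi (FinMap f0))) => sat.
    by apply/eqP/cards1P; exists f0; apply/setP => f; rewrite !inE (f0E f) eqxx sat.
  by apply: eq_card0 => f; rewrite inE (f0E f) (negPf sat).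
rewrite prenex_sat_empty //; congr ((nat_of_bool _)%:Z)%R.
(* Any quantifier is false here, so [ox] must be empty exactly when the formula has no quantifier.
   This is why it lists also the bound variables that occur in no atom. *)
have -> : (ox == [::]) = (bound_vars phi == [::]).
  apply/eqP/eqP => E0.
    case Eb : (bound_vars phi) => [//|b bs]; have := oxE b.*2.+1.
    by rewrite E0 /= odd_double /= uphalf_double Eb mem_head.
  case Ex : ox => [//|x xs]; have := oxE x.
  by rewrite Ex mem_head E0 andbF.
case: (boolP (bound_vars phi == [::])) => //= /eqP bs0.
have ox0 : ox = [::].
  by case Ex : ox => [//|x xs]; have := oxE x; rewrite Ex mem_head bs0 andbF.
have no_vars a : a \in pp_atoms phi -> avars a = [::].
  move=> aP; have := apart_atoms_vars (map_f _ aP).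
  by rewrite avars_amap ox0 Eos; case: (avars a).
have E0 g a : a \in pp_atoms phi -> amap g a = a.
  move=> /no_vars a0; case: a a0 => R vs a0; rewrite /amap /=; congr existT;
    apply: val_inj => /=.
  by rewrite -[tval vs]/(avars (existT _ R vs : atom tau nat)) a0.
have -> : map (amap h) (apart_atoms phi) = pp_atoms phi.
  rewrite /apart_atoms -map_comp -[RHS]map_id; apply/eq_in_map => a aP /=.
  by rewrite (E0 _ a) // E0.
apply: eq_in_all => a /no_vars a0; apply: eq_fo_sat => x /=; rewrite inE => xa.
by have : x \in avars a by []; rewrite a0.
Qed.

End Representation.
End Prenex.

(** * Computability of the search *)

Notation raw_atom := (nat * seq nat)%type.

Definition code_ops (d : nat) : ops raw_atom nat nat :=
  @Ops raw_atom nat nat snd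
    (fun a => npair 0 (npair a.1 (CodeSeq.code a.2)))
    (fun v p => npair 4 (npair v p))
    (fun p q => npair 2 (npair p q))
    d
    (fun p l => npair 0 (npair p (CodeSeq.code (norm l))))
    (fun v p => npair 1 (npair (CodeSeq.code [:: v]) p))
    (fun l p => npair 2 (npair (CodeSeq.code (norm l)) p))
    (fun p q => npair 3 (npair p q))
    (npair 5 (npair 0 0)).

(* A parser state consists of a stack of codes of formulas, the quantified
   variables and the atoms found so far. *)
Definition parse_step (st : seq nat * (seq nat * seq raw_atom)) :
    seq nat * (seq nat * seq raw_atom) :=
  match st.1 with
  | [::] => st
  | c :: stack =>
      if (unpair c).1 == 0 then
        (stack, (st.2.1, ((unpair (unpair c).2).1,
          CodeSeq.decode (unpair (unpair c).2).2) :: st.2.2))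
      else if (unpair c).1 == 2 then
        ((unpair (unpair c).2).1 :: (unpair (unpair c).2).2 :: stack, st.2)
      else ((unpair (unpair c).2).2 :: stack, ((unpair (unpair c).2).1 :: st.2.1, st.2.2))
  end.

(** The code of a formula bounds its parsing time, so [c.+1] rounds suffice. The quantified
    variables come out reversed, which is harmless because only membership is tested. *)
Definition parse_code (c : nat) : seq nat * seq raw_atom :=
  let st := (iter c.+1 parse_step ([:: c], ([::], [::]))).2 in (st.1, rev st.2).

Definition map_vars (f : nat -> nat) (a : raw_atom) : raw_atom := (a.1, map f a.2).

Definition raw_atoms (c : nat) : seq raw_atom :=
  map (map_vars (rename_apart (parse_code c).1)) (parse_code c).2.

Definition all_vars (x : nat * seq nat) : seq nat :=
  norm (map (fun b => b.*2.+1) (parse_code x.1).1 ++ map double x.2).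

(* The map sending the i-th element of [V] to the i-th element of [hl]. *)
Definition lookup (V hl : seq nat) (v : nat) : nat :=
  (foldl (fun st u => (behead st.1, if u == v then head 0 st.1 else st.2)) (hl, 0) V).2.

Fixpoint lists (n : nat) (V : seq nat) : seq (seq nat) :=
  if n is n'.+1 then flatten [seq [seq v :: l | l <- lists n' V] | v <- V] else [:: [::]].

Definition candidates (V : seq nat) : seq (seq nat * seq nat) :=
  flatten [seq [seq (hl, vs) | vs <- lists (size V) V] | hl <- lists (size V) V].

(** Argument lists are compared through their codes, which reduces the test to equality of
    numbers. *)
Definition eq_raw_atom (a b : raw_atom) : bool :=
  (a.1 == b.1) && (CodeSeq.code a.2 == CodeSeq.code b.2).

(** The first test says that the tabulated map is an endomorphism, the second that it covers the
    liberal variables. The third makes [k.2] a permutation of the variables, since candidates have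
    the right length. *)
Definition valid (x : nat * seq nat) (k : seq nat * seq nat) : bool :=
  [&& all (fun a => has (eq_raw_atom (map_vars (lookup (all_vars x) k.1) a)) (raw_atoms
    x.1))
        (raw_atoms x.1),
      all (fun v => odd v || has (fun u =>
        ~~ odd u && (lookup (all_vars x) k.1 u == v)) (all_vars x))
        (all_vars x)
    & all (fun v => v \in k.2) (all_vars x)].

Definition result (x : nat * seq nat) (k : seq nat * seq nat) : nat * nat :=
  build (code_ops x.1) (map (map_vars (lookup (all_vars x) k.1)) (raw_atoms x.1))
    (filter odd k.2) (filter (predC odd) k.2).

(** The search starts from the identity map with the variables in increasing order. This choice is
    itself valid, so a representation is at hand from the beginning. *)
Definition algorithm (x : nat * seq nat) : nat :=
  (foldl (fun r k => if valid x k && ((result x k).1 < r.1) then result x k else r)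
    (result x (all_vars x, all_vars x)) (candidates (all_vars x))).2.

Section Computability.

Lemma computable_norm (Z : encType) (l : Z -> seq nat) :
  computable l -> computable (fun z => norm (l z)).
Proof.
move=> hl; apply: computable_filter; first by
  apply: computable_mem; [repeat comp_base|apply: (computable_comp hl); repeat comp_base].
by apply: computable_iota0; apply: computable_succ; apply: computable_sumn.
Qed.

Lemma computable_occurs (Z F : encType) (v : Z -> nat) (ps : Z -> seq (seq nat * F)) :
  computable v -> computable ps ->
  computable (fun z => occurs (v z) (ps z)).
Proof.
move=> hv hps; apply: computable_has => //; apply: computable_mem; repeat comp_base.
by apply: (computable_comp hv); repeat comp_base.
Qed.

Lemma computable_sel (Z F : encType) (v : Z -> nat) (ps : Z -> seq (seq nat * F)) :
  computable v -> computable ps ->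
  computable (fun z => sel (v z) (ps z)).
Proof.
move=> hv hps; apply: computable_if; first exact: computable_occurs.
  apply: computable_filter => //; apply: computable_mem; repeat comp_base.
  by apply: (computable_comp hv); repeat comp_base.
apply: (@eq_computable _ _ (fun z => match ps z with [::] => [::] | p :: _ =>
  [:: p] end)).
  by move=> z; case: (ps z) => //= p s; rewrite take0.
by apply: computable_lmatch hps _ _; [|apply: computable_cons]; repeat comp_base.
Qed.

Lemma computable_unsel (Z F : encType) (v : Z -> nat) (ps : Z -> seq (seq nat * F)) :
  computable v -> computable ps ->
  computable (fun z => unsel (v z) (ps z)).
Proof.
move=> hv hps; apply: computable_if; first exact: computable_occurs.
  apply: computable_filter => //; apply: computable_not; apply: computable_mem;
    repeat comp_base.
  by apply: (computable_comp hv); repeat comp_base.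
exact: computable_behead.
Qed.

Lemma computable_elim_vars (Z F : encType) (v : Z -> nat) (ps : Z -> seq (seq nat * F)) :
  computable v -> computable ps ->
  computable (fun z => elim_vars (v z) (ps z)).
Proof.
move=> hv hps; apply: computable_norm; apply: computable_flatten.
by apply: computable_map; [repeat comp_base|apply: computable_sel].
Qed.

Lemma computable_elim_pieces (Z F : encType) (comb : Z -> nat -> seq nat ->
  seq (seq nat * F) -> F)
    (st : Z -> nat * seq (seq nat * F)) (vs : Z -> seq nat) :
  computable (fun w : Z * nat * (seq nat * seq (seq nat * F)) =>
    comb w.1.1 w.1.2 w.2.1 w.2.2) ->
  computable st -> computable vs ->
  computable (fun z => elim_pieces (comb z) (st z) (vs z)).
Proof.
move=> hc hst hvs; apply: computable_foldl => //.
have hv : computable (fun w : Z * (nat * seq (seq nat * F)) * nat =>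
  w.2) by repeat comp_base.
have hps : computable (fun w : Z * (nat * seq (seq nat * F)) * nat =>
  w.1.2.2) by repeat comp_base.
have hU := computable_elim_vars hv hps; have hs := computable_sel hv hps.
apply: computable_pair; first by
  apply: computable_max; [repeat comp_base|apply: computable_size].
apply: computable_cons; last exact: computable_unsel.
apply: computable_pair.
  by apply: computable_filter hU; apply/computable_not/computable_eqn; repeat comp_base.
apply: (computable_comp hc (f := fun w : Z * (nat * seq (seq nat * F)) * nat =>
  (w.1.1, w.2, (elim_vars w.2 w.1.2.2, sel w.2 w.1.2.2)))).
by repeat comp_base.
Qed.

Lemma computable_fold1 (Z F : encType) (op : F -> F -> F) (d : Z -> F) (l : Z -> seq F) :
  computable (fun p : F * F => op p.1 p.2) -> computable d -> computable l ->
  computable (fun z => fold1 op (d z) (l z)).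
Proof.
move=> hop hd hl; apply: computable_foldl; last exact: computable_behead.
  by apply: (computable_app2 hop); repeat comp_base.
exact: computable_head.
Qed.

Lemma computable_build (Z : encType) (d : Z -> nat) (ats : Z -> seq raw_atom)
    (ox os : Z -> seq nat) :
  computable d -> computable ats -> computable ox -> computable os ->
  computable (fun z => build (code_ops (d z)) (ats z) (ox z) (os z)).
Proof.
move=> hd hats hox hos.
have hnpair2 (W : encType) n (f g : W -> nat) : computable f -> computable g ->
    computable (fun w => npair n (npair (f w) (g w))).
  by move=> hf hg; apply: computable_npair;
    [apply: computable_const|apply: computable_npair].
have hps0 : computable (fun z => pieces0 (code_ops (d z)) (ats z)).
  apply: computable_map => //; apply: computable_pair.
    by apply: computable_norm; rewrite /=; repeat comp_base.
  by apply: (@hnpair2); [rewrite /=; repeat comp_base|apply: computable_code;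
    rewrite /=; repeat comp_base].
have hph1 : computable (fun z => phase1 (code_ops (d z)) (ats z) (ox z)).
  apply: computable_elim_pieces hox.
    apply: (@hnpair2); first by rewrite /=; repeat comp_base.
    rewrite /=; apply: (@computable_fold1 _ _ (fun p q => npair 2 (npair p q))).
    - by apply: (@hnpair2); rewrite /=; repeat comp_base.
    - by apply: (computable_comp hd); rewrite /=; repeat comp_base.
    by apply: computable_map; rewrite /=; repeat comp_base.
  apply: computable_pair (hps0); apply: computable_foldl (hps0); last by rewrite /=;
    repeat comp_base.
  by apply: computable_max; [|apply: computable_size]; rewrite /=; repeat comp_base.
have htimes : computable (fun p : nat * nat => npair 3 (npair p.1 p.2)).
  by apply: (@hnpair2); rewrite /=; repeat comp_base.
have hph2 : computable (fun z => phase2 (code_ops (d z)) (ats z) (ox z) (os z)).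
  apply: (@computable_elim_pieces _ _ (fun z => comb_proj (code_ops (d z)))) hos.
    apply: (@hnpair2); first by
      apply: computable_code; apply: computable_cons; rewrite /=; repeat comp_base.
    apply: (@computable_fold1 _ _ (fun p q => npair 3 (npair p q))) => //;
      first by rewrite /=; repeat comp_base.
    apply: computable_map; last by rewrite /=; repeat comp_base.
    apply: (@hnpair2); last by rewrite /=; repeat comp_base.
    apply: computable_code; apply: computable_norm.
    apply: computable_filter; last by rewrite /=; repeat comp_base.
    by apply: computable_not; apply: computable_mem; rewrite /=; repeat comp_base.
  apply: computable_pair; first exact: computable_fst.
  apply: computable_map; last exact: computable_snd.
  apply: computable_pair; first by rewrite /=; repeat comp_base.
  apply: (@hnpair2); first by rewrite /=; repeat comp_base.
  by apply: computable_code; apply: computable_norm; rewrite /=; repeat comp_base.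
apply: computable_pair; first exact: computable_fst.
apply: (@computable_fold1 _ _ (fun p q => npair 3 (npair p q))) => //;
  first by rewrite /=; repeat comp_base.
by apply: computable_map; [rewrite /=; repeat comp_base|apply: computable_snd].
Qed.

Lemma computable_parse_code (Z : encType) (c : Z -> nat) : computable c ->
  computable (fun z => parse_code (c z)).
Proof.
move=> hc; have hit : computable (fun z =>
  (iter (c z).+1 parse_step ([:: c z], ([::], [::]))).2);
  last by apply: computable_pair;
    [apply: computable_fst|apply/computable_rev/computable_snd].
apply: computable_snd; apply: computable_iter; first exact: computable_succ; last first.
  by apply: computable_pair; [apply: computable_cons|]; repeat comp_base.
have un (W : encType) (f : W -> nat) : computable f -> computable (fun w => unpair (f w)).
  exact: computable_unpair.
apply: (@computable_lmatch _ _ _ (fun zst : Z * (seq nat * (seq nat * seq raw_atom)) =>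
  zst.2.1));
  try by repeat comp_base.
have hu : computable (fun w : Z * (seq nat * (seq nat * seq raw_atom)) * (nat * seq
  nat) => unpair w.2.1).
  by apply: (@un); repeat comp_base.
have hu2 : computable (fun w : Z * (seq nat * (seq nat * seq raw_atom)) * (nat * seq
  nat) =>
    unpair (unpair w.2.1).2).
  by apply: (@un); apply: computable_snd.
apply: computable_if; first by apply: computable_eq0; apply: computable_fst.
  apply: computable_pair; first by repeat comp_base.
  apply: computable_pair; first by repeat comp_base.
  apply: computable_cons; last by repeat comp_base.
  apply: computable_pair; first exact: computable_fst.
  by apply: computable_decode; apply: computable_snd.
apply: computable_if; first by
  apply: computable_eqn; [apply: computable_fst|apply: computable_const].
  apply: computable_pair; last by repeat comp_base.
  apply: computable_cons; first exact: computable_fst.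
  by apply: computable_cons; [apply: computable_snd|repeat comp_base].
apply: computable_pair.
  by apply: computable_cons; [apply: computable_snd|repeat comp_base].
apply: computable_pair; last by repeat comp_base.
by apply: computable_cons; [apply: computable_fst|repeat comp_base].
Qed.

Lemma computable_map_vars (Z : encType) (f : Z -> nat -> nat) (a : Z -> raw_atom) :
  computable (fun zv : Z * nat => f zv.1 zv.2) -> computable a ->
  computable (fun z => map_vars (f z) (a z)).
Proof.
move=> hf ha; apply: computable_pair; first exact: computable_fst.
by apply: computable_map hf _; apply: computable_snd.
Qed.

Lemma computable_raw_atoms (Z : encType) (c : Z -> nat) : computable c ->
  computable (fun z => raw_atoms (c z)).
Proof.
move=> hc; apply: computable_map; last by apply/computable_snd/computable_parse_code.
apply: (@computable_map_vars _ (fun za : Z * raw_atom =>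
  rename_apart (parse_code (c za.1)).1)).
  apply: computable_if.
  - apply: computable_mem; first by repeat comp_base.
    apply: computable_fst; apply: computable_parse_code; apply: (computable_comp hc).
    by repeat comp_base.
  - by apply: computable_succ; apply: computable_double; repeat comp_base.
  by apply: computable_double; repeat comp_base.
by repeat comp_base.
Qed.

Lemma computable_all_vars (Z : encType) (x : Z -> nat * seq nat) : computable x ->
  computable (fun z => all_vars (x z)).
Proof.
move=> hx; apply: computable_norm; apply: computable_cat.
  apply: computable_map.
    by apply: computable_succ; apply: computable_double; repeat comp_base.
  by apply/computable_fst/computable_parse_code/computable_fst.
apply: (@computable_map _ _ _ (fun=> double)); last exact: computable_snd.
by apply: computable_double; repeat comp_base.
Qed.

Lemma computable_lookup (Z : encType) (V hl : Z -> seq nat) (v : Z -> nat) :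
  computable V -> computable hl -> computable v ->
  computable (fun z => lookup (V z) (hl z) (v z)).
Proof.
move=> hV hhl hv; apply: computable_snd.
apply: (@computable_foldl Z nat_enc (prod_enc (seq_enc nat_enc) nat_enc) (fun z (st :
  seq nat * nat) u =>
  (behead st.1, if u == v z then head 0 st.1 else st.2))) => //; last first.
  by repeat comp_base.
apply: computable_pair; first by apply: computable_behead; repeat comp_base.
apply: computable_if; last by repeat comp_base.
  apply: computable_eqn; first by repeat comp_base.
  by apply: (computable_comp hv); repeat comp_base.
by apply: computable_head; repeat comp_base.
Qed.

Lemma computable_lists (Z : encType) (n : Z -> nat) (V : Z -> seq nat) :
  computable n -> computable V -> computable (fun z => lists (n z) (V z)).
Proof.
move=> hn hV; apply: (@eq_computable _ _ (fun z => iter (n z)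
  (fun L => flatten [seq [seq v :: l | l <- L] | v <- V z]) [:: [::]])).
  by move=> z; elim: (n z) => // k IH; rewrite iterS IH.
apply: computable_iter => //; last exact: computable_const.
apply: computable_flatten; apply: computable_map; last by
  apply: (computable_comp hV); repeat comp_base.
apply: computable_map; last by repeat comp_base.
by apply: computable_cons; repeat comp_base.
Qed.

Lemma computable_candidates (Z : encType) (V : Z -> seq nat) : computable V ->
  computable (fun z => candidates (V z)).
Proof.
move=> hV; have hL : computable (fun z => lists (size (V z)) (V z)).
  by apply: computable_lists => //; apply: computable_size.
apply: computable_flatten; apply: computable_map => //.
apply: computable_map; first by repeat comp_base.
by apply: (computable_comp hL); repeat comp_base.
Qed.

Lemma computable_valid (Z : encType) (x : Z -> nat * seq nat) (k : Z ->
  seq nat * seq nat) :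
  computable x -> computable k -> computable (fun z => valid (x z) (k z)).
Proof.
move=> hx hk; have hV := computable_all_vars hx.
have hA : computable (fun z =>
  raw_atoms (x z).1) by apply/computable_raw_atoms/computable_fst.
apply: computable_and.
  apply: computable_all => //; apply: computable_has; last by
    apply: (computable_comp hA); repeat comp_base.
  have hm : computable (fun w : Z * raw_atom * raw_atom =>
      map_vars (lookup (all_vars (x w.1.1)) (k w.1.1).1) w.1.2).
    apply: (@computable_map_vars _ (fun w : Z * raw_atom * raw_atom =>
      lookup (all_vars (x w.1.1)) (k w.1.1).1)); last by repeat comp_base.
    apply: computable_lookup; last by repeat comp_base.
      by apply: (computable_comp hV); repeat comp_base.
    by apply: computable_fst; apply: (computable_comp hk); repeat comp_base.
  apply: computable_and.
    by apply: computable_eqn; [apply: computable_fst|repeat comp_base].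
  apply: computable_eqn; apply: computable_code; first exact: computable_snd.
  by repeat comp_base.
apply: computable_and.
  apply: computable_all => //; apply: computable_or.
    by apply: computable_odd; repeat comp_base.
  apply: computable_has; last by apply: (computable_comp hV); repeat comp_base.
  apply: computable_and.
    by apply: computable_not; apply: computable_odd; repeat comp_base.
  apply: computable_eqn; last by repeat comp_base.
  apply: computable_lookup; last by repeat comp_base.
    by apply: (computable_comp hV); repeat comp_base.
  by apply: computable_fst; apply: (computable_comp hk); repeat comp_base.
apply: computable_all => //; apply: computable_mem; first by repeat comp_base.
by apply: computable_snd; apply: (computable_comp hk); repeat comp_base.
Qed.

Lemma computable_result (Z : encType) (x : Z -> nat * seq nat) (k : Z ->
  seq nat * seq nat) :
  computable x -> computable k -> computable (fun z => result (x z) (k z)).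
Proof.
move=> hx hk; have hV := computable_all_vars hx.
apply: computable_build; first exact: computable_fst.
- apply: computable_map; last by apply/computable_raw_atoms/computable_fst.
  apply: (@computable_map_vars _ (fun w : Z * raw_atom =>
    lookup (all_vars (x w.1)) (k w.1).1)); last by repeat comp_base.
  apply: computable_lookup; last by repeat comp_base.
    by apply: (computable_comp hV); repeat comp_base.
  by apply: computable_fst; apply: (computable_comp hk); repeat comp_base.
- apply: (@computable_filter _ _ (fun=> odd)); last exact: computable_snd.
  by apply: computable_odd; repeat comp_base.
apply: (@computable_filter _ _ (fun=> predC odd)); last exact: computable_snd.
by apply: computable_not; apply: computable_odd; repeat comp_base.
Qed.

Lemma computable_algorithm : computable algorithm.
Proof.
have hV := computable_all_vars (computable_id (prod_enc nat_enc (seq_enc nat_enc))).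
apply: computable_snd; apply: computable_foldl; last exact: computable_candidates.
  have hr : computable (fun w : nat * seq nat * (nat * nat) * (seq nat * seq nat) =>
    result w.1.1 w.2) by apply: computable_result; repeat comp_base.
  apply: computable_if => //; last by repeat comp_base.
  apply: computable_and; first by apply: computable_valid; repeat comp_base.
  by apply: computable_leq; [apply/computable_succ/computable_fst|repeat comp_base].
by apply: computable_result; [exact: computable_id|apply: computable_pair].
Qed.

End Computability.

(** * Correctness of the search *)

Definition raw tau (a : atom tau nat) : raw_atom := (nat_of_ord (tag a), avars a).

Lemma raw_inj tau : injective (@raw tau).
Proof.
move=> [R t] [R' t'] [/val_inj eq_R]; case: _ / eq_R t' => t' eq_t.
by congr existT; apply: val_inj.
Qed.

Lemma raw_amap tau f (a : atom tau nat) : raw (amap f a) = map_vars f (raw a).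
Proof. by []. Qed.

Lemma leq_npair a b : (a + b)%N <= npair a b.
Proof.
rewrite -ltnS /npair prednK ?muln_gt0 ?expn_gt0 //.
apply: leq_trans (leq_mul (ltn_expl a (isT : 1 < 2)) (leqnn _)).
by rewrite mulSn addSn ltnS addnC leq_add // ?leq_pmulr // -addnn leq_addr.
Qed.

Section Parse.
Variable tau : signature.

Fixpoint parse_time (phi : fo tau) : nat :=
  match phi with
  | And phi phi' => (parse_time phi + parse_time phi').+1
  | Ex _ phi => (parse_time phi).+1
  | _ => 1
  end.

(** A tag of at least 2 raises the code by at least two. For a conjunction this pays for the two
    successors in the bounds of its parts. *)
Lemma parse_time_code (phi : fo tau) : parse_time phi <= (code_fo phi).+1.
Proof.
have npair_gt n m : 1 < n -> m.+2 <= npair n m.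
  move=> n1; rewrite -ltnS /npair prednK ?muln_gt0 ?expn_gt0 //.
  have le4 : 4 <= 2 ^ n by rewrite -[4]/(2 ^ 2) leq_exp2l.
  apply: leq_trans (leq_mul le4 (leqnn _)); rewrite mulnS -[m.+3]/(3 + m)%N.
  by rewrite leq_add // -addnn mulnDr (leq_trans _ (leq_addr _ _)) // leq_pmull.
elim: phi => //= [phi IH phi' IH'|x phi IH]; rewrite ltnS.
  apply: leq_trans (leq_add IH IH') _; rewrite addSn addnS.
  by apply: leq_trans (npair_gt _ _ _) => //; rewrite !ltnS leq_npair.
apply: leq_trans IH _; apply: leq_trans (npair_gt _ _ _) => //.
by rewrite ltnS ltnW // ltnS; apply: leq_trans (leq_npair _ _); apply: leq_addl.
Qed.

Lemma parse_step_atom R vs stack bs ats :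
  parse_step (npair 0 (npair R (CodeSeq.code vs)) :: stack, (bs, ats))
  = (stack, (bs, (R, vs) :: ats)).
Proof. by rewrite /parse_step /= npairK /= npairK /= CodeSeq.codeK. Qed.

Lemma parse_step_and c c' stack st :
  parse_step (npair 2 (npair c c') :: stack, st) = ([:: c, c' & stack], st).
Proof. by rewrite /parse_step /= npairK /= npairK. Qed.

Lemma parse_step_ex x c stack bs ats :
  parse_step (npair 4 (npair x c) :: stack, (bs, ats)) = (c :: stack, (x :: bs, ats)).
Proof. by rewrite /parse_step /= npairK /= npairK. Qed.

Lemma parse_conj (phi : fo tau) stack bs ats : is_conjunction_of_atoms phi ->
  iter (parse_time phi) parse_step (code_fo phi :: stack, (bs, ats))
  = (stack, (bs, catrev (map (@raw tau) (pp_atoms phi)) ats)).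
Proof.
elim: phi stack ats => //= [R vs|phi IH phi' IH'] stack ats.
  by move=> _; rewrite parse_step_atom.
move=> /andP[c c']; rewrite -iterS iterSr parse_step_and.
by rewrite addnC iterD IH // IH' // map_cat catrev_catl.
Qed.

Lemma parse_prenex (phi : fo tau) stack bs ats : is_prenex_pp phi ->
  iter (parse_time phi) parse_step (code_fo phi :: stack, (bs, ats))
  = (stack, (catrev (bound_vars phi) bs, catrev (map (@raw tau) (pp_atoms phi)) ats)).
Proof.
move=> pp; elim/prenex_ind: phi / pp bs => [phi c bs0|x phi _ IH] bs.
  by rewrite parse_conj // bs0.
by rewrite [parse_time _]/= iterSr [code_fo _]/= parse_step_ex IH.
Qed.

Lemma parse_codeE (phi : fo tau) : is_prenex_pp phi ->
  parse_code (code_fo phi) = (rev (bound_vars phi), map (@raw tau) (pp_atoms phi)).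
Proof.
move=> pp; rewrite /parse_code -(subnK (parse_time_code phi)) iterD parse_prenex //.
have nil_fix n b : iter n parse_step ([::], b) = ([::], b).
  by elim: n => // n IH; rewrite iterS IH.
by rewrite nil_fix /= /rev -/(rev (rev _)) revK.
Qed.

End Parse.

Section Coding.
Variables (tau : signature) (phi : fo tau) (S : {fset var}).
Hypothesis pp : is_prenex_pp phi.
Hypothesis phiS : fo_free phi `<=` S.

Let x : nat * seq nat := (code_fo phi, sort leq (enum_fset S)).
Let V := all_vars x.

Lemma raw_atomsE : raw_atoms x.1 = map (@raw tau) (apart_atoms phi).
Proof.
rewrite /raw_atoms parse_codeE //= /apart_atoms -!map_comp; apply: eq_map => a /=.
rewrite /raw avars_amap /map_vars /=; congr (_, _); apply: eq_map => v.
by rewrite /rename_apart mem_rev.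
Qed.

Lemma mem_all_vars v : (v \in V) = if odd v then v./2 \in bound_vars phi else v./2 \in S.
Proof.
rewrite mem_norm mem_cat parse_codeE //=; apply/orP/idP.
  case=> /mapP[u]; rewrite ?mem_rev ?mem_sort => uin ->.
    by rewrite /= odd_double /= uphalf_double.
  by rewrite odd_double doubleK.
case: ifP => ov vin; [left|right]; apply/mapP; exists v./2.
- by rewrite mem_rev.
- by rewrite -[LHS]odd_double_half ov.
- by rewrite mem_sort.
by rewrite -[LHS]odd_double_half ov.
Qed.

Lemma apart_atoms_all_vars : all (fun a => all [in V] (avars a)) (apart_atoms phi).
Proof.
apply/allP => a /mapP[b bP ->]; apply/allP => v; rewrite avars_amap => /mapP[u ub ->].
rewrite /= mem_all_vars /rename_apart; case: (boolP (u \in bound_vars phi)) => ubd.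
  by rewrite /= odd_double /= uphalf_double.
rewrite odd_double doubleK; apply: (fsubsetP phiS).
by rewrite prenex_free // ubd andbT; apply/hasP; exists b.
Qed.

(** The input formula itself is the default of the folds, because its code is available to the
    program as [x.1]. *)
Definition typed_result (k : seq nat * seq nat) : nat * sharp tau :=
  build (typed_ops phi) (map (amap (lookup V k.1)) (apart_atoms phi))
    (filter odd k.2) (filter (predC odd) k.2).

Lemma resultE k : result x k = ((typed_result k).1, code_sharp (typed_result k).2).
Proof.
rewrite /result raw_atomsE -map_comp.
rewrite (eq_map (g := @raw tau \o amap (lookup V k.1))) // map_comp.
apply: (build_morph (fF := @code_fo tau)) => // [p l|v p|l p].
- by rewrite /= code_vars_fset.
- rewrite /= (_ : code_vars [fset v] = CodeSeq.code [:: v]) //.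
  rewrite /code_vars (_ : enum_fset [fset v] = [:: v]) //.
  apply: perm_small_eq => //; apply: uniq_perm => // u.
  by rewrite -[LHS]/(u \in [fset v]) !inE.
by rewrite /= code_vars_fset.
Qed.

Lemma validE k : valid x k =
  [&& all (fun a => amap (lookup V k.1) a \in apart_atoms phi) (apart_atoms phi),
      all (fun v => odd v || has (fun u => ~~ odd u && (lookup V k.1 u == v)) V) V
    & all (fun v => v \in k.2) V].
Proof.
rewrite /valid raw_atomsE all_map; congr (_ && _); apply: eq_all => a /=.
rewrite -(mem_map (@raw_inj tau)) raw_amap.
rewrite -has_pred1; apply: eq_has => -[R vs]; rewrite /eq_raw_atom /map_vars /=.
by rewrite xpair_eqE (inj_eq (can_inj CodeSeq.codeK)) eq_sym [X in _ && X]eq_sym.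
Qed.

Lemma typed_result_correct k : size k.2 = size V -> valid x k ->
  sharpPP_representation (typed_result k).2 phi S /\
  width (typed_result k).2 <= (typed_result k).1.
Proof.
move=> size_k; rewrite validE => /and3P[h_ats h_even /allP Vk].
have uV : uniq V by apply: norm_uniq.
have [uk kV] : uniq k.2 /\ k.2 =i V.
  have [_ eq_k] := uniq_min_size uV Vk (eq_leq size_k).
  by split=> [|v]; rewrite ?eq_k // -(eq_uniq (esym size_k) eq_k).
have osS v : (v \in filter (predC odd) k.2) = ~~ odd v && (v./2 \in S).
  by rewrite mem_filter kV mem_all_vars /=; case: (odd v).
have oxE v : (v \in filter odd k.2) = odd v && (v./2 \in bound_vars phi).
  by rewrite mem_filter kV mem_all_vars /=; case: (odd v).
have cov : all (fun a => all [in filter odd k.2 ++ filter (predC odd) k.2] (avars a))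
    (map (amap (lookup V k.1)) (apart_atoms phi)).
  rewrite all_map; apply/allP => a /(allP h_ats) ha; apply/allP => v va.
  have := allP (allP apart_atoms_all_vars _ ha) v va.
  by rewrite /= mem_cat (mem_filter odd) (mem_filter (predC odd)) !kV => ->;
    rewrite !andbT /= orbN.
split.
  apply: representation => //; first by rewrite filter_uniq.
  move=> v; rewrite mem_filter kV /= => /andP[ev vV].
  have := allP h_even v vV; rewrite (negPf ev) /= => /hasP[u uV' /andP[eu /eqP eq_u]].
  by exists u; rewrite // mem_filter kV /= eu.
have [||_ _ //] := @build_correct tau phi (map (amap (lookup V k.1)) (apart_atoms phi))
  (filter odd k.2) (filter (predC odd) k.2) _ _ cov.
  by rewrite !size_map prenex_atoms_neq0.
by rewrite filter_uniq.
Qed.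

Lemma typed_result_width w k : 
  elimok w predT (map (@avars tau nat) (map (amap (lookup V k.1)) (apart_atoms phi)))
    (filter odd k.2 ++ filter (predC odd) k.2) ->
  (typed_result k).1 <= w.
Proof. exact: (@build_width _ _ _ (typed_ops phi)). Qed.

Lemma lookup_map h v : v \in V -> lookup V (map h V) v = h v.
Proof.
rewrite /lookup; suff H s r : (foldl (fun st u =>
    (behead st.1, if u == v then head 0 st.1 else st.2)) (map h s, r) s).2
    = if v \in s then h v else r by rewrite H => ->.
elim: s r => //= u s IH r; rewrite IH inE eq_sym.
by case: eqP => [->|]; case: (_ \in s).
Qed.

Lemma mem_lists n l : (l \in lists n V) = (size l == n) && all [in V] l.
Proof.
elim: n l => [|n IH] l /=; first by rewrite inE; case: l.
apply/flattenP/idP => [[s /mapP[v vV ->] /mapP[l' l'n ->]]|].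
  by move: l'n; rewrite IH /= vV eqSS => /andP[-> ->].
case: l => // v l /=; rewrite eqSS => /andP[sz /andP[vV lV]].
exists [seq v :: l | l <- lists n V]; first exact: map_f.
by apply: map_f; rewrite IH sz.
Qed.

Lemma mem_candidates k : (k \in candidates V) =
  [&& size k.1 == size V, all [in V] k.1, size k.2 == size V & all [in V] k.2].
Proof.
case: k => hl vs /=; rewrite /candidates; apply/flattenP/idP.
  move=> [s /mapP[hl' + ->] /mapP[vs' + [-> ->]]]; rewrite !mem_lists.
  by move=> /andP[-> ->] /andP[-> ->].
rewrite andbA -!mem_lists => /andP[hlL vsL].
exists [seq (hl, vs) | vs <- lists (size V) V]; last exact: map_f.
by apply: (map_f (fun hl => [seq (hl, vs) | vs <- lists (size V) V])).
Qed.

Lemma lookup_id v : v \in V -> lookup V V v = v.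
Proof. by move=> vV; have := lookup_map id vV; rewrite map_id. Qed.

Lemma valid_id : valid x (V, V).
Proof.
rewrite validE /=; apply/and3P; split; last exact/allP.
  apply/allP => a aP; suff -> : amap (lookup V V) a = a by [].
  have := allP apart_atoms_all_vars a aP; case: a {aP} => R t /allP tV.
  rewrite /amap /=; congr existT; apply: eq_from_tnth => i; rewrite tnth_map.
  by apply/lookup_id/tV/mem_tnth.
apply/allP => v vV; case: (boolP (odd v)) => //= ev; apply/hasP; exists v => //.
by rewrite ev lookup_id ?eqxx.
Qed.

End Coding.

Lemma foldl_min (K : eqType) (R : Type) (f : K -> nat * R) (a : pred K) k0 (s : seq K) :
  let r := foldl (fun r k => if a k && ((f k).1 < r.1) then f k else r) (f k0) s in
  [/\ exists2 k, k = k0 \/ k \in s /\ a k & r = f k,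
      r.1 <= (f k0).1 & {in s, forall k, a k -> r.1 <= (f k).1}].
Proof.
elim: s k0 => [|k s IH] k0 /=; first by split=> //; exists k0; first by left.
set k1 := if a k && ((f k).1 < (f k0).1) then k else k0.
have -> : (if a k && ((f k).1 < (f k0).1) then f k else f k0) = f k1.
  by rewrite /k1; case: ifP.
have [[k' k'in eq_r] le1 le_s] := IH k1.
have le0 : (f k1).1 <= (f k0).1.
  by rewrite /k1; case: ifP => // /andP[_ /ltnW].
split; first exists k' => //.
- case: k'in => [->|[k's ak']]; last by right; rewrite inE k's orbT.
  by rewrite /k1; case: ifP => [/andP[ak _]|_]; [right; rewrite mem_head|left].
- exact: leq_trans le1 le0.
move=> k2; rewrite inE => /orP[/eqP-> ak|k2s ak2]; last exact: le_s.
apply: leq_trans le1 _; rewrite /k1 ak /=.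
by case: ltnP.
Qed.

Theorem theorem4p2 :
  exists algo : recfun,
    forall (tau : signature) (phi : fo tau) (S : {fset var}),
      is_prenex_pp phi -> fo_free phi `<=` S ->
      exists psi : sharp tau,
        [/\ computes algo (code_input phi S) (code_sharp psi),
            sharpPP_representation psi phi S
          & forall psi' : sharp tau,
              sharpPP_representation psi' phi S -> width psi <= width psi'].
Proof.
have [algo algoP] := computable_algorithm; exists algo => tau phi S pp phiS.
pose x : nat * seq nat := (code_fo phi, sort leq (enum_fset S)).
pose V := all_vars x.
have [[k k_cand best_k] best_id best] :=
  foldl_min (result x) (valid x) (V, V) (candidates V).
set r := foldl _ _ _ in best_k best_id best.
have [size_k valid_k] : size k.2 = size V /\ valid x k.
  case: k_cand => [-> //|[+ ->]]; first by split=> //; apply: valid_id.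
  by rewrite mem_candidates => /and4P[_ _ /eqP ->].
have [repr_k width_k] := typed_result_correct pp phiS size_k valid_k.
have r1 : r.1 = (typed_result phi S k).1 by rewrite best_k (resultE S pp).
exists (typed_result phi S k).2; split=> //.
  have -> : code_sharp (typed_result phi S k).2 = algorithm x.
    by rewrite /algorithm -/V -/r best_k (resultE S pp).
  have -> : code_input phi S = enc x by rewrite /code_input /= map_id.
  exact: algoP.
move=> psi' [sharp_psi' [_ closed_psi' psi'P]].
(* It remains to bound the number reported by the search, and for this one valid candidate of cost
   at most [width psi'] is enough. *)
apply: leq_trans width_k _; rewrite -r1.
case EV : V => [|v0 V'].
  apply: leq_trans best_id _; rewrite (resultE S pp); apply: (@leq_trans 0) => //.
  apply: typed_result_width; rewrite -/V EV /=.
  have nil_vars : all (fun a =>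
    nilp (avars a)) (map (amap (lookup [::] [::])) (apart_atoms phi)).
    rewrite all_map; apply/allP => a aP /=;
      have := allP (apart_atoms_all_vars pp phiS) a aP.
    rewrite -/x -/V EV /nilp avars_amap size_map.
    by case: (avars a) => //= v s.
  apply/andP; split; last by apply/allP => e _; apply/allP.
  by rewrite all_map; apply: sub_all nil_vars => a /nilP /= ->.
have v0V : v0 \in V by rewrite EV mem_head.
have SV v : ~~ odd v -> (v \in V) = (v./2 \in S).
  by move=> /negPf ev; rewrite mem_all_vars // ev.
have uV : uniq V by apply: norm_uniq.
have inst (B : structure tau) : (exists b : B, True) ->
    ((nanswers (inst_pair (apart_atoms phi) (SeqSub v0V) SV) B)%:Z)%R
    = sh_eval psi' ([fmap] : {fmap var -> B}).
  move=> [b _]; rewrite -psi'P; congr (_%:Z)%R; apply: eq_card => f.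
  rewrite inE; apply: (sameP _ (apart_solves b f pp phiS)).
  exact: (inst_answerP (SeqSub v0V) (apart_atoms_all_vars pp phiS) SV).
have [h [vs [h_ats hV h_even perm_vs ok]]] :=
  order_of_representation uV (apart_atoms_all_vars pp phiS) sharp_psi' closed_psi' inst.
(* The endomorphism extracted from [psi'] is a function on all numbers. The search sees only its
   table on [V], which agrees with it on every atom. *)
have lookup_h a : a \in apart_atoms phi -> amap (lookup V (map h V)) a = amap h a.
  move=> aP; have := allP (apart_atoms_all_vars pp phiS) a aP;
    case: a {aP} => R t /allP tV.
  rewrite /amap /=; congr existT; apply: eq_from_tnth => i; rewrite !tnth_map.
  by apply/lookup_map/tV/mem_tnth.
have k'_cand : (map h V, vs) \in candidates V.
  rewrite mem_candidates /= size_map eqxx (perm_size perm_vs) eqxx /=.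
  apply/andP; split; last by apply/allP => v; rewrite (perm_mem perm_vs).
  by apply/allP => _ /mapP[v vV ->]; apply: hV.
have k'_valid : valid x (map h V, vs).
  rewrite validE //= -/V; apply/and3P; split.
  - by apply/allP => a aP; rewrite lookup_h // (allP h_ats).
  - apply/allP => v vV; case: (boolP (odd v)) => //= ev.
    have [u uV' [eu eq_u]] := h_even v vV ev.
    by apply/hasP; exists u; rewrite // eu lookup_map ?eq_u ?eqxx.
  by apply/allP => v; rewrite (perm_mem perm_vs).
apply: leq_trans (best _ k'_cand k'_valid) _; rewrite (resultE S pp).
apply: typed_result_width => /=; rewrite -/V.
have -> : map (amap (lookup V (map h V))) (apart_atoms phi) = map (amap h) (apart_atoms
  phi).
  exact/eq_in_map.
exact: ok.
Qed.
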